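(* Let $G$ be a connected noncompact semisimple real Lie group with finite center, with the notation $K,H,A,A^+,\Delta_\sigma,\mathcal W$ described in the context, and fix a Riemannian metric on $G$; let $\mathcal O_\varepsilon$ be the open $\varepsilon$-ball about the identity $e$. Given $c>0$, there exist $\ell>1$ and $\varepsilon_0>0$ such that for every $k\in K$, $a\in A^+$, $w\in\mathcal W$, $h\in H$ with $\alpha(\log a)\ge c$ for all $\alpha\in\Delta_\sigma$, setting $g=kawh$, and every $0<\varepsilon<\varepsilon_0$, $$\mathcal O_\varepsilon\cdot g\subset (K\cap\mathcal O_{\ell\varepsilon})k\cdot(A\cap\mathcal O_{\ell\varepsilon})a\cdot w\,(H\cap\mathcal O_{\ell\varepsilon})h.$$
   Context: Let $\sigma$ be an involution of $G$ and $H$ a closed subgroup of $G$ whose identity component coincides with the identity component of $\{g\in G:\sigma(g)=g\}$. Let $\theta$ be a Cartan involution of $G$ commuting with $\sigma$ and $K=\{g:\theta(g)=g\}$. Denote the Lie algebras of $G,H,K$ by $\mathfrak g,\mathfrak h,\mathfrak k$ and the differentials of $\sigma,\theta$ by the same letters; $\mathfrak g=\mathfrak k\oplus\mathfrak p=\mathfrak h\oplus\mathfrak q$ where $\mathfrak p,\mathfrak q$ are the $(-1)$-eigenspaces of $\theta,\sigma$. Let $\mathfrak a$ be a maximal abelian subspace of $\mathfrak p\cap\mathfrak q$ contained in a maximal abelian subspace $\mathfrak b$ of $\mathfrak p$, and $A=\exp\mathfrak a$. For $\alpha\in\mathfrak a^*$ let $\mathfrak g^\alpha$ be the joint eigenspace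 of $\operatorname{ad}\mathfrak a$ with character $\alpha$, and $\Sigma_\sigma=\{\alpha\neq0:\mathfrak g^\alpha\neq0\}$ (a root system). Fix a closed positive Weyl chamber $A^+\subset A$, with positive roots $\Sigma_\sigma^+$ and simple roots $\Delta_\sigma$. Let $\mathcal W\subset N_K(\mathfrak a)\cap N_K(\mathfrak b)$ be a set of coset representatives of $N_K(\mathfrak a)/N_{K\cap H}(\mathfrak a)Z_K(\mathfrak a)$; then $G=\bigcup_{w\in\mathcal W}KA^+wH$. *)

(* Defs.v *)
From HB Require Import structures.
From mathcomp Require Import all_boot all_order all_algebra.
From mathcomp Require Import all_classical all_reals all_analysis.

Set Implicit Arguments.
Unset Strict Implicit.
Unset Printing Implicit Defensive.

Import Order.TTheory GRing.Theory Num.Theory.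
Import numFieldNormedType.Exports.

Local Open Scope classical_set_scope.
Local Open Scope ring_scope.

HB.mixin Record isTopologicalGroup G of Group G & Topological G := {
  mulg_continuous : continuous (fun p : G * G => (p.1 * p.2)%g);
  invg_continuous : continuous (fun x : G => (x^-1)%g)
}.

#[short(type="topologicalGroupType")]
HB.structure Definition TopologicalGroup :=
  { G of isTopologicalGroup G & Group G & Topological G }.

Definition set_mulg (G : topologicalGroupType) (S T : set G) : set G :=
  [set (x * y)%g | x in S & y in T].

Notation "S ** T" := (set_mulg S T)
  (at level 40, left associativity) : classical_set_scope.

(** * Smooth maps between open subsets of finite-dimensional normed spaces *)

(* [U] is meant to be open and [V] finite-dimensional: [f] is then C^(k+1) iff
   it is differentiable and all its directional derivatives are C^k. *)
Fixpoint Ck (R : realType) (V W : normedModType R) (k : nat)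
    (U : set V) (f : V -> W) : Prop :=
  match k with
  | 0 => forall x, U x -> {for x, continuous f}
  | k'.+1 => (forall x, U x -> differentiable f x) /\
             (forall v, Ck k' U (fun x => 'd f x v))
  end.

Definition smooth_on (R : realType) (V W : normedModType R)
    (U : set V) (f : V -> W) : Prop := forall k, Ck k U f.

(** * Manifolds, given by a preferred chart at every point *)

Record chart (R : realType) (E : normedModType R) (M : topologicalType) := Chart {
  cdom : set M;
  cfun : M -> E;
  cinv : E -> M
}.

Definition is_chart (R : realType) (E : normedModType R) (M : topologicalType)
    (c : chart E M) : Prop :=
  [/\ open (cdom c), open (cfun c @` cdom c),
      (forall x, cdom c x -> cinv c (cfun c x) = x),
      {within cdom c, continuous (cfun c)} &
      {within cfun c @` cdom c, continuous (cinv c)}].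

Definition atlas (R : realType) (E : normedModType R) (M : topologicalType) :=
  M -> chart E M.

Definition model_atlas (R : realType) (E : normedModType R) : atlas E E :=
  fun _ => Chart setT id id.

Definition prod_atlas (R : realType) (E F : normedModType R)
    (M N : topologicalType) (AM : atlas E M) (AN : atlas F N) :
    atlas (E * F)%type (M * N)%type :=
  fun p => Chart (cdom (AM p.1) `*` cdom (AN p.2))
    (fun q => (cfun (AM p.1) q.1, cfun (AN p.2) q.2))
    (fun u => (cinv (AM p.1) u.1, cinv (AN p.2) u.2)).

Definition is_manifold (R : realType) (E : normedModType R)
    (M : topologicalType) (A : atlas E M) : Prop :=
  [/\ hausdorff_space M, @second_countable M,
      (forall x, is_chart (A x) /\ cdom (A x) x) &
      forall x y, smooth_on (cfun (A x) @` (cdom (A x) `&` cdom (A y)))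
                            (cfun (A y) \o cinv (A x))].

Definition Ck_map (R : realType) (E F : normedModType R)
    (M N : topologicalType) (AM : atlas E M) (AN : atlas F N)
    (k : nat) (f : M -> N) : Prop :=
  continuous f /\
  forall x, Ck k (cfun (AM x) @` (cdom (AM x) `&` f @^-1` cdom (AN (f x))))
                 (cfun (AN (f x)) \o f \o cinv (AM x)).

Definition smooth_map (R : realType) (E F : normedModType R)
    (M N : topologicalType) (AM : atlas E M) (AN : atlas F N)
    (f : M -> N) : Prop := forall k, Ck_map AM AN k f.

(* The tangent space at [x] is the model space, seen through the chart at [x];
   [tangent_map] is the differential of [f] at [x] in these identifications. *)
Definition tangent_map (R : realType) (E F : normedModType R)
    (M N : topologicalType) (AM : atlas E M) (AN : atlas F N)
    (f : M -> N) (x : M) : E -> F :=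
  'd (cfun (AN (f x)) \o f \o cinv (AM x)) (cfun (AM x) x).

(** * Lie groups *)

Definition is_lie_group (R : realType) (n : nat) (G : topologicalGroupType)
    (A : atlas 'rV[R]_n G) : Prop :=
  [/\ is_manifold A,
      smooth_map (prod_atlas A A) A (fun p : G * G => (p.1 * p.2)%g) &
      smooth_map A A (fun x : G => (x^-1)%g)].

Section LieGroup.
Context (R : realType) (n : nat) (G : topologicalGroupType).
Variable A : atlas 'rV[R]_n G.

(* The Lie algebra is the tangent space at the identity. *)
Local Notation g := 'rV[R]_n.

Definition Ad (x : G) : g -> g :=
  tangent_map A A (fun y => x * y * x^-1)%g 1%g.

(* [X, Y] = ad X Y, where ad is the differential of Ad at the identity. *)
Definition bracket (X Y : g) : g :=
  tangent_map A (@model_atlas R g) (fun x => Ad x Y) 1%g X.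

Definition one_param_subgroup (X : g) (gam : R -> G) : Prop :=
  [/\ smooth_map (@model_atlas R R) A gam,
      (forall s t, gam (s + t) = gam s * gam t)%g &
      tangent_map (@model_atlas R R) A gam 0 1 = X].

Definition lexp (X : g) : G :=
  xget 1%g [set x | exists gam, one_param_subgroup X gam /\ gam 1 = x].

Definition killing (X Y : g) : R :=
  \tr (lin1_mx (bracket X) *m lin1_mx (bracket Y)).

Definition comm_space (U V : {vspace g}) : {vspace g} :=
  <<[seq bracket X Y | X <- vbasis U, Y <- vbasis V]>>%VS.

Definition solvable_space (U : {vspace g}) : Prop :=
  exists k, iter k (fun V => comm_space V V) U = 0%VS.

Definition is_ideal (U : {vspace g}) : Prop :=
  forall X Y, Y \in U -> bracket X Y \in U.

Definition semisimple_lie_algebra : Prop :=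
  forall U, is_ideal U -> solvable_space U -> U = 0%VS.

Definition group_center : set G := [set z | forall x, (z * x = x * z)%g].

Definition is_closed_subgroup (H : set G) : Prop :=
  [/\ closed H, H 1%g, (forall x y, H x -> H y -> H (x * y)%g) &
      (forall x, H x -> H (x^-1)%g)].

Definition is_involution (s : G -> G) : Prop :=
  [/\ smooth_map A A s, (forall x y, s (x * y) = s x * s y)%g &
      forall x, s (s x) = x].

Definition fixed_group (s : G -> G) : set G := [set x | s x = x].

Definition differential (s : G -> G) : g -> g := tangent_map A A s 1%g.

Definition is_cartan_involution (t : G -> G) : Prop :=
  is_involution t /\
  forall X, X != 0 -> 0 < - killing X (differential t X).

Definition minus_eigenspace (s : G -> G) : set g :=
  [set X | differential s X = - X].

Definition abelian_subspace (S : set g) (a : {vspace g}) : Prop :=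
  (forall X, X \in a -> S X) /\
  (forall X Y, X \in a -> Y \in a -> bracket X Y = 0).

Definition maximal_abelian_subspace (S : set g) (a : {vspace g}) : Prop :=
  abelian_subspace S a /\
  forall b, abelian_subspace S b -> (a <= b)%VS -> b = a.

(** ** Roots, chambers and the group A *)
Section Roots.
Variable a : {vspace g}.

Definition dual_space := 'Hom(subvs_of a, R^o).

(* Only meaningful for [X] in [a]. *)
Definition deval (alpha : dual_space) (X : g) : R := alpha (vsproj a X).

Definition root_space (alpha : dual_space) : set g :=
  [set X | forall Y, Y \in a -> bracket Y X = deval alpha Y *: X].

Definition is_root (alpha : dual_space) : Prop :=
  alpha != 0 /\ exists X, root_space alpha X /\ X != 0.

Definition regular_set : set g :=
  [set X | X \in a /\ forall alpha, is_root alpha -> deval alpha X != 0].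

Definition is_open_chamber (C : set g) : Prop :=
  exists2 X, regular_set X & C = connected_component regular_set X.

Definition positive_root (C : set g) (alpha : dual_space) : Prop :=
  is_root alpha /\ forall X, C X -> 0 < deval alpha X.

Definition simple_root (C : set g) (alpha : dual_space) : Prop :=
  positive_root C alpha /\
  ~ exists beta gamma,
      [/\ positive_root C beta, positive_root C gamma & alpha = beta + gamma].

Definition Agroup : set G := lexp @` [set` a].

Definition Aplus (C : set g) : set G := lexp @` closure C.

(* The inverse of [lexp : a -> A]. *)
Definition logA (x : G) : g := xget 0 [set X | X \in a /\ lexp X = x].

Definition normalizer_in (S : set G) : set G :=
  [set x | S x /\ Ad x @` [set` a] = [set` a]].

Definition centralizer_in (S : set G) : set G :=
  [set x | S x /\ forall X, X \in a -> Ad x X = X].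

End Roots.

(* [W] contains exactly one element of each left coset [x L] with [x] in [N]. *)
Definition is_coset_reps (N L W : set G) : Prop :=
  W `<=` N /\ forall x, N x -> exists! w, W w /\ L (w^-1 * x)%g.

(** ** Riemannian metrics *)

Definition inner (m : G -> 'M[R]_n) (x : G) (u v : g) : R :=
  (u *m m x *m v^T) 0 0.

(* [m x] is the Gram matrix at [x] in the chart at [x]; smoothness is that of
   the coefficients of the metric in each chart of the atlas. *)
Definition is_riemannian_metric (m : G -> 'M[R]_n) : Prop :=
  [/\ (forall x, (m x)^T = m x),
      (forall x v, v != 0 -> 0 < inner m x v v) &
      forall (x0 : G) (u v : g),
        @smooth_on R g R (cfun (A x0) @` cdom (A x0)) (fun y =>
          let x := cinv (A x0) y in
          inner m x ('d (cfun (A x) \o cinv (A x0)) y u)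
                    ('d (cfun (A x) \o cinv (A x0)) y v))].

Definition curve_length (m : G -> 'M[R]_n) (gam : R -> G) : R :=
  \int[lebesgue_measure]_(t in `[0, 1]%classic)
    (let v := tangent_map (@model_atlas R R) A gam t 1 in
     Num.sqrt (inner m (gam t) v v)).

(* [piecewise_path m x y L]: some piecewise C^1 curve from [x] to [y] has length
   [L]; each C^1 piece is parametrized by [0, 1]. *)
Inductive piecewise_path (m : G -> 'M[R]_n) : G -> G -> R -> Prop :=
| path_nil x : piecewise_path m x x 0
| path_cons gam y L :
    Ck_map (@model_atlas R R) A 1 gam -> piecewise_path m (gam 1) y L ->
    piecewise_path m (gam 0) y (curve_length m gam + L).

Definition riemannian_dist (m : G -> 'M[R]_n) (x y : G) : R :=
  inf [set L | piecewise_path m x y L].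

Definition identity_ball (m : G -> 'M[R]_n) (eps : R) : set G :=
  [set x | riemannian_dist m 1%g x < eps].

End LieGroup.

(* Main.v *)
(** The statement is linearized: after conjugating by [k], every
    [X] in the Lie algebra must be split as [X = U + V + Ad x Ad w Y] with [U], [V], [Y] in
    the Lie algebras of K, A, H. For a root vector of [a] on which [ad (log x)] acts by
    [t], such a splitting has coefficients of size [1 / (e^|t| - e^-|t|)], and [|t| >= c]
    because every root is up to sign a sum of simple roots; on the centralizer of [a] it
    follows from the maximality of [a]. Hence [U], [V], [Y] and [Ad x Ad w Y] depend
    linearly on [X] with a norm bound independent of [x] and [w], so that in the chart
    [X |-> exp (U X) exp (V X) exp (Ad x Ad w Y X)] is a perturbation of the identity with
    Lipschitz constant 1/2 on a ball independent of [x] and [w], and covers a smaller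
    ball. Near the identity, Riemannian balls and balls of exponential coordinates are
    comparable, and [Ad k] is bounded uniformly in [k]. *)

Require Import Defs.
From HB Require Import structures.
From mathcomp Require Import all_boot all_order all_algebra.
From mathcomp Require Import all_classical all_reals all_analysis.
From mathcomp Require Import lra ring.

Set Implicit Arguments.
Unset Strict Implicit.
Unset Printing Implicit Defensive.

Import Order.TTheory GRing.Theory Num.Theory.
Import numFieldNormedType.Exports.

Local Open Scope classical_set_scope.
Local Open Scope ring_scope.

(** The obstacle is that [A^+] is not compact: [Ad x] is unbounded, so compactness gives nothing
    uniform in [x]. Moreover [Y] and [Ad x Ad w Y] can have very different sizes, and both matter:
    the first for the ball in [H], the second for the perturbation of the identity. Both are
    therefore estimated. In an eigenvector splitting they cost at most [e^|t| / (e^|t| - e^-|t|)],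
    which [|t| >= c] bounds by [1 / (1 - e^(-2 c))]. Uniformity in [x] and [w] comes from an
    eigenbasis for all [ad Y] with [Y] in [a], fixed beforehand. It exists because these commuting
    operators are symmetric for the inner product attached to the Cartan involution. Only the
    splittings of its finitely many vectors vary with [x] and [w]; coefficients in the basis extend
    them to all of the Lie algebra. The facts used about the exponential map all rest on one
    principle: a sequence of successive square roots in the group, tending to the identity, is
    determined by its initial velocity. Naturality, the addition law on a line and the comparison
    with one-parameter subgroups are instances of this uniqueness. *)

Ltac row_ring := apply/rowP => ?; rewrite !mxE; ring.

(** * Calculus of [C^k] maps *)

Section CkCalculus.
Context {R : realType}.
Implicit Types V W Z : normedModType R.

Lemma diff_eps V W (f : V -> W) (x : V) : differentiable f x ->
  forall e, 0 < e ->
    \forall y \near x, `|f y - f x - 'd f x (y - x)| <= e * `|y - x|.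
Proof.
move=> df e e0.
have [_ /eqaddoP /(_ _ e0)] := (diff_locallyP _ _).1 df.
move=> H.
have : \forall y \near x, (fun h => `|(f \o shift x - (cst (f x) + 'd f x)) h| <= e * `|id h|) (y - x).
  by rewrite (near_shift 0) subr0 /=; apply: filterS H => y; rewrite /= addrK.
apply: filterS => y.
by rewrite !fctE /= subrK opprD addrA.
Qed.

Lemma eps_diff V W (f : V -> W) (x : V) (L : {linear V -> W}) :
  continuous L -> (forall e, 0 < e ->
    \forall y \near x, `|f y - f x - L (y - x)| <= e * `|y - x|) ->
  differentiable f x /\ 'd f x = L :> (V -> W).
Proof.
move=> Lc H.
have eg : f \o shift x = cst (f x) + L +o_ 0 id.
  apply/eqaddoP => e e0; have := H _ e0.
  rewrite (near_shift 0) subr0 /=; apply: filterS => y /=.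
  by rewrite !fctE /= addrK opprD addrA.
have dE := diff_unique Lc eg.
by split=> //; apply/diff_locallyP; rewrite dE.
Qed.

Lemma near_diff_eq V W (f g : V -> W) (x : V) :
  (\forall y \near x, f y = g y) -> differentiable f x ->
  differentiable g x /\ 'd g x = 'd f x :> (V -> W).
Proof.
move=> fg df; apply: eps_diff; first exact: diff_continuous.
move=> e e0; have fgx := nbhs_singleton fg.
by apply: filterS2 (diff_eps df e0) fg => y; rewrite -fgx => + <-.
Qed.


(** ['d f x] carries no information where [f] is not differentiable, so differentiability and
    differential travel together; [df] is a bare function, free to be rewritten. *)
Definition has_diff V W (f : V -> W) (x : V) (df : V -> W) :=
  differentiable f x /\ 'd f x = df :> (V -> W).

Lemma has_diff_comp V W Z (f : V -> W) (g : W -> Z) x df dg :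
  has_diff f x df -> has_diff g (f x) dg ->
  has_diff (fun y => g (f y)) x (fun v => dg (df v)).
Proof.
move=> [d1 e1] [d2 e2]; split; first exact: (differentiable_comp (g := g)).
by rewrite (diff_comp d1 d2) e1 e2.
Qed.

Lemma has_diffD V W (f g : V -> W) x df dg :
  has_diff f x df -> has_diff g x dg ->
  has_diff (fun y => f y + g y) x (fun v => df v + dg v).
Proof.
move=> [d1 e1] [d2 e2]; split; first exact: (differentiableD d1 d2).
by rewrite (diffD d1 d2) e1 e2.
Qed.

Lemma has_diffB V W (f g : V -> W) x df dg :
  has_diff f x df -> has_diff g x dg ->
  has_diff (fun y => f y - g y) x (fun v => df v - dg v).
Proof.
move=> [d1 e1] [d2 e2]; split; first exact: (differentiableB d1 d2).
by rewrite (diffB d1 d2) e1 e2.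
Qed.

Lemma has_diff_pair V W Z (f : V -> W) (g : V -> Z) x df dg :
  has_diff f x df -> has_diff g x dg ->
  has_diff (fun y => (f y, g y)) x (fun v => (df v, dg v)).
Proof.
move=> [d1 e1] [d2 e2]; split; first exact: (differentiable_pair d1 d2).
by rewrite (diff_pair d1 d2) e1 e2.
Qed.

Lemma has_diff_cst V W (w : W) (x : V) : has_diff (fun=> w) x (fun=> 0).
Proof. by split; [exact: differentiable_cst|exact: diff_cst]. Qed.

Lemma has_diff_lin V W (L : {linear V -> W}) (x : V) :
  continuous L -> has_diff L x L.
Proof. by move=> Lc; split; [exact: linear_differentiable|exact: diff_lin]. Qed.

Lemma has_diff_id V (x : V) : has_diff (fun y : V => y) x (fun v => v).
Proof. by apply: (@has_diff_lin _ _ idfun) => y; exact: cvg_id. Qed.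

Lemma has_diff_line V (w : V) (t : R) :
  has_diff (fun s : R => s *: w) t (fun s => s *: w).
Proof.
have H := is_diff_scalel t w.
by split; [exact: (@ex_diff _ _ _ _ _ _ _ H)|exact: (@diff_val _ _ _ _ _ _ _ H)].
Qed.

Lemma has_diff_near V W (f g : V -> W) (x : V) df :
  (\forall y \near x, f y = g y) -> has_diff f x df -> has_diff g x df.
Proof. by move=> fg [d <-]; exact: near_diff_eq. Qed.

Lemma has_diff_ext V W (f g : V -> W) (x : V) df dg :
  f =1 g -> df =1 dg -> has_diff f x df -> has_diff g x dg.
Proof. by move=> /funext -> /funext ->. Qed.

Lemma diff_scale V W (c : V -> R) (h : V -> W) (x : V) :
  differentiable c x -> differentiable h x ->
  differentiable (fun y => c y *: h y) x /\
  'd (fun y => c y *: h y) x = (fun v => 'd c x v *: h x + c x *: 'd h x v)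
    :> (V -> W).
Proof.
move=> dc dh.
have bil : bilinear_for
    (GRing.Scale.Law.clone _ _ *:%R _) (GRing.Scale.Law.clone _ _ *:%R _)
    (fun (k : R) (w : W) => k *: w).
  split=> [w|k] a u v /=; first by rewrite scalerDl scalerA.
  by rewrite scalerDr !scalerA mulrC.
pose M := bilinear_isBilinear.Build R R W W _ _ (fun (k : R) (w : W) => k *: w) bil.
pose B : {bilinear R -> W -> W} := HB.pack (fun (k : R) (w : W) => k *: w) M.
have Bc : continuous (fun p : R * W => B p.1 p.2) by exact: scale_continuous.
have dB p := differentiable_bilin p Bc.
have dp : differentiable (fun y => (c y, h y)) x by exact: differentiable_pair.
have -> : (fun y => c y *: h y) =
  (fun p => B p.1 p.2) \o (fun y => (c y, h y)) by [].
split; first exact: differentiable_comp.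
rewrite diff_comp // diff_bilin // diff_pair //.
by apply/funext => v /=; rewrite addrC.
Qed.

Lemma Ck_cont k V W (U : set V) (f : V -> W) :
  Ck k U f -> forall x, U x -> {for x, continuous f}.
Proof.
case: k => [//|k] [df _] x Ux.
by apply: differentiable_continuous; exact: df.
Qed.

Lemma CkS k V W (U : set V) (f : V -> W) : Ck k.+1 U f -> Ck k U f.
Proof.
elim: k f => [f|k IH f] /= [df dC].
  by move=> x Ux; apply: differentiable_continuous; exact: df.
by split=> // v; exact: IH.
Qed.

Lemma Ck_sub k V W (U U' : set V) (f : V -> W) :
  U' `<=` U -> Ck k U f -> Ck k U' f.
Proof.
move=> sU; elim: k f => [f H x /sU|k IH f [df dC]]; first exact: H.
split=> [x /sU Ux|v]; [exact: df|exact: (IH _ (dC v))].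
Qed.

Lemma near_open (T : topologicalType) (U : set T) (P : T -> Prop) x :
  open U -> U x -> (forall y, U y -> P y) -> \forall y \near x, P y.
Proof. by move=> oU Ux UP; apply: filterS UP _; exact: open_nbhs_nbhs. Qed.

Lemma Ck_ext k V W (U : set V) (f g : V -> W) :
  open U -> (forall x, U x -> f x = g x) -> Ck k U f -> Ck k U g.
Proof.
move=> oU; elim: k f g => [|k IH] f g fg.
  move=> Hf x Ux; rewrite /prop_for /continuous_at -(fg x Ux).
  apply: cvg_trans (Hf x Ux); apply: near_eq_cvg.
  exact: near_open oU Ux fg.
move=> [df dC].
have H x : U x -> differentiable g x /\ 'd g x = 'd f x :> (V -> W).
  move=> Ux; apply: near_diff_eq; last exact: df.
  exact: near_open oU Ux fg.
split=> [x /H[]//|v]; by apply: IH (dC v) => x /H [_ ->].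
Qed.

Lemma Ck_cst k V W (U : set V) (w : W) : Ck k U (fun=> w).
Proof.
elim: k w => [|k IH] w; first by move=> x _; exact: cvg_cst.
split=> [x _|v]; first exact: differentiable_cst.
by rewrite (_ : (fun x => _) = (fun=> 0)) //; apply/funext => x; rewrite diff_cst.
Qed.

Lemma Ck_lin k V W (U : set V) (L : {linear V -> W}) : continuous L -> Ck k U L.
Proof.
case: k => [|k] Lc; first by move=> x _; exact: Lc.
split=> [x _|v]; first exact: linear_differentiable.
rewrite (_ : (fun x => _) = (fun=> L v)); first exact: Ck_cst.
by apply/funext => x; rewrite diff_lin.
Qed.

Lemma Ck_id k V (U : set V) : Ck k U (fun x : V => x).
Proof. by apply: (@Ck_lin k _ _ _ idfun) => x; exact: cvg_id. Qed.

Lemma Ck_linl k V W Z (U : set V) (L : {linear W -> Z}) (f : V -> W) :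
  open U -> continuous L -> Ck k U f -> Ck k U (fun x => L (f x)).
Proof.
move=> oU Lc; elim: k f => [|k IH] f.
  by move=> H x Ux; apply: continuous_comp; [exact: H|exact: Lc].
move=> [df dC].
have H x : U x -> differentiable (L \o f) x /\ 'd (L \o f) x = L \o 'd f x :> (_ -> _).
  move=> Ux; have dL := @linear_differentiable _ _ _ L (f x) Lc.
  split; first by apply: differentiable_comp; [exact: df|].
  by rewrite diff_comp ?diff_lin //; exact: df.
split=> [x /H[]//|v]; apply: (Ck_ext oU _ (IH _ (dC v))).
by move=> x /H [_ /= ->].
Qed.

Lemma Ck_add k V W (U : set V) (f g : V -> W) : open U ->
  Ck k U f -> Ck k U g -> Ck k U (fun x => f x + g x).
Proof.
move=> oU; elim: k f g => [|k IH] f g.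
  by move=> Hf Hg x Ux; apply: continuousD; [exact: Hf|exact: Hg].
move=> [df dCf] [dg dCg].
split=> [x Ux|v]; first by apply: differentiableD; [exact: df|exact: dg].
apply: (Ck_ext oU _ (IH _ _ (dCf v) (dCg v))) => x Ux.
by rewrite diffD //; [exact: df|exact: dg].
Qed.

Lemma Ck_scale k V W (U : set V) (c : V -> R) (h : V -> W) : open U ->
  Ck k U c -> Ck k U h -> Ck k U (fun x => c x *: h x).
Proof.
move=> oU; elim: k c h => [|k IH] c h.
  by move=> Hf Hg x Ux; apply: cvgZ; [exact: Hf|exact: Hg].
move=> Hc Hh; have [dc dCc] := Hc; have [dh dCh] := Hh.
split=> [x Ux|v]; first by have [] := diff_scale (dc x Ux) (dh x Ux).
apply: (Ck_ext oU _ (Ck_add oU (IH _ _ (dCc v) (CkS Hh)) (IH _ _ (CkS Hc) (dCh v)))).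
by move=> x Ux; have [_ ->] := diff_scale (dc x Ux) (dh x Ux).
Qed.

Lemma Ck_sum k V W (U : set V) N (f : 'I_N -> V -> W) : open U ->
  (forall i, Ck k U (f i)) -> Ck k U (fun x => \sum_i f i x).
Proof.
move=> oU; elim: N f => [|N IH] f Hf.
  by rewrite (_ : (fun x => _) = (fun=> 0)); [exact: Ck_cst|apply/funext => x; rewrite big_ord0].
rewrite (_ : (fun x => _) =
   (fun x => (\sum_(i < N) f (widen_ord (leqnSn N) i) x) + f ord_max x)).
  by apply: Ck_add => //; exact: IH.
by apply/funext => x; rewrite big_ord_recr.
Qed.

Lemma Ck_pair k V W Z (U : set V) (f : V -> W) (g : V -> Z) : open U ->
  Ck k U f -> Ck k U g -> Ck k U (fun x => (f x, g x)).
Proof.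
move=> oU; elim: k f g => [|k IH] f g.
  by move=> Hf Hg x Ux; apply: cvg_pair; [exact: Hf|exact: Hg].
move=> [df dCf] [dg dCg].
split=> [x Ux|v]; first by apply: differentiable_pair; [exact: df|exact: dg].
apply: (Ck_ext oU _ (IH _ _ (dCf v) (dCg v))) => x Ux.
by rewrite diff_pair //; [exact: df|exact: dg].
Qed.

Lemma fst_continuous (T T' : topologicalType) : continuous (@fst T T').
Proof. by case=> a b; exact: cvg_fst. Qed.

Lemma snd_continuous (T T' : topologicalType) : continuous (@snd T T').
Proof. by case=> a b; exact: cvg_snd. Qed.

(** Finite dimension in the form that the chain rule for [Ck] asks for: [Ck] controls ['d g y v]
    only for fixed [v], and coordinates reduce the moving vector ['d f x v] to the fixed vectors
    [e i]. *)
Definition has_coordinates V := exists N (e : 'I_N -> V) (c : 'I_N -> {linear V -> R}),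
  (forall i, continuous (c i)) /\ forall x, x = \sum_i c i x *: e i.

Lemma Ck_comp k V W Z (U : set V) (U' : set W) (f : V -> W) (g : W -> Z) :
  has_coordinates W -> open U -> (forall x, U x -> U' (f x)) ->
  Ck k U f -> Ck k U' g -> Ck k U (fun x => g (f x)).
Proof.
move=> [N [e [c [cc ce]]]] oU fU; elim: k g => [|k IH] g.
  by move=> Hf Hg x Ux; apply: continuous_comp; [exact: Hf|apply: Hg; exact: fU].
move=> Hf Hg; have [df dCf] := Hf; have [dg dCg] := Hg.
have H x : U x -> differentiable (g \o f) x /\
    'd (g \o f) x = (fun v => \sum_i c i ('d f x v) *: 'd g (f x) (e i)) :> (V -> Z).
  move=> Ux; have df' := df x Ux; have dg' := dg _ (fU _ Ux).
  split; first exact: differentiable_comp.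
  rewrite diff_comp //; apply/funext => v /=.
  rewrite [in LHS](ce ('d f x v)) linear_sum.
  by apply: eq_bigr => i _; rewrite linearZ.
split=> [x /H[]//|v].
apply: (@Ck_ext _ _ _ _ (fun x => \sum_i c i ('d f x v) *: 'd g (f x) (e i)) _ oU).
  by move=> x Ux; have [_ /= ->] := H x Ux.
apply: Ck_sum => // i; apply: Ck_scale => //; first exact: (Ck_linl oU (cc i) (dCf v)).
exact: (IH _ (CkS Hf) (dCg (e i))).
Qed.

Definition coord_lin n (j : 'I_n) (v : 'rV[R]_n) := v ord0 j.

Lemma coord_lin_is_linear n j : linear (@coord_lin n j).
Proof. by move=> a u v; rewrite /coord_lin !mxE. Qed.

HB.instance Definition _ n j :=
  GRing.isLinear.Build R 'rV[R]_n R _ (@coord_lin n j) (@coord_lin_is_linear n j).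

Lemma has_coordinates_rV n : has_coordinates 'rV[R]_n.
Proof.
exists n, (fun j => delta_mx 0 j), (fun j => @coord_lin n j).
split=> [j x|x]; first exact: coord_continuous.
exact: row_sum_delta.
Qed.

Lemma has_coordinates_prod V W :
  has_coordinates V -> has_coordinates W -> has_coordinates (V * W)%type.
Proof.
move=> [N [e [c [cc ce]]]] [M [d [b [bc be]]]].
pose s (i : 'I_(N + M)) : (V * W)%type :=
  match fintype.split i with inl j => (e j, 0) | inr j => (0, d j) end.
pose t (i : 'I_(N + M)) : {linear (V * W)%type -> R} :=
  match fintype.split i with inl j => c j \o fst | inr j => b j \o snd end.
exists (N + M)%N, s, t; split=> [i|x].
  rewrite /t; case: fintype.split => j x /=.
    by apply: continuous_comp; [exact: fst_continuous|exact: cc].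
  by apply: continuous_comp; [exact: snd_continuous|exact: bc].
rewrite big_split_ord /=.
under eq_bigr do rewrite /s /t (unsplitK (inl _)) /=.
under [X in _ = _ + X]eq_bigr do rewrite /s /t (unsplitK (inr _)) /=.
case: x => x y /=.
have E1 : forall k : 'I_N -> R, \sum_i k i *: ((e i, 0) : (V * W)%type) = (\sum_i k i *: e i, 0).
  move=> k; elim/big_ind2: _ => //.
  - by move=> ? u ? v -> ->; rewrite /GRing.add /= /add_pair /= addr0.
  - by move=> i _; rewrite /GRing.scale /= /scale_pair scaler0.
have E2 : forall k : 'I_M -> R, \sum_i k i *: ((0, d i) : (V * W)%type) = (0, \sum_i k i *: d i).
  move=> k; elim/big_ind2: _ => //.
  - by move=> ? u ? v -> ->; rewrite /GRing.add /= /add_pair /= addr0.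
  - by move=> i _; rewrite /GRing.scale /= /scale_pair scaler0.
by rewrite E1 E2 -ce -be /GRing.add /= /add_pair /= addr0 add0r.
Qed.

End CkCalculus.

(** * The mean value inequality and quantitative differentiability *)

Section MeanValue.
Context {R : realType}.
Implicit Types V W Z : normedModType R.

Lemma rV_norm_le m (v : 'rV[R]_m) (M : R) : 0 <= M ->
  (forall j, `|v ord0 j| <= M) -> `|v| <= M.
Proof.
move=> M0 H; rewrite /Num.Def.normr /= mx_normrE; apply/bigmax_leP; split=> //= -[i j] _ /=.
by rewrite ord1.
Qed.

Lemma rV_coord_le m (v : 'rV[R]_m) j : `|v ord0 j| <= `|v|.
Proof.
rewrite [leRHS]/Num.Def.normr /= mx_normrE; apply/bigmax_geP; right => /=.
by exists (ord0, j).
Qed.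

Lemma linear_bound V W (L : {linear V -> W}) : continuous L ->
  exists2 K, 0 < K & forall v, `|L v| <= K * `|v|.
Proof.
by move=> Lc; have [K K0 H] := linear_lipschitz Lc; exists K.
Qed.

(** The norm of a row vector is the maximum of its coordinates, so the one-variable mean value
    theorem, applied to each coordinate of [f - L] along the segment, loses no constant. *)
Lemma mean_value V m (f : V -> 'rV[R]_m) (L : {linear V -> 'rV[R]_m})
    (x0 x y : V) (r M : R) :
  0 <= M ->
  (forall z : V, `|z - x0| <= r -> differentiable f z) ->
  (forall z v : V, `|z - x0| <= r -> `|'d f z v - L v| <= M * `|v|) ->
  `|x - x0| <= r -> `|y - x0| <= r ->
  `|f x - f y - L (x - y)| <= M * `|x - y|.
Proof.
move=> M0 df dfL xr yr.
apply: rV_norm_le => [|j]; first by rewrite mulr_ge0.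
pose p (t : R) := y + t *: (x - y).
pose h (t : R) := f (p t) - t *: L (x - y).
pose g (t : R) : R := coord_lin j (h t).
have pr (t : R) : 0 <= t <= 1 -> `|p t - x0| <= r.
  move=> /andP[t0 t1].
  have -> : p t - x0 = (1 - t) *: (y - x0) + t *: (x - x0).
    rewrite scalerBl scale1r -[RHS]addrA [X in _ = _ + X]addrC -scalerBr.
    by rewrite opprB addrA subrK /p addrAC.
  apply: le_trans (ler_normD _ _) _; rewrite !normrZ.
  rewrite (ger0_norm t0) ger0_norm ?subr_ge0 //.
  have -> : r = (1 - t) * r + t * r by ring.
  by apply: lerD; apply: ler_wpM2l => //; rewrite subr_ge0.
have dp (t : R) : has_diff p t (fun s => s *: (x - y)).
  have := has_diffD (has_diff_cst y t) (has_diff_line (x - y) t).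
  by under [X in has_diff _ _ X]funext do rewrite add0r.
have dg (t : R) : 0 <= t <= 1 -> has_diff g t
    (fun s => coord_lin j ('d f (p t) (s *: (x - y)) - s *: L (x - y))).
  move=> t01; have dfp : has_diff f (p t) ('d f (p t)) by split=> //; apply/df/pr.
  apply: (has_diff_comp (f := h)); last first.
    by apply: has_diff_lin; exact: coord_continuous.
  by apply: has_diffB (has_diff_line _ _); exact: has_diff_comp dfp.
have [||t] := @MVT_segment R g (fun t => 'd g t 1) 0 1 ler01.
- move=> t; rewrite in_itv /= => /andP[/ltW t0 /ltW t1].
  have [dgt _] := dg t (introT andP (conj t0 t1)).
  by apply: DeriveDef; [exact: diff_derivable|rewrite deriveE].
- apply: continuous_in_subspaceT => t; rewrite inE /= in_itv /= => t01.
  by apply: differentiable_continuous; have [] := dg t t01.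
rewrite in_itv /= => t01; rewrite subr0 mulr1.
have -> : g 1 - g 0 = coord_lin j (f x - f y - L (x - y)).
  rewrite -linearB /h /p !scale0r !scale1r subr0 addr0; congr coord_lin.
  by rewrite (addrC y) subrK addrAC.
rewrite (dg t t01).2 !scale1r /coord_lin => ->.
by apply: le_trans (rV_coord_le _ _) _; apply: dfL; exact: pr.
Qed.

Lemma diff_locally_lipschitz V W (g : V -> W) (x0 : V) : differentiable g x0 ->
  exists C r, [/\ 0 < C, 0 < r &
    forall x, `|x - x0| <= r -> `|g x - g x0| <= C * `|x - x0|].
Proof.
move=> dg; have [K K0 HK] := linear_bound (diff_continuous dg).
have /nbhs_normP [r /= r0 H] := diff_eps dg ltr01.
exists (K + 1), (r / 2); split; rewrite ?addr_gt0 ?divr_gt0 // => x xr.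
have /(_ _)/wrap[] := H x; rewrite /= ?(distrC x0).
  by apply: le_lt_trans xr _; rewrite ltr_pdivrMr // ltr_pMr // ltr1n.
rewrite mul1r => H1; rewrite mulrDl mul1r [leRHS]addrC.
rewrite -[X in `|X|](subrK ('d g x0 (x - x0))).
by apply: le_trans (ler_normD _ _) _; exact: lerD.
Qed.

(** Strict differentiability at a linear rate: on the ball of radius [rho], [f - L] is Lipschitz
    with constant [C * rho]. Two moving points are compared, as contraction arguments require. *)
Definition quad_diff V W (f : V -> W) (x0 : V) (L : V -> W) (C r : R) :=
  [/\ 0 < C, 0 < r & forall rho x y, rho <= r -> `|x - x0| <= rho -> `|y - x0| <= rho ->
    `|f x - f y - L (x - y)| <= C * rho * `|x - y|].

(** Each partial derivative is differentiable at [x0], so it deviates from its value there by at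
    most a multiple of the distance; [mean_value] turns this into the rate [C * rho]. *)
Lemma C2_quad_diff V m (U : set V) (f : V -> 'rV[R]_m) (x0 : V) :
  has_coordinates V -> open U -> U x0 -> Ck 2 U f ->
  exists C r, quad_diff f x0 ('d f x0) C r /\ forall x, `|x - x0| <= r -> U x.
Proof.
move=> [N [e [c [cc ce]]]] oU Ux0 [df dC].
have H i : exists Cr : R * R, [/\ 0 < Cr.1, 0 < Cr.2 &
    forall x, `|x - x0| <= Cr.2 -> `|'d f x (e i) - 'd f x0 (e i)| <= Cr.1 * `|x - x0|].
  have [C [r HH]] := diff_locally_lipschitz ((dC (e i)).1 x0 Ux0).
  by exists (C, r).
have [Cr HCr] := choice H.
have H' i : exists K, 0 < K /\ forall v, `|c i v| <= K * `|v|.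
  by have [K] := linear_bound (cc i); exists K.
have [K HK] := choice H'.
have /nbhs_normP [r1 /= r10 HU] : nbhs x0 U by exact: open_nbhs_nbhs.
pose r := \big[Num.min/(r1 / 2)]_i (Cr i).2.
pose C := \sum_i K i * (Cr i).1 + 1.
have rle i : r <= (Cr i).2 by exact: bigmin_le_cond.
have rU x : `|x - x0| <= r -> U x.
  move=> xr; apply: HU; rewrite /ball_ /= distrC.
  apply: le_lt_trans xr _; apply: le_lt_trans (bigmin_le_id _ _ _ _) _.
  by rewrite ltr_pdivrMr // ltr_pMr // ltr1n.
have C0 : 0 < C.
  rewrite ltr_wpDl // sumr_ge0 // => i _.
  by have [? ? _] := HCr i; have [? _] := HK i; rewrite mulr_ge0 // ltW.
exists C, r; split=> //; split=> //.
  apply/bigmin_gtP; split; first by rewrite divr_gt0.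
  by move=> i _; have [] := HCr i.
move=> rho x y rhor xrho yrho.
have rho0 : 0 <= rho by apply: le_trans xrho.
apply: (@mean_value _ _ _ ('d f x0) x0 _ _ rho) => //.
- by rewrite mulr_ge0 // ltW.
- by move=> z zr; apply: df; apply: rU; exact: le_trans zr rhor.
move=> z v zr; have -> : 'd f z v - 'd f x0 v = \sum_i c i v *: ('d f z (e i) - 'd f x0 (e i)).
  rewrite [in LHS](ce v) (linear_sum ('d f z)) (linear_sum ('d f x0)) -sumrB; apply: eq_bigr => i _.
  by rewrite (linearZ_LR ('d f z)) (linearZ_LR ('d f x0)) -scalerBr.
apply: le_trans (ler_norm_sum _ _ _) _.
apply: (@le_trans _ _ (\sum_i K i * (Cr i).1 * rho * `|v|)).
  apply: ler_sum => i _; rewrite normrZ.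
  have [K0 HKi] := HK i; have [C1 C2 HC] := HCr i.
  have h1 := HKi v; have h2 := HC z (le_trans zr (le_trans rhor (rle i))).
  have -> : K i * (Cr i).1 * rho * `|v| = (K i * `|v|) * ((Cr i).1 * rho) by ring.
  apply: ler_pM => //; apply: le_trans h2 _.
  by rewrite ler_pM2l.
rewrite -!mulr_suml; apply: ler_wpM2r => //; apply: ler_wpM2r => //.
by rewrite lerDl.
Qed.

End MeanValue.

(** * Contraction arguments *)

(* The library proves completeness of matrices only for the uniform structure;
   this joins it with the norm. *)
HB.instance Definition _ (R : realType) m n :=
  Uniform_isComplete.Build 'M[R]_(m, n) (@cauchy_cvg _).

Section RootIteration.
Context {R : realType} {n : nat}.
Local Notation V := 'rV[R]_n.

Lemma cvgn_geometric_steps (u : V ^nat) (K q : R) : 0 <= K -> 0 <= q < 1 ->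
  (forall k, `|u k.+1 - u k| <= K * q ^+ k) -> cvgn u.
Proof.
move=> K0 /andP[q0 q1] H.
have cs : cvgn (series (fun k => u k.+1 - u k)).
  apply: normed_cvg; apply: (@series_le_cvg _ _ (geometric K q)) => //.
  - by move=> k; exact: normr_ge0.
  - by move=> k; apply: mulr_ge0; rewrite ?exprn_ge0.
  - by apply: is_cvg_geometric_series; rewrite ger0_norm.
have E : u = (fun k => u 0 + series (fun k => u k.+1 - u k) k).
  apply/funext => k; rewrite /series /= telescope_sumr //.
  by rewrite addrC subrK.
rewrite E; apply: is_cvgD => //; exact: is_cvg_cst.
Qed.

Lemma limn_norm_le (u : V ^nat) (w : V) (M : R) : cvgn u ->
  (forall k, `|u k - w| <= M) -> `|limn u - w| <= M.
Proof.
move=> cu H.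
have c2 : (fun k => `|u k - w|) @ \oo --> `|limn u - w|.
  by apply: cvg_norm; apply: cvgB => //; exact: cvg_cst.
have <- := cvg_lim (@norm_hausdorff _ _) c2.
by apply: limr_le; [apply/cvg_ex; eexists; exact: c2|exact: nearW].
Qed.

(** Iterate [u - (F u - y)]. The steps decay like [2^-k], and the bound [2 |y| (1 - 2^-k)] on the
    iterates keeps them in the ball where the hypothesis holds. *)
Lemma small_perturbation_onto (F : V -> V) (r : R) (y : V) : F 0 = 0 ->
  (forall x z, `|x| <= r -> `|z| <= r -> `|F x - F z - (x - z)| <= 2^-1 * `|x - z|) ->
  `|y| <= r / 2 -> exists x, `|x| <= 2 * `|y| /\ F x = y.
Proof.
move=> F0 HF yr.
pose u := fix u k := if k is k'.+1 then u k' - (F (u k') - y) else 0.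
have r2 : 2 * `|y| <= r by rewrite mulrC -ler_pdivlMr.
have y0 := normr_ge0 y.
have q1 k : 2^-1 ^+ k <= 1 :> R by apply: exprn_ile1; rewrite ?invr_ge0 // invf_le1 // ler1n.
have q0 k : 0 <= 2^-1 ^+ k :> R by rewrite exprn_ge0.
have H k : `|u k| <= 2 * `|y| * (1 - 2^-1 ^+ k) /\ `|u k.+1 - u k| <= `|y| * 2^-1 ^+ k.
  elim: k => [|k [IH1 IH2]].
    by rewrite expr0 subrr mulr0 /= normr0 F0 !sub0r subr0 opprK mulr1.
  have ur : `|u k| <= r.
    by apply: le_trans IH1 (le_trans _ r2); rewrite ler_piMr ?mulr_ge0 // lerBlDr lerDl.
  have ur' : `|u k.+1| <= 2 * `|y| * (1 - 2^-1 ^+ k.+1).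
    rewrite -[u k.+1](subrK (u k)); apply: le_trans (ler_normD _ _) _.
    apply: le_trans (lerD IH2 IH1) _; rewrite exprS; lra.
  split=> //.
  have ur'' : `|u k.+1| <= r.
    by apply: le_trans ur' (le_trans _ r2); rewrite ler_piMr ?mulr_ge0 // lerBlDr lerDl.
  have -> : u k.+2 - u k.+1 = - (F (u k.+1) - F (u k) - (u k.+1 - u k)).
    by rewrite /=; row_ring.
  rewrite normrN; apply: le_trans (HF _ _ ur'' ur) _.
  by rewrite exprS mulrCA ler_pM2l.
have cu : cvgn u.
  apply: (@cvgn_geometric_steps _ `|y| 2^-1) => //; last by move=> k; have [] := H k.
  by rewrite invr_ge0 ler0n /= invf_lt1 // ltr1n.
have lu : `|limn u| <= 2 * `|y|.
  rewrite -[limn u]subr0; apply: limn_norm_le => // k; rewrite subr0.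
  apply: le_trans (H k).1 _; rewrite ler_piMr ?mulr_ge0 // lerBlDr lerDl //.
exists (limn u); split=> //.
have key k : `|F (limn u) - y| <= 2^-1 * `|limn u - u k| + `|limn u - u k| + `|u k.+1 - u k|.
  have uk : `|u k| <= r.
    by apply: le_trans (H k).1 (le_trans _ r2); rewrite ler_piMr ?mulr_ge0 // lerBlDr lerDl.
  have -> : F (limn u) - y = (F (limn u) - F (u k) - (limn u - u k)) + (limn u - u k) - (u k.+1 - u k).
    by rewrite /=; row_ring.
  apply: le_trans (ler_normB _ _) _; rewrite lerD2r.
  apply: le_trans (ler_normD _ _) _; rewrite lerD2r; apply: HF => //.
  exact: le_trans lu r2.
apply/eqP; rewrite -subr_eq0 -normr_le0; apply/ler_addgt0Pr => e e0.
rewrite add0r.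
have [N _ HN] : \forall k \near \oo, `|limn u - u k| <= e / 4.
  by move/cvgrPdist_le : cu; apply; rewrite divr_gt0.
have h1 := HN N (leqnn N); have h2 := HN N.+1 (leqnSn N).
apply: le_trans (key N) _.
have h3 : `|u N.+1 - u N| <= e / 4 + e / 4.
  rewrite -[u N.+1](subrK (limn u)) -addrA; apply: le_trans (ler_normD _ _) _.
  by rewrite distrC lerD.
by lra.
Qed.

End RootIteration.

(** * Successive square roots in coordinates *)

Section SquareRoots.
Context {R : realType} {n : nat}.
Local Notation V := 'rV[R]_n.
Variables (sq : V -> V) (C r : R).
Hypothesis sq_quad : quad_diff sq 0 (fun v => 2 *: v) C r.
Hypothesis sq0 : sq 0 = 0.

Let C0 : 0 < C. Proof. by case: sq_quad. Qed.
Let r0 : 0 < r. Proof. by case: sq_quad. Qed.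
Let sqP rho x y : rho <= r -> `|x| <= rho -> `|y| <= rho ->
  `|sq x - sq y - 2 *: (x - y)| <= C * rho * `|x - y|.
Proof. by case: sq_quad => _ _ H h1 h2 h3; apply: H; rewrite ?subr0. Qed.

Let sqL rho x y : rho <= r -> `|x| <= rho -> `|y| <= rho ->
  `|sq x - sq y| <= (2 + C * rho) * `|x - y|.
Proof.
move=> h1 h2 h3; rewrite -[X in `|X|](subrK (2 *: (x - y))).
apply: le_trans (ler_normD _ _) _.
by rewrite normrZ ger0_norm // (mulrDl 2 (C * rho)) [leLHS]addrC lerD2l; exact: sqP.
Qed.

(** Each squaring stretches distances by at most [2 + C B 2^-k]. Compared with exact doubling, the
    total loss is a convergent product, at most [e^(C B)], so the rescaled limit of the difference
    decides the first terms. *)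
Lemma root_sequence_unique (x y : nat -> V) (B : R) : B <= r ->
  (forall k, x k = sq (x k.+1)) -> (forall k, y k = sq (y k.+1)) ->
  (forall k, `|x k| <= B * 2^-1 ^+ k) -> (forall k, `|y k| <= B * 2^-1 ^+ k) ->
  (fun k => 2 ^+ k *: (x k - y k)) @ \oo --> (0 : V) -> x 0 = y 0.
Proof.
move=> Br xs ys xB yB lim0.
have B0 : 0 <= B by apply: le_trans (normr_ge0 (x 0)) _; rewrite -[leRHS]mulr1.
have CB0 : 0 <= C * B by rewrite mulr_ge0 // ltW.
have q0 k : 0 <= 2^-1 ^+ k :> R by rewrite exprn_ge0.
have q1 k : 2^-1 ^+ k <= 1 :> R by apply: exprn_ile1; rewrite ?invr_ge0 // invf_le1 // ler1n.
have key k : `|x 0 - y 0| <= expR (C * B * (1 - 2^-1 ^+ k)) * (2 ^+ k * `|x k - y k|).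
  elim: k => [|k IH]; first by rewrite expr0 subrr mulr0 expR0 !mul1r.
  apply: le_trans IH _.
  have -> : expR (C * B * (1 - 2^-1 ^+ k.+1)) =
      expR (C * B * (1 - 2^-1 ^+ k)) * expR (C * B * 2^-1 ^+ k.+1).
    by rewrite -expRD; congr expR; rewrite exprS; field.
  rewrite -(mulrA (expR _) (expR _)) ler_pM2l ?expR_gt0 //.
  have Bk : B * 2^-1 ^+ k <= r by apply: le_trans Br; rewrite ler_piMr.
  have le2 (z : nat -> V) : (forall k, `|z k| <= B * 2^-1 ^+ k) -> `|z k.+1| <= B * 2^-1 ^+ k.
    move=> /(_ k.+1) h; apply: le_trans h _; rewrite ler_wpM2l // exprS ler_piMl //.
    by rewrite invf_le1 // ler1n.
  have := sqL Bk (le2 x xB) (le2 y yB); rewrite -xs -ys => h.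
  apply: (@le_trans _ _ (2 ^+ k * ((2 + C * (B * 2^-1 ^+ k)) * `|x k.+1 - y k.+1|))).
    by rewrite ler_wpM2l // exprn_ge0.
  have -> : 2 ^+ k * ((2 + C * (B * 2^-1 ^+ k)) * `|x k.+1 - y k.+1|) =
      (1 + C * B * 2^-1 ^+ k.+1) * (2 ^+ k.+1 * `|x k.+1 - y k.+1|).
    by rewrite !exprS; field.
  by rewrite ler_wpM2r ?expR_ge1Dx // mulr_ge0 // exprn_ge0.
apply/eqP; rewrite -subr_eq0 -normr_le0; apply/ler_addgt0Pr => e e0; rewrite add0r.
have e1 : 0 < e / expR (C * B) by rewrite divr_gt0 // expR_gt0.
have [N _ HN] : \forall k \near \oo, `|0 - 2 ^+ k *: (x k - y k)| <= e / expR (C * B).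
  by move/cvgrPdist_le : lim0; apply.
have := HN N (leqnn N); rewrite sub0r normrN normrZ ger0_norm ?exprn_ge0 // => h.
apply: le_trans (key N) _.
rewrite -[leRHS](divfK (lt0r_neq0 (expR_gt0 (C * B)))) [leRHS]mulrC.
apply: ler_pM; rewrite ?expR_ge0 ?mulr_ge0 ?exprn_ge0 //.
by rewrite ler_expR ler_piMr // lerBlDr lerDl.
Qed.

(** [E] is the limit of [x |-> sq^k (2^-k x)], the exponential map in coordinates when [sq] is the
    squaring of the group. With [sq] applied outermost, estimates at radius [rho] follow from those
    at [rho / 2]. *)
Lemma square_functional_equation : exists (E : V -> V) (A rE : R),
  [/\ rE <= r, A * rE <= 1, quad_diff E 0 idfun A rE, E 0 = 0 &
      forall x, `|x| <= rE -> E x = sq (E (2^-1 *: x))].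
Proof.
(* [A = 2 C] solves the recursion for the error: a squaring contributes [C * rho], and the error
   inherited from half the radius, doubled, contributes [A * rho / 2]. The bound on [rE] keeps
   [A * rho <= 1]. *)
pose A := 2 * C; pose rE := Num.min r (2 * C)^-1.
have A0 : 0 < A by rewrite mulr_gt0.
have rEr : rE <= r by rewrite ge_min lexx.
have rE0 : 0 < rE by rewrite lt_min r0 invr_gt0.
have ArE : A * rE <= 1.
  by rewrite -ler_pdivlMl // mulr1 ge_min lexx orbT.
pose E := fix E k x := if k is k'.+1 then sq (E k' (2^-1 *: x)) else x : V.
have E0 k : E k 0 = 0 by elim: k => //= k IH; rewrite scaler0 IH.
have half (x : V) : `|2^-1 *: x| = `|x| / 2 by rewrite normrZ ger0_norm ?invr_ge0 // mulrC.
have EP k rho x y : rho <= rE -> `|x| <= rho -> `|y| <= rho ->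
    `|E k x - E k y - (x - y)| <= A * rho * `|x - y|.
  elim: k rho x y => [|k IH] rho x y h1 h2 h3.
    have rho0 : 0 <= rho by apply: le_trans h2.
    by rewrite /= subrr normr0 !mulr_ge0 // ltW.
  have rho0 : 0 <= rho by apply: le_trans h2.
  have h1' : rho / 2 <= rE by apply: le_trans h1; rewrite ler_pdivrMr // ler_peMr // ler1n.
  have Arho : A * rho <= 1 by apply: le_trans ArE; rewrite ler_pM2l.
  have hh (z : V) : `|z| <= rho -> `|2^-1 *: z| <= rho / 2.
    by move=> hz; rewrite half ler_pM2r // invr_gt0.
  have bd (z : V) : `|z| <= rho -> `|E k (2^-1 *: z)| <= rho.
    move=> /hh hz.
    have := IH (rho / 2) _ 0 h1' hz; rewrite normr0 E0 !subr0 => /(_ _)/wrap[].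
      by rewrite divr_ge0.
    move=> h; rewrite -[E k _](subrK (2^-1 *: z)); apply: le_trans (ler_normD _ _) _.
    have : A * (rho / 2) * `|2^-1 *: z| <= 1 * `|2^-1 *: z|.
      rewrite ler_wpM2r // mulrA ler_pdivrMr // mul1r; apply: le_trans Arho _; by rewrite ler1n.
    by move: h hz; lra.
  have h := sqP (le_trans h1 rEr) (bd x h2) (bd y h3).
  have g := IH (rho / 2) _ _ h1' (hh x h2) (hh y h3).
  move: h g; rewrite -scalerBr half /=; set a := E k _; set b := E k _.
  set N := `|x - y|; move=> h g.
  have N0 : 0 <= N by exact: normr_ge0.
  have ab : `|a - b| <= N.
    rewrite -[a - b](subrK (2^-1 *: (x - y))); apply: le_trans (ler_normD _ _) _.
    rewrite half -/N; have : A * (rho / 2) * (N / 2) <= 1 * (N / 2).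
      rewrite ler_wpM2r ?divr_ge0 // mulrA ler_pdivrMr // mul1r; apply: le_trans Arho _; by rewrite ler1n.
    by move: g; lra.
  have -> : sq a - sq b - (x - y) = sq a - sq b - 2 *: (a - b) + 2 *: (a - b - 2^-1 *: (x - y)).
    by apply/rowP => j; rewrite !mxE; field.
  apply: le_trans (ler_normD _ _) _; rewrite normrZ ger0_norm //.
  have h' : C * rho * `|a - b| <= C * rho * N by rewrite ler_wpM2l // mulr_ge0 // ltW.
  rewrite /A in g *; move: g h h'.
  have -> : 2 * C * rho * N = C * rho * N + 2 * (2 * C * (rho / 2) * (N / 2)) by field.
  by lra.
have Ebd k x : `|x| <= rE -> `|E k x| <= 2 * `|x|.
  move=> h; have := EP k `|x| x 0 h (lexx _); rewrite normr0 E0 !subr0 => /(_ (normr_ge0 _)) g.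
  rewrite -[E k x](subrK x); apply: le_trans (ler_normD _ _) _.
  have : A * `|x| * `|x| <= 1 * `|x|.
    by rewrite ler_wpM2r //; apply: le_trans ArE; rewrite ler_pM2l.
  by move: g; lra.
have Ebd2 k x : `|x| <= rE -> `|E k (2^-1 *: x)| <= `|x|.
  move=> h; apply: le_trans (Ebd _ _ _) _; last by rewrite half; lra.
  by rewrite half; have := normr_ge0 x; lra.
(* Since [C * |x| <= 1 / 2], squaring stretches by at most [5 / 2], while halving [x] divides the
   quadratic bound by 4: the ratio is [5 / 8]. *)
have q01 : 0 <= (5 / 8 : R) < 1 by apply/andP; split; lra.
have step k x : `|x| <= rE -> `|E k.+1 x - E k x| <= C * `|x| ^+ 2 * (5 / 8) ^+ k.
  elim: k x => [|k IH] x h.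
    rewrite expr0 mulr1 /=.
    have := @sqP `|x| (2^-1 *: x) 0 (le_trans h rEr).
    rewrite normr0 sq0 !subr0 half scalerA mulfV // scale1r => /(_ _ _)/wrap[||].
    - by have := normr_ge0 x; lra.
    - exact: normr_ge0.
    move=> g; apply: le_trans g _.
    have -> : C * `|x| * (`|x| / 2) = C * `|x| ^+ 2 / 2 by rewrite expr2 !mulrA.
    by rewrite ler_pdivrMr // ler_peMr ?ler1n // mulr_ge0 ?sqr_ge0 // ltW.
  have h2 : `|2^-1 *: x| <= rE by rewrite half; have := normr_ge0 x; lra.
  have g := IH _ h2.
  have s := sqL (le_trans h rEr) (Ebd2 k.+1 x h) (Ebd2 k x h).
  apply: le_trans s _.
  have c : 2 + C * `|x| <= 5 / 2.
    have : A * `|x| <= 1 by apply: le_trans ArE; rewrite ler_pM2l.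
    by rewrite /A; lra.
  apply: (@le_trans _ _ (5 / 2 * `|E k.+1 (2^-1 *: x) - E k (2^-1 *: x)|)).
    by rewrite ler_wpM2r.
  apply: le_trans (ler_wpM2l _ g) _; first by lra.
  by rewrite half le_eqVlt; apply/orP; left; apply/eqP; rewrite (exprS _ k); move: (_ ^+ k) => z; field.
have Ecvg x : `|x| <= rE -> cvgn (E^~ x).
  move=> h; apply: (@cvgn_geometric_steps _ _ _ (C * `|x| ^+ 2) _ _ q01).
    by rewrite mulr_ge0 ?(ltW C0).
  by move=> k; exact: step.
pose Ex x := limn (E^~ x).
exists Ex, A, rE; split=> //.
- split=> // rho x y h1; rewrite !subr0 => h2 h3.
  have cx := Ecvg x (le_trans h2 h1); have cy := Ecvg y (le_trans h3 h1).
  have -> : Ex x - Ex y = limn (fun k => E k x - E k y).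
    by apply/esym/cvg_lim => //; apply: cvgB.
  apply: limn_norm_le; first by apply/cvg_ex; eexists; apply: cvgB; [exact: cx|exact: cy].
  by move=> k; exact: EP.
- by rewrite /Ex; under eq_fun do rewrite E0; exact: lim_cst.
- move=> x h.
  have h2 : `|2^-1 *: x| <= rE by rewrite half; have := normr_ge0 x; lra.
  have c2 := Ecvg _ h2; have c1 := Ecvg _ h.
  have lx : `|Ex (2^-1 *: x)| <= `|x|.
    by rewrite -[Ex _]subr0; apply: limn_norm_le => // k; rewrite subr0; exact: Ebd2.
  have c3 : (fun k => E k.+1 x) @ \oo --> sq (Ex (2^-1 *: x)).
    apply/cvgrPdist_le => e e0.
    have M0 : 0 < 2 + C * `|x| by rewrite ltr_pwDl // mulr_ge0 // ltW.
    have e1 : 0 < e / (2 + C * `|x|) by rewrite divr_gt0.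
    move/cvgrPdist_le : c2 => /(_ _ e1); apply: filterS => k hk.
    apply: le_trans (sqL (le_trans h rEr) lx (Ebd2 k x h)) _.
    by rewrite mulrC -ler_pdivlMr.
  have c4 : (fun k => E k.+1 x) @ \oo --> Ex x by rewrite (cvg_shiftS (E^~ x)).
  exact: (cvg_unique _ c4 c3).
Qed.

End SquareRoots.

(** * Manifolds and Lie groups in charts *)

Section Manifolds.
Context {R : realType}.
Implicit Types E F : normedModType R.
Implicit Types M N P : topologicalType.

Lemma chart_image_open E M (c : chart E M) (O : set M) :
  is_chart c -> open O -> open (cfun c @` (cdom c `&` O)).
Proof.
move=> [odom oim cK ccf cci] oO.
have -> : cfun c @` (cdom c `&` O) = (cfun c @` cdom c) `&` cinv c @^-1` O.
  apply/seteqP; split=> [y [x [dx Ox] <-]|y [[x dx <-]]] /=.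
    by split; [exists x|rewrite cK].
  by rewrite cK // => Ox; exists x.
rewrite openE => y [imy Oy].
rewrite continuous_open_subspace // in cci.
have H : nbhs y (cinv c @^-1` O) by apply: cci; [rewrite inE|exact: open_nbhs_nbhs].
by apply: filterI => //; exact: open_nbhs_nbhs.
Qed.

Lemma chart_cfun_continuous E M (c : chart E M) x :
  is_chart c -> cdom c x -> {for x, continuous (cfun c)}.
Proof.
move=> [odom oim cK ccf cci] dx; rewrite continuous_open_subspace // in ccf.
by apply: ccf; rewrite inE.
Qed.

Lemma chart_cinv_continuous E M (c : chart E M) x :
  is_chart c -> cdom c x -> {for cfun c x, continuous (cinv c)}.
Proof.
move=> [odom oim cK ccf cci] dx; rewrite continuous_open_subspace // in cci.
by apply: cci; rewrite inE; exists x.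
Qed.

Lemma open_setX M N (P : set M) (Q : set N) : open P -> open Q -> open (P `*` Q).
Proof.
move=> oP oQ; rewrite openE => -[x y] [/= Px Qy].
by exists (P, Q) => //; split; exact: open_nbhs_nbhs.
Qed.

Lemma prod_chart E F M N (AM : atlas E M) (AN : atlas F N) p :
  is_chart (AM p.1) -> is_chart (AN p.2) -> is_chart (prod_atlas AM AN p).
Proof.
move=> c1 c2; have [d1 i1 K1 f1 g1] := c1; have [d2 i2 K2 f2 g2] := c2.
have Eim : cfun (prod_atlas AM AN p) @` cdom (prod_atlas AM AN p) =
    (cfun (AM p.1) @` cdom (AM p.1)) `*` (cfun (AN p.2) @` cdom (AN p.2)).
  apply/seteqP; split=> [_ [q [q1 q2] <-]|[u v] [/= [x dx <-] [y dy <-]]] /=.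
    by split; [exists q.1|exists q.2].
  by exists (x, y).
have odom : open (cdom (prod_atlas AM AN p)) by exact: open_setX.
have oim : open (cfun (prod_atlas AM AN p) @` cdom (prod_atlas AM AN p)).
  by rewrite Eim; exact: open_setX.
split=> //.
- by case=> x y [/= dx dy]; rewrite K1 // K2.
- rewrite continuous_open_subspace // => -[x y]; rewrite inE => -[/= dx dy].
  apply: cvg_pair.
    apply: (@continuous_comp _ _ _ fst (cfun (AM p.1))); first exact: fst_continuous.
    exact: chart_cfun_continuous.
  apply: (@continuous_comp _ _ _ snd (cfun (AN p.2))); first exact: snd_continuous.
  exact: chart_cfun_continuous.
- rewrite continuous_open_subspace // => -[u v]; rewrite inE Eim => -[/= [x dx <-] [y dy <-]].
  apply: cvg_pair.
    apply: (@continuous_comp _ _ _ fst (cinv (AM p.1))); first exact: fst_continuous.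
    exact: chart_cinv_continuous.
  apply: (@continuous_comp _ _ _ snd (cinv (AN p.2))); first exact: snd_continuous.
  exact: chart_cinv_continuous.
Qed.

Lemma model_chart E (x : E) : is_chart (@model_atlas R E x).
Proof.
have ES : (fun y : E => y) @` setT = setT by apply/seteqP; split=> // y _; exists y.
split=> //=; first exact: openT.
- by rewrite ES; exact: openT.
- by apply: continuous_subspaceT => y; exact: cvg_id.
- by apply: continuous_subspaceT => y; exact: cvg_id.
Qed.

(** Continuity is a separate clause: the chart expression describes [f] only near points that [f]
    sends into the chart domain at [f x], and continuity makes these a neighbourhood. *)
Definition mdiff E F M N (AM : atlas E M) (AN : atlas F N) (f : M -> N) (x : M) :=
  {for x, continuous f} /\
  differentiable (cfun (AN (f x)) \o f \o cinv (AM x)) (cfun (AM x) x).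

Definition good_chart E M (AM : atlas E M) x := is_chart (AM x) /\ cdom (AM x) x.

Lemma good_model E (x : E) : good_chart (@model_atlas R E) x.
Proof. by split=> //; exact: model_chart. Qed.

Lemma good_prod E F M N (AM : atlas E M) (AN : atlas F N) p :
  good_chart AM p.1 -> good_chart AN p.2 -> good_chart (prod_atlas AM AN) p.
Proof. by move=> [c1 d1] [c2 d2]; split=> //; exact: prod_chart. Qed.

Lemma good_near E M (AM : atlas E M) x (P : M -> Prop) : good_chart AM x ->
  (\forall y \near x, P y) -> \forall z \near cfun (AM x) x, P (cinv (AM x) z).
Proof.
move=> [c d] H; have [_ _ K _ _] := c.
by apply: (chart_cinv_continuous c d); rewrite K.
Qed.

Lemma good_dom E M (AM : atlas E M) x : good_chart AM x -> nbhs x (cdom (AM x)).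
Proof. by move=> [[od _ _ _ _] d]; exact: open_nbhs_nbhs. Qed.

Lemma good_cinvK E M (AM : atlas E M) x : good_chart AM x ->
  cinv (AM x) (cfun (AM x) x) = x.
Proof. by move=> [[_ _ K _ _] d]; exact: K. Qed.

Lemma good_cfunK E M (AM : atlas E M) x : good_chart AM x ->
  \forall z \near cfun (AM x) x, cfun (AM x) (cinv (AM x) z) = z.
Proof.
move=> [[od oi K _ _] d]; apply: (near_open oi); first by exists x.
by move=> _ [y dy <-]; rewrite K.
Qed.

Lemma Ck_map_mdiff E F M N (AM : atlas E M) (AN : atlas F N) k (f : M -> N) x :
  good_chart AM x -> good_chart AN (f x) -> Ck_map AM AN k.+1 f -> mdiff AM AN f x.
Proof.
move=> gx gfx [fc /(_ x) [fd _]]; split; first exact: fc.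
by apply: fd; exists x => //; split; [exact: gx.2|exact: gfx.2].
Qed.

Lemma mdiff_comp E F H M N P (AM : atlas E M) (AN : atlas F N) (AP : atlas H P)
    (f : M -> N) (g : N -> P) x : good_chart AM x -> good_chart AN (f x) ->
  mdiff AM AN f x -> mdiff AN AP g (f x) ->
  mdiff AM AP (g \o f) x /\
  tangent_map AM AP (g \o f) x =
    (fun v => tangent_map AN AP g (f x) (tangent_map AM AN f x v)) :> (E -> H).
Proof.
move=> gx gfx [fc fd] [gc gd].
set F1 := cfun (AN (f x)) \o f \o cinv (AM x) in fd *.
set G1 := cfun (AP (g (f x))) \o g \o cinv (AN (f x)) in gd *.
have eF : F1 (cfun (AM x) x) = cfun (AN (f x)) (f x) by rewrite /F1 /= good_cinvK.
have hF : has_diff F1 (cfun (AM x) x) ('d F1 (cfun (AM x) x)) by [].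
have hG : has_diff G1 (F1 (cfun (AM x) x)) ('d G1 (cfun (AN (f x)) (f x))) by rewrite eF.
have near_dom : \forall z \near cfun (AM x) x, cdom (AN (f x)) (f (cinv (AM x) z)).
  by apply: (good_near (P := fun y => cdom (AN (f x)) (f y)) gx); apply: fc; exact: good_dom.
have [d e] : has_diff (cfun (AP (g (f x))) \o (g \o f) \o cinv (AM x)) (cfun (AM x) x)
    (fun v => 'd G1 (cfun (AN (f x)) (f x)) ('d F1 (cfun (AM x) x) v)).
  apply: has_diff_near (has_diff_comp hF hG).
  by apply: filterS near_dom => z dz; rewrite /G1 /F1 /=; case: gfx => -[_ _ -> //].
by split; [split=> //; exact: continuous_comp|rewrite /tangent_map /= e].
Qed.

Lemma mdiff_cst E F M N (AM : atlas E M) (AN : atlas F N) (q : N) (x : M) :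
  mdiff AM AN (fun=> q) x /\ tangent_map AM AN (fun=> q) x = (fun=> 0) :> (E -> F).
Proof.
have [d e] := has_diff_cst (cfun (AN q) q) (cfun (AM x) x).
by split; first by split; [exact: cvg_cst|exact: d].
Qed.

Lemma mdiff_id E M (AM : atlas E M) (x : M) : good_chart AM x ->
  mdiff AM AM (fun y => y) x /\ tangent_map AM AM (fun y => y) x = (fun v => v) :> (E -> E).
Proof.
move=> gx.
have [d e] : has_diff (cfun (AM x) \o (fun y => y) \o cinv (AM x)) (cfun (AM x) x) (fun v => v).
  apply: has_diff_near (has_diff_id _).
  by apply: filterS (good_cfunK gx) => z /= ->.
by split; first by split; [exact: cvg_id|exact: d].
Qed.

Lemma mdiff_pair E F H M N P (AM : atlas E M) (AN : atlas F N) (AP : atlas H P)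
    (f : M -> N) (g : M -> P) x :
  mdiff AM AN f x -> mdiff AM AP g x ->
  mdiff AM (prod_atlas AN AP) (fun y => (f y, g y)) x /\
  tangent_map AM (prod_atlas AN AP) (fun y => (f y, g y)) x =
    (fun v => (tangent_map AM AN f x v, tangent_map AM AP g x v)) :> (E -> F * H).
Proof.
move=> [fc fd] [gc gd].
set F1 := cfun (AN (f x)) \o f \o cinv (AM x) in fd *.
set G1 := cfun (AP (g x)) \o g \o cinv (AM x) in gd *.
have hF : has_diff F1 (cfun (AM x) x) ('d F1 (cfun (AM x) x)) by [].
have hG : has_diff G1 (cfun (AM x) x) ('d G1 (cfun (AM x) x)) by [].
have [d e] := has_diff_pair hF hG.
split; first by split; [exact: cvg_pair|exact: d].
exact: e.
Qed.

End Manifolds.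

Lemma has_diff_unique (R : realType) (V W : normedModType R) (f : V -> W) x L L' :
  has_diff f x L -> has_diff f x L' -> L = L'.
Proof. by move=> [_ <-] [_ <-]. Qed.

(** * The adjoint action and the chart at the identity *)

Section LieCharts.
Context {R : realType} {n : nat} {G : topologicalGroupType}.
Variable At : atlas 'rV[R]_n G.
Hypothesis G_lie : is_lie_group At.
Local Notation V := 'rV[R]_n.

Lemma lie_chart x : good_chart At x.
Proof. by case: G_lie => -[_ _ H _] _ _; exact: H. Qed.

Lemma lie_prod_chart p : good_chart (prod_atlas At At) p.
Proof. by apply: good_prod; exact: lie_chart. Qed.

Lemma mdiff_lieM E M (AM : atlas E M) (f g : M -> G) x : good_chart AM x ->
  mdiff AM At f x -> mdiff AM At g x ->
  mdiff AM At (fun y => f y * g y)%g x.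
Proof.
move=> gx df dg; have [dp _] := mdiff_pair df dg.
have dm : mdiff (prod_atlas At At) At (fun p : G * G => (p.1 * p.2)%g) (f x, g x).
  apply: (@Ck_map_mdiff _ _ _ _ _ _ _ 0); [exact: lie_prod_chart|exact: lie_chart|].
  by case: G_lie => _ + _; exact.
exact: (mdiff_comp gx (lie_prod_chart _) dp dm).1.
Qed.

Definition conj_by (g x : G) : G := (g * x * g^-1)%g.

Lemma conj_by1 g : conj_by g 1%g = 1%g.
Proof. by rewrite /conj_by mulg1 mulgV. Qed.

Lemma mdiff_conj g x : mdiff At At (conj_by g) x.
Proof.
have gx := lie_chart x.
apply: mdiff_lieM => //; last exact: (mdiff_cst _ _ _ _).1.
by apply: mdiff_lieM => //; [exact: (mdiff_cst _ _ _ _).1|exact: (mdiff_id gx).1].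
Qed.

Lemma mdiff_smooth (s : G -> G) x : smooth_map At At s -> mdiff At At s x.
Proof.
move=> ss; apply: (@Ck_map_mdiff _ _ _ _ _ _ _ 0); [exact: lie_chart|exact: lie_chart|].
exact: ss.
Qed.

Lemma AdD g X Y : Ad At g (X + Y) = Ad At g X + Ad At g Y.
Proof. by rewrite /Ad /tangent_map linearD. Qed.
Lemma AdZ g (c : R) X : Ad At g (c *: X) = c *: Ad At g X.
Proof. by rewrite /Ad /tangent_map linearZ. Qed.
Lemma Ad0 g : Ad At g 0 = 0.
Proof. by rewrite /Ad /tangent_map linear0. Qed.
Lemma AdN g X : Ad At g (- X) = - Ad At g X.
Proof. by rewrite /Ad /tangent_map linearN. Qed.
Lemma AdB g X Y : Ad At g (X - Y) = Ad At g X - Ad At g Y.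
Proof. by rewrite AdD AdN. Qed.

Lemma Ad1 X : Ad At 1%g X = X.
Proof.
rewrite /Ad (_ : (fun y => _) = (fun y => y)); last first.
  by apply/funext => y; rewrite mul1g invg1 mulg1.
by rewrite (mdiff_id (lie_chart _)).2.
Qed.

Lemma AdM g h X : Ad At (g * h)%g X = Ad At g (Ad At h X).
Proof.
have E : (fun y => (g * h) * y * (g * h)^-1)%g = conj_by g \o conj_by h.
  by apply/funext => y; rewrite /conj_by /= invgM !mulgA.
have [_] := mdiff_comp (lie_chart _) (lie_chart _) (mdiff_conj h 1%g) (mdiff_conj g _).
by rewrite {1}/Ad E conj_by1 => ->.
Qed.

Lemma AdK g X : Ad At g^-1%g (Ad At g X) = X.
Proof. by rewrite -AdM mulVg Ad1. Qed.
Lemma AdVK g X : Ad At g (Ad At g^-1%g X) = X.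
Proof. by rewrite -AdM mulgV Ad1. Qed.

Lemma differential_Ad (s : G -> G) g X : mdiff At At s 1%g ->
  (forall x y, s (x * y) = s x * s y)%g ->
  differential At s (Ad At g X) = Ad At (s g) (differential At s X).
Proof.
move=> ds sM.
have s1 : s 1%g = 1%g.
  by apply: (@mulgI _ (s 1%g)); rewrite -sM !mulg1.
have sV x : s x^-1%g = (s x)^-1%g.
  by apply: (@mulgI _ (s x)); rewrite -sM !mulgV.
have E : s \o conj_by g = conj_by (s g) \o s.
  by apply/funext => y; rewrite /conj_by /= !sM sV.
have ds' : mdiff At At s (conj_by g 1%g) by rewrite conj_by1.
have [_ e1] := mdiff_comp (lie_chart _) (lie_chart _) (mdiff_conj g 1%g) ds'.
have [_ e2] := mdiff_comp (lie_chart _) (lie_chart _) ds (mdiff_conj (s g) _).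
move: e1 e2; rewrite E conj_by1 s1 => -> /(congr1 (@^~ X)) /= e.
exact: e.
Qed.

Lemma differentialD s X Y : differential At s (X + Y) = differential At s X + differential At s Y.
Proof. by rewrite /differential /tangent_map linearD. Qed.
Lemma differentialZ s (c : R) X : differential At s (c *: X) = c *: differential At s X.
Proof. by rewrite /differential /tangent_map linearZ. Qed.

Lemma differential0 s : differential At s 0 = 0.
Proof. by rewrite /differential /tangent_map linear0. Qed.
Lemma differentialN s X : differential At s (- X) = - differential At s X.
Proof. by rewrite /differential /tangent_map linearN. Qed.

Lemma differential_involution s X : is_involution At s ->
  differential At s (differential At s X) = X.
Proof.
move=> [ss sM sK].
have s1 : s 1%g = 1%g by apply: (@mulgI _ (s 1%g)); rewrite -sM !mulg1.
have [_] := mdiff_comp (lie_chart _) (lie_chart _) (mdiff_smooth 1%g ss) (mdiff_smooth _ ss).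
rewrite (_ : s \o s = fun y => y); last by apply/funext => y /=.
by rewrite (mdiff_id (lie_chart _)).2 s1 => /(congr1 (@^~ X)) /= e; exact: esym e.
Qed.

Local Notation y0 := (cfun (At 1%g) 1%g).
(** The chart at the identity, translated so that the identity element has coordinate 0; the
    translation leaves differentials unchanged. *)
Definition lphi (x : G) : V := cfun (At 1%g) x - y0.
Definition lpsi (v : V) : G := cinv (At 1%g) (v + y0).
Local Notation dom := (cdom (At 1%g)).

Lemma lphiE x : lphi x = cfun (At 1%g) x - y0. Proof. by []. Qed.
Lemma lpsiE v : lpsi v = cinv (At 1%g) (v + y0). Proof. by []. Qed.

Lemma lphiK x : dom x -> lpsi (lphi x) = x.
Proof.
by move=> dx; rewrite /lpsi /lphi subrK; have [[_ _ K _ _] _] := lie_chart 1%g; exact: K.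
Qed.

Lemma lphi1 : lphi 1%g = 0. Proof. by rewrite /lphi subrr. Qed.
Lemma lpsi0 : lpsi 0 = 1%g.
Proof. by rewrite -lphi1 lphiK //; exact: (lie_chart _).2. Qed.

Lemma dom_nbhs : nbhs 1%g dom. Proof. exact: good_dom (lie_chart _). Qed.

Lemma has_diff_shift (w x : V) : has_diff (fun z : V => z + w) x (fun z => z).
Proof.
have := has_diffD (has_diff_id x) (has_diff_cst w x).
by under [X in has_diff _ _ X]funext do rewrite addr0.
Qed.

Lemma shift_continuous (v w : V) : {for w, continuous (fun z : V => z + v)}.
Proof. by apply: differentiable_continuous; exact: (has_diff_shift v w).1. Qed.

Lemma lphi_continuous x : dom x -> {for x, continuous lphi}.
Proof.
move=> dx.
apply: (@continuous_comp _ _ _ (cfun (At 1%g)) (fun z => z + - y0)).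
  exact: chart_cfun_continuous (lie_chart 1%g).1 dx.
exact: shift_continuous.
Qed.

Lemma lpsi_continuous x : dom x -> {for lphi x, continuous lpsi}.
Proof.
move=> dx.
apply: (@continuous_comp _ _ _ (fun z => z + y0) (cinv (At 1%g))).
  exact: shift_continuous.
by rewrite /lphi subrK; exact: chart_cinv_continuous (lie_chart 1%g).1 dx.
Qed.

Lemma lpsi_continuous0 : lpsi @ (0 : V) --> 1%g.
Proof.
have := lpsi_continuous (lie_chart 1%g).2.
by rewrite lphi1 /prop_for /continuous_at lpsi0.
Qed.

Lemma lpsi_near : \forall v \near (0 : V), dom (lpsi v) /\ lphi (lpsi v) = v.
Proof.
apply: filterI; first by apply: lpsi_continuous0; exact: dom_nbhs.
have := good_cfunK (lie_chart 1%g).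
rewrite (near_shift 0) subr0; apply: filterS => v /=.
by rewrite /lphi /lpsi /= => ->; rewrite addrK.
Qed.

Lemma mdiff_lphi (f : G -> G) : f 1%g = 1%g -> mdiff At At f 1%g ->
  has_diff (fun v => lphi (f (lpsi v))) 0 (differential At f).
Proof.
move=> f1 [fc fd].
have h1 : has_diff (fun v : V => v + y0) 0 (fun v => v) by exact: has_diff_shift.
have h2 : has_diff (cfun (At (f 1%g)) \o f \o cinv (At 1%g)) (0 + y0) (differential At f).
  by rewrite add0r.
have h3 := has_diff_comp h1 h2.
have h4 := has_diff_comp h3 (has_diff_shift (- y0) _).
by apply: has_diff_ext h4 => // v /=; rewrite f1.
Qed.

Lemma Ad_lphi g : has_diff (fun v => lphi (g * lpsi v * g^-1)%g) 0 (Ad At g).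
Proof. exact: (mdiff_lphi (conj_by1 g) (mdiff_conj g _)). Qed.

End LieCharts.

(** * Multiplication and inversion in coordinates *)

Section LocalGroup.
Context {R : realType} {n : nat} {G : topologicalGroupType}.
Variable At : atlas 'rV[R]_n G.
Hypothesis G_lie : is_lie_group At.
Local Notation V := 'rV[R]_n.
Local Notation y0 := (cfun (At 1%g) 1%g).
Local Notation dom := (cdom (At 1%g)).
Local Notation lphi := (lphi At).
Local Notation lpsi := (lpsi At).

(** Here a point near [g0] is multiplied on the right by an element near the identity, with the
    chart at [g0] for point and product. This serves the curves [g * gexp (t *: X)] away from the
    identity; [g0 = 1] gives [mulc]. *)
Definition trans_dom (g0 : G) : set (V * V) :=
  [set p | exists x y, [/\ cdom (At g0) x, dom y, cdom (At g0) (x * y)%g &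
                           p = (cfun (At g0) x, lphi y)]].

Lemma trans_dom_open g0 : open (trans_dom g0).
Proof.
pose U := cfun (prod_atlas At At (g0, 1%g)) @`
  (cdom (prod_atlas At At (g0, 1%g)) `&` (fun p : G * G => p.1 * p.2)%g @^-1` cdom (At g0)).
have oU : open U.
  apply: chart_image_open; first exact: (lie_prod_chart G_lie (g0, 1%g)).1.
  apply: open_comp; last by have [[]] := lie_chart G_lie g0.
  by move=> p _; exact: mulg_continuous.
have -> : trans_dom g0 = (fun p : V * V => p + ((0, y0) : V * V)) @^-1` U.
  apply/seteqP; split=> [_ [x [y [dx dy dxy ->]]]|[u v]] /=.
    exists (x, y) => //=; rewrite /GRing.add /= /add_pair /=.
    by rewrite addr0 /lphi subrK.
  move=> [[x y] [/= [dx dy] dxy]]; rewrite /GRing.add /= /add_pair /= => -[e1 e2].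
  exists x, y; split=> //; rewrite e1 /lphi /= e2; congr (_, _); first by rewrite addr0.
  by rewrite addrK.
apply: open_comp => // p _.
by apply: differentiable_continuous; exact: (has_diffD (has_diff_id p) (has_diff_cst _ p)).1.
Qed.

Lemma trans_smooth g0 k : Ck k (trans_dom g0)
  (fun p : V * V => cfun (At g0) (cinv (At g0) p.1 * lpsi p.2)%g).
Proof.
have [_ sm _] := G_lie; have [_ /(_ (g0, 1%g))] := sm k.
rewrite /= mulg1.
set U := _ @` _ => CU.
pose S (p : V * V) : V * V := (p.1, p.2 + y0).
have hcV := @has_coordinates_rV R n.
have CS : Ck k (trans_dom g0) S.
  apply: Ck_pair; first exact: trans_dom_open.
    by apply: (@Ck_lin _ k _ _ _ fst) => p; exact: fst_continuous.
  apply: Ck_add; first exact: trans_dom_open; last exact: Ck_cst.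
  by apply: (@Ck_lin _ k _ _ _ snd) => p; exact: snd_continuous.
have SU p : trans_dom g0 p -> U (S p).
  move=> [x [y [dx dy dxy ->]]]; exists (x, y) => //=.
  by rewrite /S /= /lphi subrK.
exact: (Ck_comp (has_coordinates_prod hcV hcV) (@trans_dom_open g0) SU CS CU).
Qed.

Definition mulc (p : V * V) : V := lphi (lpsi p.1 * lpsi p.2)%g.
Definition mulc_dom : set (V * V) :=
  [set p | exists x y, [/\ dom x, dom y, dom (x * y)%g & p = (lphi x, lphi y)]].

Lemma mulc_domE : mulc_dom = (fun p : V * V => (p.1 + y0, p.2)) @^-1` trans_dom 1%g.
Proof.
apply/seteqP; split=> [_ [x [y [dx dy dxy ->]]]|[u v]] /=.
  by exists x, y; split=> //=; rewrite /lphi subrK.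
move=> [x [y [dx dy dxy [e1 e2]]]]; exists x, y; split=> //.
by rewrite /= -e2 /lphi -e1 addrK.
Qed.

Lemma Ck_shift_fst k U : open U -> Ck k U (fun p : V * V => (p.1 + y0, p.2)).
Proof.
move=> oU; apply: Ck_pair => //; last by apply: (@Ck_lin _ k _ _ _ snd) => p; exact: snd_continuous.
apply: Ck_add => //; last exact: Ck_cst.
by apply: (@Ck_lin _ k _ _ _ fst) => p; exact: fst_continuous.
Qed.

Lemma mulc_dom_open : open mulc_dom.
Proof.
rewrite mulc_domE; apply: open_comp; last exact: trans_dom_open.
by move=> p _; apply: (Ck_cont (Ck_shift_fst 0 openT)).
Qed.

Lemma mulc_smooth k : Ck k mulc_dom mulc.
Proof.
have hcV := @has_coordinates_rV R n.
have H : Ck k mulc_dom (fun p : V * V =>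
    cfun (At 1%g) (cinv (At 1%g) (p.1 + y0, p.2).1 * lpsi (p.1 + y0, p.2).2)%g).
  apply: (Ck_comp (has_coordinates_prod hcV hcV) mulc_dom_open _
    (Ck_shift_fst k mulc_dom_open) (trans_smooth 1%g k)).
  by move=> p; rewrite mulc_domE.
exact: (Ck_add mulc_dom_open H (Ck_cst k mulc_dom (- y0))).
Qed.

Lemma mulc_domP u v : mulc_dom (u, v) ->
  [/\ dom (lpsi u), dom (lpsi v), dom (lpsi u * lpsi v)%g, lphi (lpsi u) = u &
      lphi (lpsi v) = v].
Proof. by move=> [x [y [dx dy dxy [-> ->]]]]; rewrite !lphiK. Qed.

Lemma mulc_dom0 : mulc_dom (0, 0).
Proof.
have d1 := (lie_chart G_lie 1%g).2.
by exists 1%g, 1%g; rewrite mulg1 lphi1.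
Qed.

Definition invc (u : V) : V := lphi (lpsi u)^-1%g.
Definition invc_dom : set V := [set u | exists x, [/\ dom x, dom x^-1%g & u = lphi x]].

Lemma invc_dom_open : open invc_dom.
Proof.
have -> : invc_dom = (fun u => u + y0) @^-1`
    (cfun (At 1%g) @` (dom `&` (fun x => x^-1%g) @^-1` dom)).
  apply/seteqP; split=> [_ [x [dx dy ->]]|u /= [x [dx dy] e]] /=.
    by exists x => //; rewrite /lphi subrK.
  by exists x; split=> //; rewrite /lphi e addrK.
apply: open_comp; first by move=> u _; exact: shift_continuous.
apply: chart_image_open; first exact: (lie_chart G_lie 1%g).1.
apply: open_comp; last by have [[]] := lie_chart G_lie 1%g.
by move=> p _; exact: invg_continuous.
Qed.

Lemma invc_smooth k : Ck k invc_dom invc.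
Proof.
have [_ _ sm] := G_lie; have [_ /(_ 1%g)] := sm k.
rewrite /= invg1.
set U := _ @` _ => CU.
have CS : Ck k invc_dom (fun u => u + y0).
  by apply: Ck_add; [exact: invc_dom_open|exact: Ck_id|exact: Ck_cst].
have H : Ck k invc_dom (fun u => (cfun (At 1%g) \o (fun x => x^-1%g) \o cinv (At 1%g)) (u + y0)).
  apply: (Ck_comp (@has_coordinates_rV R n) invc_dom_open _ CS CU).
  by move=> _ [x [dx dy ->]]; exists x => //; rewrite /lphi subrK.
exact: (Ck_add invc_dom_open H (Ck_cst k invc_dom (- y0))).
Qed.

Lemma invc_domP u : invc_dom u ->
  [/\ dom (lpsi u), dom (lpsi u)^-1%g & lphi (lpsi u) = u].
Proof. by move=> [x [dx dy ->]]; rewrite !lphiK. Qed.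

Lemma invc_dom0 : invc_dom 0.
Proof. by exists 1%g; rewrite invg1 lphi1; split=> //; exact: (lie_chart G_lie 1%g).2. Qed.

Lemma has_diff_inl (x y : V) : has_diff (fun u : V => (u, y)) x (fun u => (u, 0)).
Proof. by apply: has_diff_pair; [exact: has_diff_id|exact: has_diff_cst]. Qed.

Lemma has_diff_inr (x y : V) : has_diff (fun u : V => (x, u)) y (fun u => (0, u)).
Proof. by apply: has_diff_pair; [exact: has_diff_cst|exact: has_diff_id]. Qed.

(** On either axis one factor is the identity element, so [mulc] restricts to the identity map near
    0. *)
Lemma mulc_diff0 : has_diff mulc (0, 0) (fun p => p.1 + p.2).
Proof.
have [d _] := mulc_smooth 1; have d0 := d _ mulc_dom0.
split=> //; apply/funext => -[u v] /=.
have h : has_diff mulc (0, 0) ('d mulc (0 : V, 0 : V)) by [].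
have -> : (u, v) = (u, 0) + (0, v) :> V * V.
  by rewrite /GRing.add /= /add_pair /= addr0 add0r.
rewrite linearD; congr (_ + _).
  have e := has_diff_comp (f := fun u : V => (u, 0)) (has_diff_inl 0 0) h.
  rewrite -[LHS]/((fun v => 'd mulc (0, 0) (v, 0)) u) (has_diff_unique e (L' := fun v => v)) //.
  apply: has_diff_near (has_diff_id _).
  by apply: filterS (lpsi_near G_lie) => w [dw ew]; rewrite /mulc /= lpsi0 // mulg1.
have e := has_diff_comp (f := fun u : V => (0, u)) (has_diff_inr 0 0) h.
rewrite -[LHS]/((fun v => 'd mulc (0, 0) (0, v)) v) (has_diff_unique e (L' := fun v => v)) //.
apply: has_diff_near (has_diff_id _).
by apply: filterS (lpsi_near G_lie) => w [dw ew]; rewrite /mulc /= lpsi0 // mul1g.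
Qed.

Definition sqc (v : V) : V := mulc (v, v).

Lemma sqc_quad_diff : exists C r, quad_diff sqc 0 (fun v => 2 *: v) C r /\
  forall v, `|v| <= r -> mulc_dom (v, v).
Proof.
pose U := (fun v : V => (v, v)) @^-1` mulc_dom.
have cdiag k (W : set V) : open W -> Ck k W (fun v : V => (v, v)).
  by move=> oW; apply: Ck_pair => //; exact: Ck_id.
have oU : open U.
  apply: open_comp; last exact: mulc_dom_open.
  by move=> v _; exact: (Ck_cont (cdiag 0 _ openT)).
have hcV := @has_coordinates_rV R n.
have C2 : Ck 2 U sqc.
  exact: (Ck_comp (has_coordinates_prod hcV hcV) oU _ (cdiag 2 _ oU) (mulc_smooth 2)).
have [C [r [q qU]]] := C2_quad_diff hcV oU mulc_dom0 C2.
exists C, r; split=> [|v vr]; last by apply: qU; rewrite subr0.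
have [_ e] : has_diff sqc 0 (fun v => 2 *: v).
  have := has_diff_comp (f := fun v : V => (v, v)) (has_diff_pair (has_diff_id 0) (has_diff_id 0)) mulc_diff0.
  by apply: has_diff_ext => // u /=; rewrite scaler_nat mulr2n.
by rewrite -e.
Qed.

End LocalGroup.

(** * The exponential map *)

Section DyadicLimits.
Context {R : realType} {V : normedModType R}.

Lemma pow2_scaled_cvg0 (u : nat -> V) (X : V) :
  (fun k => 2 ^+ k *: u k) @ \oo --> X -> u @ \oo --> (0 : V).
Proof.
move=> H.
have -> : u = (fun k => 2^-1 ^+ k *: (2 ^+ k *: u k)).
  apply/funext => k; rewrite scalerA -exprMn_comm; last exact: mulrC.
  by rewrite mulVf // expr1n scale1r.
rewrite -[X in _ --> X](scale0r X); apply: cvgZ => //.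
apply: cvg_trans (@cvg_geometric _ 1 2^-1 _); last by rewrite ger0_norm // invf_lt1 // ltr1n.
by apply: near_eq_cvg; apply: nearW => k /=; rewrite mul1r.
Qed.

(** The error [F u - L u] is [o(u)], and it is multiplied by [2 ^+ k] while [2 ^+ k *: u k] stays
    bounded. *)
Lemma has_diff_pow2 (W : normedModType R) (F : V -> W) (L : V -> W) (u : nat -> V) (X : V) :
  has_diff F 0 L -> F 0 = 0 -> (fun k => 2 ^+ k *: u k) @ \oo --> X ->
  (fun k => 2 ^+ k *: F (u k)) @ \oo --> L X.
Proof.
move=> [d <-] F0 H.
have u0 := pow2_scaled_cvg0 H.
have Lc := diff_continuous d.
have cL : (fun k => 'd F 0 (2 ^+ k *: u k)) @ \oo --> 'd F 0 X.
  by apply: continuous_cvg => //; exact: Lc.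
apply/cvgrPdist_le => e e0.
have [M M0 HM] : exists2 M, 0 < M & \forall k \near \oo, `|2 ^+ k *: u k| <= M.
  exists (`|X| + 1); first by rewrite ltr_wpDl.
  move/cvgrPdist_le : H => /(_ _ ltr01); apply: filterS => k h.
  rewrite -[X in `|X|](subrK X) addrC; apply: le_trans (ler_normD _ _) _.
  by rewrite lerD2l distrC.
have e1 : 0 < e / 2 / M by rewrite !divr_gt0.
have := diff_eps d e1; rewrite F0 => /u0 /= h1.
have e2 : 0 < e / 2 by rewrite divr_gt0.
move/cvgrPdist_le : cL => /(_ _ e2) h2.
near=> k.
have g1 : `|F (u k) - 0 - 'd F 0 (u k - 0)| <= e / 2 / M * `|u k - 0| by near: k; exact: h1.
have g2 : `|'d F 0 X - 'd F 0 (2 ^+ k *: u k)| <= e / 2 by near: k; exact: h2.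
have g3 : `|2 ^+ k *: u k| <= M by near: k; exact: HM.
rewrite !subr0 in g1.
have -> : 'd F 0 X - 2 ^+ k *: F (u k) =
  ('d F 0 X - 'd F 0 (2 ^+ k *: u k)) - 2 ^+ k *: (F (u k) - 'd F 0 (u k)).
  by rewrite (linearZ_LR ('d F 0)) /= scalerBr opprB addrA subrK.
apply: le_trans (ler_normB _ _) _; rewrite (splitr e); apply: lerD => //.
rewrite normrZ in g3; rewrite [leLHS]normrZ; apply: (@le_trans _ _ (`|2 ^+ k| * (e / 2 / M * `|u k|))).
  by rewrite ler_wpM2l.
rewrite mulrCA -[leRHS](divfK (lt0r_neq0 M0)).
by rewrite ler_wpM2l // ltW.
Unshelve. all: by end_near. Qed.

End DyadicLimits.

Section Exponential.
Context {R : realType} {n : nat} {G : topologicalGroupType}.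
Variable At : atlas 'rV[R]_n G.
Hypothesis G_lie : is_lie_group At.
Local Notation V := 'rV[R]_n.
Local Notation dom := (cdom (At 1%g)).
Local Notation lphi := (lphi At).
Local Notation lpsi := (lpsi At).

(* The sequence [exp (X / 2^k)], characterized without one-parameter groups. *)
Definition root_seq (X : V) (f : nat -> G) :=
  [/\ forall k, f k = (f k.+1 * f k.+1)%g, f @ \oo --> 1%g &
      (fun k => 2 ^+ k *: lphi (f k)) @ \oo --> X].

Lemma root_seq_dom X f : root_seq X f -> \forall k \near \oo, dom (f k).
Proof. by move=> [_ f1 _]; apply: f1; exact: dom_nbhs. Qed.

Lemma cvg_seqS (T : topologicalType) (f : nat -> T) (l : T) :
  (fun k => f k.+1) @ \oo --> l <-> f @ \oo --> l.
Proof.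
split=> H A /H [N _ h].
  by exists N.+1 => // -[//|k] /= kN; exact: h.
by exists N => // k /= kN; apply: h; exact: leqW.
Qed.

Lemma root_seqS X f : root_seq X f -> root_seq (2^-1 *: X) (fun k => f k.+1).
Proof.
move=> [fs f1 fX]; split=> [k||]; [exact: fs|exact/(cvg_seqS f)|].
have h : (fun k => 2 ^+ k.+1 *: lphi (f k.+1)) @ \oo --> X.
  by rewrite (cvg_shiftS (fun k => 2 ^+ k *: lphi (f k))).
have -> : (fun k => 2 ^+ k *: lphi (f k.+1)) =
    (fun k => 2^-1 *: (2 ^+ k.+1 *: lphi (f k.+1))).
  by apply/funext => k; rewrite scalerA exprS mulKf.
exact: cvgZr.
Qed.

Lemma root_seq_shift X f N : root_seq X f ->
  root_seq (2^-1 ^+ N *: X) (fun k => f (N + k)%N).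
Proof.
elim: N X f => [|N IH] X f rf; first by rewrite expr0 scale1r.
have := IH _ _ (root_seqS rf).
by rewrite scalerA -exprSr.
Qed.

(** Beyond some rank both sequences lie in the chart with geometric bounds, so
    [root_sequence_unique] applies to the tails; repeated squaring carries the equality back to rank
    0. *)
Lemma root_seq_unique X f g : root_seq X f -> root_seq X g -> f 0 = g 0.
Proof.
move=> rf rg; have [fs f1 fX] := rf; have [gs g1 gX] := rg.
have [C [r [q qU]]] := sqc_quad_diff G_lie.
have [_ r0 _] := q.
have bdd h : (fun k => 2 ^+ k *: lphi (h k)) @ \oo --> X ->
    \forall k \near \oo, `|lphi (h k)| <= (`|X| + 1) * 2^-1 ^+ k.
  move=> /cvgrPdist_le /(_ _ ltr01); apply: filterS => k hk.
  have p2 : 0 < 2 ^+ k :> R by rewrite exprn_gt0.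
  rewrite exprVn ler_pdivlMr // mulrC -[2 ^+ k](ger0_norm (ltW p2)) -normrZ.
  rewrite -[X in `|X|](subrK X) addrC; apply: le_trans (ler_normD _ _) _.
  by rewrite lerD2l distrC.
have half0 : \forall k \near \oo, (`|X| + 1) * 2^-1 ^+ k <= r.
  have : (fun k => (`|X| + 1) * 2^-1 ^+ k) @ \oo --> (0 : R).
    by apply: (@cvg_geometric _ (`|X| + 1) 2^-1); rewrite ger0_norm // invf_lt1 // ltr1n.
  move=> /cvgrPdist_le /(_ _ r0); apply: filterS => k.
  by rewrite sub0r normrN; apply: le_trans; exact: ler_norm.
have [N _ HN] := filterI (filterI (bdd f fX) (bdd g gX))
  (filterI half0 (filterI (root_seq_dom rf) (root_seq_dom rg))).
have B0 : 0 <= `|X| + 1 by rewrite addr_ge0.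
have fd k : dom (f (N + k)%N) by have [_ [_ []]] := HN (N + k)%N (leq_addr _ _).
have gd k : dom (g (N + k)%N) by have [_ [_ []]] := HN (N + k)%N (leq_addr _ _).
have Lf k : lphi (f (N + k)%N) = sqc At (lphi (f (N + k.+1)%N)).
  by rewrite /sqc /mulc /= lphiK // addnS -fs.
have Lg k : lphi (g (N + k)%N) = sqc At (lphi (g (N + k.+1)%N)).
  by rewrite /sqc /mulc /= lphiK // addnS -gs.
have Br : (`|X| + 1) * 2^-1 ^+ N <= r by have [_ []] := HN N (leqnn N).
have bf k : `|lphi (f (N + k)%N)| <= (`|X| + 1) * 2^-1 ^+ N * 2^-1 ^+ k.
  by rewrite -mulrA -exprD; have [[+ _] _] := HN (N + k)%N (leq_addr _ _).
have bg k : `|lphi (g (N + k)%N)| <= (`|X| + 1) * 2^-1 ^+ N * 2^-1 ^+ k.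
  by rewrite -mulrA -exprD; have [[_ +] _] := HN (N + k)%N (leq_addr _ _).
have lim0 : (fun k => 2 ^+ k *: (lphi (f (N + k)%N) - lphi (g (N + k)%N))) @ \oo --> (0 : V).
  have [_ _ h1] := root_seq_shift N rf; have [_ _ h2] := root_seq_shift N rg.
  rewrite -(subrr (2^-1 ^+ N *: X)).
  under eq_fun do rewrite scalerBr.
  exact: cvgB h1 h2.
have := root_sequence_unique q Br Lf Lg bf bg lim0.
rewrite addn0 => E.
have {}E : f N = g N by rewrite -(lphiK G_lie (x := f N)) ?E ?lphiK //; have := fd 0; have := gd 0; rewrite addn0.
elim: N E {HN fd gd Lf Lg Br bf bg lim0} => // N IH E.
by apply: IH; rewrite fs gs E.
Qed.

Lemma root_seq_exists_local : exists (E : V -> V) (A r : R),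
  [/\ quad_diff E 0 idfun A r, A * r <= 1, E 0 = 0 &
    forall X, `|X| <= r -> [/\ root_seq X (fun k => lpsi (E (2^-1 ^+ k *: X))),
       dom (lpsi (E X)) & lphi (lpsi (E X)) = E X]].
Proof.
have [C [r [q qU]]] := sqc_quad_diff G_lie.
have sq0 : sqc At 0 = 0 by rewrite /sqc /mulc /= lpsi0 // mulg1 lphi1.
have [E [A [rE [rEr ArE qE E0 Esq]]]] := square_functional_equation q sq0.
have [A0 rE0 qE'] := qE.
have EP X : `|X| <= rE -> `|E X - X| <= A * `|X| * `|X|.
  move=> h; have := qE' `|X| X 0 h.
  by rewrite !subr0 normr0 E0 subr0 => /(_ (lexx _) (normr_ge0 _)).
have Ebd X : `|X| <= rE -> `|E X| <= 2 * `|X|.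
  move=> h; rewrite -[E X](subrK X); apply: le_trans (ler_normD _ _) _.
  have := EP _ h; have : A * `|X| * `|X| <= 1 * `|X|.
    by rewrite ler_wpM2r //; apply: le_trans ArE; rewrite ler_pM2l.
  by lra.
(* The radius is halved because [E] at most doubles norms and [E X] must stay where squaring is
   defined in the chart. *)
exists E, A, (rE / 2); split=> //.
- split=> //; first by rewrite divr_gt0.
  move=> rho x y h; apply: qE'; apply: le_trans h _.
  by rewrite ler_pdivrMr // ler_peMr ?ler1n // ltW.
- by rewrite mulrA ler_pdivrMr // mul1r; apply: le_trans ArE _; rewrite ler1n.
move=> X XrE.
have XrE' k : `|2^-1 ^+ k *: X| <= rE / 2.
  rewrite normrZ ger0_norm ?exprn_ge0 //; apply: le_trans XrE.
  by rewrite ler_piMl // exprn_ile1 // invf_le1 // ler1n.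
have Eok Y : `|Y| <= rE / 2 -> mulc_dom At (E Y, E Y).
  move=> h; apply: qU; apply: le_trans rEr.
  have h1 : `|Y| <= rE by lra.
  by have := Ebd Y h1; lra.
have EokX := mulc_domP G_lie (Eok _ XrE).
split; [|by case: EokX|by case: EokX].
have cvX : (fun k => 2^-1 ^+ k *: X) @ \oo --> (0 : V).
  rewrite -[X in _ --> X](scale0r X); apply: cvgZl.
  apply: cvg_trans (@cvg_geometric _ 1 2^-1 _); last by rewrite ger0_norm // invf_lt1 // ltr1n.
  by apply: near_eq_cvg; apply: nearW => k /=; rewrite mul1r.
have dE : has_diff E 0 idfun.
  apply: eps_diff => [x|e e0]; first exact: cvg_id.
  have m0 : 0 < Num.min rE (e / A) by rewrite lt_min rE0 divr_gt0.
  apply/nbhs_normP; exists (Num.min rE (e / A)) => //= x.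
  rewrite /ball_ /= sub0r normrN lt_min => /andP[/ltW h1 /ltW h2].
  rewrite E0 !subr0; apply: le_trans (EP _ h1) _.
  by rewrite ler_wpM2r // mulrC -ler_pdivlMr.
split.
- move=> k; have [_ _ _ e1 _] := mulc_domP G_lie (Eok _ (XrE' k.+1)).
  have h : `|2^-1 ^+ k *: X| <= rE by have := XrE' k; lra.
  have [_ _ d _ _] := mulc_domP G_lie (Eok _ (XrE' k.+1)).
  by rewrite (Esq _ h) scalerA -exprS /sqc /mulc /= lphiK.
- have c1 : (fun k => E (2^-1 ^+ k *: X)) @ \oo --> E 0.
    by apply: continuous_cvg cvX; apply: differentiable_continuous; exact: dE.1.
  rewrite E0 in c1; apply: cvg_comp c1 _; exact: lpsi_continuous0.
have c2 : (fun k => 2 ^+ k *: (2^-1 ^+ k *: X)) @ \oo --> X.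
  under eq_fun do rewrite scalerA -exprMn mulfV // expr1n scale1r.
  exact: cvg_cst.
rewrite (_ : (fun k => _) = (fun k => 2 ^+ k *: E (2^-1 ^+ k *: X))).
  exact: (has_diff_pow2 dE E0 c2).
apply/funext => k.
by have [_ _ _ -> _] := mulc_domP G_lie (Eok _ (XrE' k)).
Qed.

Lemma root_seq_double X f : root_seq X f ->
  root_seq (2 *: X) (fun k => if k is k'.+1 then f k' else (f 0 * f 0)%g).
Proof.
move=> [fs f1 fX]; set g := fun k => _.
split=> [[|k] //=||]; first exact/(cvg_seqS g).
apply/(cvg_seqS (fun k => 2 ^+ k *: lphi (g k))) => /=.
have -> : (fun k => 2 ^+ k.+1 *: lphi (f k)) = (fun k => 2 *: (2 ^+ k *: lphi (f k))).
  by apply/funext => k; rewrite scalerA -exprS.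
exact: cvgZr.
Qed.

(** Halving brings [X] into the local ball; each squaring prepends a term and undoes one halving. *)
Lemma root_seq_exists X : exists f, root_seq X f.
Proof.
have [E [A [r [[_ r0 _] _ _ H]]]] := root_seq_exists_local.
have [N hN] : exists N, `|2^-1 ^+ N *: X| <= r.
  have cvX : (fun k => `|X| * 2^-1 ^+ k) @ \oo --> (0 : R).
    by apply: (@cvg_geometric _ `|X| 2^-1); rewrite ger0_norm // invf_lt1 // ltr1n.
  move: cvX => /cvgrPdist_le /(_ _ r0) [N _ /(_ N (leqnn N))].
  rewrite sub0r normrN normrM normr_id => h; exists N.
  by rewrite normrZ mulrC.
have [+ _ _] := H _ hN; move: (fun k => _) => f {H hN E}.
elim: N f => [|N IH] f rf; first by exists f; rewrite expr0 scale1r in rf.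
have := root_seq_double rf.
by rewrite scalerA exprS mulrA mulfV // mul1r; exact: IH.
Qed.

(* Iterated square roots give the exponential without solving an ODE; [lexpE]
   identifies it with [lexp]. *)
Definition gexp (X : V) : G := xget 1%g [set g | exists2 f, root_seq X f & f 0 = g].

Lemma root_seq_gexp X f : root_seq X f -> f 0 = gexp X.
Proof.
move=> rf; rewrite /gexp; case: xgetP => [_ -> [g rg <-]|/(_ (f 0))].
  exact: root_seq_unique rf rg.
by case; exists f.
Qed.

Lemma gexp_root_seq X : root_seq X (fun k => gexp (2^-1 ^+ k *: X)).
Proof.
have [f rf] := root_seq_exists X.
rewrite (_ : (fun k => _) = f) //; apply/funext => k.
by rewrite -(root_seq_gexp (root_seq_shift k rf)) addn0.
Qed.

Lemma gexp_local : exists (E : V -> V) (A r : R),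
  [/\ quad_diff E 0 idfun A r, A * r <= 1, E 0 = 0 &
    forall X, `|X| <= r -> [/\ gexp X = lpsi (E X),
       dom (lpsi (E X)) & lphi (lpsi (E X)) = E X]].
Proof.
have [E [A [r [q Ar E0 H]]]] := root_seq_exists_local.
exists E, A, r; split=> // X /H [rX d e]; split=> //.
by rewrite -(root_seq_gexp rX) expr0 scale1r.
Qed.

Lemma quad_diff_has_diff (E : V -> V) A r : quad_diff E 0 idfun A r -> E 0 = 0 ->
  has_diff E 0 idfun.
Proof.
move=> [A0 r0 qE] E0.
apply: eps_diff => [x|e e0]; first exact: cvg_id.
have m0 : 0 < Num.min r (e / A) by rewrite lt_min r0 divr_gt0.
apply/nbhs_normP; exists (Num.min r (e / A)) => //= x.
rewrite /ball_ /= sub0r normrN lt_min => /andP[/ltW h1 /ltW h2].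
have := qE `|x| x 0 h1; rewrite !subr0 normr0 E0 subr0 => /(_ (lexx _) (normr_ge0 _)).
by move=> h; apply: le_trans h _; rewrite ler_wpM2r // mulrC -ler_pdivlMr.
Qed.

Lemma gexp_near : \forall X \near (0 : V), dom (gexp X).
Proof.
have [E [A [r [[_ r0 _] _ _ H]]]] := gexp_local.
apply/nbhs_normP; exists r => //= x.
by rewrite /ball_ /= sub0r normrN => /ltW /H [->].
Qed.

Lemma gexp_diff0 : has_diff (fun X => lphi (gexp X)) 0 idfun.
Proof.
have [E [A [r [q _ E0 H]]]] := gexp_local.
apply: has_diff_near (quad_diff_has_diff q E0).
have [_ r0 _] := q.
apply/nbhs_normP; exists r => //= x.
by rewrite /ball_ /= sub0r normrN => /ltW /H [-> _ ->].
Qed.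

Lemma gexp_cvg0 : gexp @ (0 : V) --> 1%g.
Proof.
have [E [A [r [q _ E0 H]]]] := gexp_local.
have [_ r0 _] := q.
have h : lpsi \o E @ (0 : V) --> 1%g.
  apply: cvg_comp; last exact: lpsi_continuous0.
  by have := differentiable_continuous (quad_diff_has_diff q E0).1; rewrite /prop_for /continuous_at E0.
have e : \forall x \near (0 : V), (lpsi \o E) x = gexp x.
  apply/nbhs_normP; exists r => //= x.
  by rewrite /ball_ /= sub0r normrN => /ltW /H [-> _ _].
exact: cvg_trans (near_eq_cvg e) h.
Qed.

(** A homomorphism sends square roots to square roots, and near the identity it acts on the rescaled
    sequence through its differential. *)
Lemma root_seq_map (s : G -> G) X f : mdiff At At s 1%g ->
  (forall x y, s (x * y) = s x * s y)%g -> root_seq X f ->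
  root_seq (differential At s X) (s \o f).
Proof.
move=> ds sM rf; have [fs f1 fX] := rf.
have s1 : s 1%g = 1%g by apply: (@mulgI _ (s 1%g)); rewrite -sM !mulg1.
split=> [k /=||]; first by rewrite -sM -fs.
  have [sc _] := ds; rewrite -[X in _ --> X]s1.
  exact: (cvg_comp _ _ f1 sc).
have h := has_diff_pow2 (mdiff_lphi s1 ds) _ fX.
apply: cvg_trans (h _); last by rewrite lpsi0 // s1 lphi1.
apply: near_eq_cvg; move: (root_seq_dom rf); apply: filterS => k dk /=.
by rewrite lphiK.
Qed.

Lemma gexp_map (s : G -> G) X : mdiff At At s 1%g ->
  (forall x y, s (x * y) = s x * s y)%g -> s (gexp X) = gexp (differential At s X).
Proof.
move=> ds sM; rewrite -(root_seq_gexp (root_seq_map ds sM (gexp_root_seq X))) /=.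
by rewrite expr0 scale1r.
Qed.

Lemma gexp_conj g X : (g * gexp X * g^-1)%g = gexp (Ad At g X).
Proof.
apply: (gexp_map X (mdiff_conj G_lie g 1%g)) => x y.
by rewrite /conj_by !mulgA mulgVK.
Qed.

(** Every term of a root sequence is a power of each later one, so [gexp X] commutes with all terms:
    conjugation fixes the sequence and hence its velocity. *)
Lemma Ad_gexp_self X : Ad At (gexp X) X = X.
Proof.
have rX := gexp_root_seq X.
have cM x y : conj_by (gexp X) (x * y)%g = (conj_by (gexp X) x * conj_by (gexp X) y)%g.
  by rewrite /conj_by !mulgA mulgVK.
have := root_seq_map (mdiff_conj G_lie (gexp X) 1%g) cM rX.
set f := (fun k => gexp _) in rX *.
have e0 : gexp X = f 0 by rewrite /f expr0 scale1r.
clearbody f; have [Xs _ X1] := rX.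
have -> : conj_by (gexp X) \o f = f.
  apply/funext => k /=; rewrite /conj_by.
  have : commute (gexp X) (f k).
    rewrite e0.
    have H j : forall i, commute (f i) (f (i + j)%N).
      elim: j => [|j IH] i; first by rewrite addn0; exact: commute_refl.
      rewrite (Xs i) addnS -addSn; apply: commute_sym.
      by apply: commuteM; apply: commute_sym; exact: IH.
    exact: (H k 0).
  by move=> ->; rewrite mulgK.
move=> [_ _ h]; exact: (cvg_unique _ h X1).
Qed.

(** Commutation makes the termwise products a root sequence, and the velocities add because the
    product has differential [p.1 + p.2] at the identity. *)
Lemma root_seq_mul X Y f g : root_seq X f -> root_seq Y g ->
  (forall k, commute (f k) (g k)) -> root_seq (X + Y) (fun k => f k * g k)%g.
Proof.
move=> rf rg fg; have [fs f1 fX] := rf; have [gs g1 gY] := rg; split.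
- move=> k; rewrite fs gs !mulgA; congr (_ * _)%g; rewrite -!mulgA; congr (_ * _)%g.
  exact: fg.
- rewrite -[X in _ --> X](mulg1 1%g).
  exact: (cvg_comp2 f1 g1 (@mulg_continuous G (1%g, 1%g))).
have c : (fun k => 2 ^+ k *: ((lphi (f k), lphi (g k)) : V * V)) @ \oo --> ((X, Y) : V * V).
  exact: cvg_pair fX gY.
have m0 : mulc At (0, 0) = 0 by rewrite /mulc /= lpsi0 // mulg1 lphi1.
have := has_diff_pow2 (mulc_diff0 G_lie) m0 c.
apply: cvg_trans; apply: near_eq_cvg.
have rfd := root_seq_dom rf; have rgd := root_seq_dom rg.
apply: filterS2 rfd rgd => k df dg.
by rewrite /mulc /= !lphiK.
Qed.

Lemma gexp_commute X s t : commute (gexp (s *: X)) (gexp (t *: X)).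
Proof.
have [->|s0] := eqVneq s 0.
  have -> : gexp (0 *: X) = 1%g.
    rewrite scale0r -(@root_seq_gexp 0 (fun=> 1%g)) //; split.
    - by move=> _; rewrite mulg1.
    - exact: cvg_cst.
    - by rewrite lphi1; under eq_fun do rewrite scaler0; exact: cvg_cst.
  exact/commute_sym/commute1.
have AdX : Ad At (gexp (s *: X)) X = X.
  by have := Ad_gexp_self (s *: X); rewrite AdZ => /scalerI; apply.
have := gexp_conj (gexp (s *: X)) (t *: X); rewrite AdZ AdX => e.
by rewrite /commute -{2}e mulgVK.
Qed.

Lemma gexpD X s t : gexp ((s + t) *: X) = (gexp (s *: X) * gexp (t *: X))%g.
Proof.
have := root_seq_mul (gexp_root_seq (s *: X)) (gexp_root_seq (t *: X)).
move=> /(_ _)/wrap[k|r].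
  by rewrite !scalerA; exact: gexp_commute.
by rewrite scalerDl -(root_seq_gexp r) expr0 !scale1r.
Qed.

Lemma gexp0 : gexp 0 = 1%g.
Proof.
have := gexpD 0 0 0; rewrite addr0 scale0r => e.
by apply: (@mulgI _ (gexp 0)); rewrite -e mulg1.
Qed.

Lemma gexpN X : gexp (- X) = (gexp X)^-1%g.
Proof.
apply: (@mulgI _ (gexp X)); rewrite mulgV.
have := gexpD X 1 (-1); rewrite subrr scale0r scale1r scaleN1r gexp0 => <- //.
Qed.

Lemma gexp_line_continuous X : continuous (fun t : R => gexp (t *: X)).
Proof.
move=> t.
have c0 : (fun s : R => gexp ((s - t) *: X)) @ t --> 1%g.
  have c1 : (fun s : R => (s - t) *: X) @ t --> (t - t) *: X.
    by apply: cvgZl; apply: cvgB; [exact: cvg_id|exact: cvg_cst].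
  by rewrite subrr scale0r in c1; exact: (cvg_comp _ _ c1 gexp_cvg0).
have -> : (fun s : R => gexp (s *: X)) = (fun s => gexp (t *: X) * gexp ((s - t) *: X))%g.
  by apply/funext => s; rewrite -gexpD addrC subrK.
rewrite /prop_for /continuous_at subrr scale0r gexp0.
exact: (cvg_comp2 (cvg_cst _) c0 (@mulg_continuous G (gexp (t *: X), 1%g))).
Qed.

Lemma gexp_onto : exists2 r, 0 < r & forall x, dom x -> `|lphi x| <= r ->
  exists X, `|X| <= 2 * `|lphi x| /\ gexp X = x.
Proof.
have [E [A [r [[A0 r0 qE] _ E0 H]]]] := gexp_local.
(* On this radius [E - id] has Lipschitz constant [A * r' <= 1 / 2], as [small_perturbation_onto]
   requires. *)
pose r' := Num.min r (2 * A)^-1.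
have r'0 : 0 < r' by rewrite lt_min r0 invr_gt0 mulr_gt0.
have Ar' : A * r' <= 2^-1.
  rewrite -ler_pdivlMl //; apply: (@le_trans _ _ (2 * A)^-1); first by rewrite ge_min lexx orbT.
  by rewrite invfM mulrC.
have r'r : r' <= r by rewrite ge_min lexx.
exists (r' / 2); first by rewrite divr_gt0.
move=> x dx xr.
have [|X [X2 EX]] := @small_perturbation_onto _ _ E r' (lphi x) E0 _ xr.
  move=> y z hy hz; apply: le_trans (qE r' y z r'r _ _) _; rewrite ?subr0 //.
  by rewrite ler_wpM2r.
exists X; split=> //.
have Xr : `|X| <= r by apply: le_trans r'r; move: X2 xr; lra.
by have [-> _ _] := H X Xr; rewrite EX lphiK.
Qed.

End Exponential.

Lemma rV_linear_continuous (R : realType) n (W : normedModType R)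
  (L : {linear 'rV[R]_n -> W}) : continuous L.
Proof.
have E : (fun v : 'rV[R]_n => L v) =
    (fun v => \sum_j coord_lin j v *: L (delta_mx 0 j)).
  apply/funext => v; rewrite [in LHS](row_sum_delta v) linear_sum.
  by apply: eq_bigr => j _; rewrite linearZ.
suff : continuous (fun v : 'rV[R]_n => L v) by [].
rewrite E => v; apply: (Ck_cont (U := setT) (k := 0)) => //; apply: Ck_sum; first exact: openT.
move=> j; apply: Ck_scale; first exact: openT; last exact: Ck_cst.
by apply: Ck_lin => w; exact: coord_continuous.
Qed.

Lemma zero_diff_cst (R : realType) n (f : R -> 'rV[R]_n) :
  (forall t, has_diff f t (fun=> 0)) -> forall t, f t = f 0.
Proof.
move=> df t; apply/eqP; rewrite -subr_eq0 -normr_le0.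
have L0 z v : `|'d f z v - (\0 : {linear R -> 'rV[R]_n}) v| <= 0 * `|v|.
  by rewrite (df z).2 /= subrr normr0 mul0r.
have := @mean_value _ _ _ f (\0 : {linear R -> 'rV[R]_n}) 0 t 0 `|t| 0 (lexx _).
rewrite !subr0 normr0 mul0r /=; apply=> // z _; exact: (df z).1.
Qed.

(** * One-parameter subgroups *)

Section OneParameter.
Context {R : realType} {n : nat} {G : topologicalGroupType}.
Variable At : atlas 'rV[R]_n G.
Hypothesis G_lie : is_lie_group At.
Local Notation V := 'rV[R]_n.
Local Notation dom := (cdom (At 1%g)).
Local Notation lphi := (lphi At).
Local Notation lpsi := (lpsi At).
Local Notation gexp := (gexp At).

Lemma has_diff_gexp_line X (t0 : R) :
  has_diff (fun t : R => lphi (gexp ((t - t0) *: X))) t0 (fun s => s *: X).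
Proof.
have h : has_diff (fun t : R => (t - t0) *: X) t0 (fun s => s *: X).
  apply: has_diff_ext (has_diffB (has_diff_line X t0) (has_diff_cst (t0 *: X) t0)) => s /=.
    by rewrite scalerBl.
  by rewrite subr0.
have g : has_diff (fun X => lphi (gexp X)) ((t0 - t0) *: X) idfun.
  by rewrite subrr scale0r; exact: gexp_diff0.
exact: (has_diff_comp h g).
Qed.

(** As [gam s = gam t * gexp ((s - t) *: X)], the curve read in the chart satisfies
    [y' = 'd tr (y, 0) (0, X)]. The right side is smooth in [y], so each [C^k] bound on the curve
    improves to [C^(k+1)]. *)
Lemma mulg_gexp_line_smooth g X :
  smooth_map (@model_atlas R R) At (fun t : R => g * gexp (t *: X))%g.
Proof.
set gam := fun t : R => (g * gexp (t *: X))%g.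
have gc : continuous gam.
  move=> t; have c := @gexp_line_continuous _ _ _ _ G_lie X t.
  exact: (cvg_comp2 (cvg_cst _) c (@mulg_continuous G (g, gexp (t *: X)))).
move=> k; split=> // t0; rewrite /=.
set g0 := gam t0; set chi := cfun (At g0).
have -> : (fun y : R => y) @` (setT `&` gam @^-1` cdom (At g0)) = gam @^-1` cdom (At g0).
  by apply/seteqP; split=> [_ [y [_ h] <-]|y h] //; exists y.
set T0 := gam @^-1` _.
have [[od oi chiK _ _] _] := lie_chart G_lie g0.
have oT0 : open T0 by apply: open_comp => // t _; exact: gc.
have tdom t : T0 t -> trans_dom At g0 (chi (gam t), 0).
  move=> Tt; exists (gam t), 1%g; rewrite mulg1 lphi1; split=> //.
  exact: (lie_chart G_lie 1%g).2.
pose tr (p : V * V) := cfun (At g0) (cinv (At g0) p.1 * lpsi p.2)%g.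
have key t : T0 t -> has_diff (chi \o gam) t
    (fun s => s *: 'd tr (chi (gam t), 0 : V) (0 : V, X)).
  move=> Tt.
  have h1 := has_diff_pair (has_diff_cst (chi (gam t)) t) (has_diff_gexp_line X t).
  have [dtr _] := trans_smooth G_lie g0 1.
  have h2 : has_diff tr (chi (gam t), lphi (gexp ((t - t) *: X)))
      ('d tr (chi (gam t), 0 : V)).
    have -> : lphi (gexp ((t - t) *: X)) = 0 by rewrite subrr scale0r gexp0 // lphi1.
    by split; [apply: dtr; exact: tdom|].
  have := has_diff_comp (f := fun s : R => (chi (gam t), lphi (gexp ((s - t) *: X)))) h1 h2.
  move=> h3; apply: has_diff_near (has_diff_ext _ _ h3) => //; last first.
    move=> s; rewrite -linearZ; congr ('d _ _ _).
    by rewrite /GRing.scale /= /scale_pair /= scaler0.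
  have near_dom : \forall s \near t, dom (gexp ((s - t) *: X)).
    have c : (fun s : R => (s - t) *: X) @ t --> (t - t) *: X.
      by apply: cvgZl; apply: cvgB; [exact: cvg_id|exact: cvg_cst].
    rewrite subrr scale0r in c; exact: (c _ (gexp_near G_lie)).
  move: near_dom; apply: filterS => s ds.
  have e1 : cinv (At g0) (chi (gam t)) = gam t := chiK _ Tt.
  have e2 : gam s = (gam t * gexp ((s - t) *: X))%g.
    have e : t + (s - t) = s by rewrite addrC subrK.
    by rewrite /gam -mulgA; have := gexpD G_lie X t (s - t); rewrite e => ->.
  rewrite -[LHS]/(chi (cinv (At g0) (chi (gam t)) * lpsi (lphi (gexp ((s - t) *: X))))%g).
  rewrite e1 (lphiK G_lie ds) -e2; reflexivity.
rewrite [X in Ck _ _ X](_ : _ = chi \o gam) //.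
elim: k => [|k IH].
  move=> t Tt; apply: differentiable_continuous; exact: (key t Tt).1.
split=> [t Tt|v]; first exact: (key t Tt).1.
apply: (@Ck_ext _ _ _ _ _ (fun t => v *: 'd tr (chi (gam t), 0 : V) (0 : V, X))) => //.
  by move=> t Tt; rewrite (key t Tt).2.
apply: Ck_scale => //; first exact: Ck_cst.
have [_ dtr] := trans_smooth G_lie g0 k.+1.
have hcV := @has_coordinates_rV R n.
apply: (Ck_comp (f := fun t => (chi (gam t), 0 : V)) (has_coordinates_prod hcV hcV) oT0 tdom _ (dtr (0, X))).
apply: Ck_pair => //; exact: Ck_cst.
Qed.

Lemma gexp_line_smooth X : smooth_map (@model_atlas R R) At (fun t : R => gexp (t *: X)).
Proof.
have := mulg_gexp_line_smooth 1%g X.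
by under [X in smooth_map _ _ X]funext do rewrite mul1g.
Qed.

Lemma one_param_gexp X : one_param_subgroup At X (fun t : R => gexp (t *: X)).
Proof.
split; first exact: gexp_line_smooth.
  by move=> s t; exact: gexpD.
rewrite /tangent_map /= scale0r gexp0 //.
have h := has_diff_gexp_line X 0.
have [_ e] : has_diff (cfun (At 1%g) \o (fun t : R => gexp (t *: X)) \o (fun u => u)) 0 (fun s : R => s *: X).
  apply: has_diff_ext (has_diffD h (has_diff_cst (cfun (At 1%g) 1%g) _)) => t /=.
    by rewrite subr0 subrK.
  by rewrite addr0.
by rewrite e scale1r.
Qed.

(** Sampled at the times [2^-k], a one-parameter subgroup is a root sequence with velocity [X]. *)
Lemma one_param_unique X gam : one_param_subgroup At X gam -> gam 1 = gexp X.
Proof.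
move=> [gs gD gX].
have g0 : gam 0 = 1%g by apply: (@mulgI _ (gam 0)); rewrite -gD mulg1 addr0.
have [gc gd] : mdiff (@model_atlas R R) At gam 0.
  by apply: (@Ck_map_mdiff _ _ _ _ _ _ _ 0) (gs 1) => //; [exact: good_model|exact: lie_chart].
have h : has_diff (fun t => lphi (gam t)) 0 (fun s : R => s *: X).
  have h1 : has_diff (cfun (At (gam 0)) \o gam \o (fun u => u)) (0 : R) (fun s => s *: X).
    split=> //; apply/funext => s; rewrite -[s in LHS]mulr1 -gX.
    exact: (linearZ_LR ('d _ _) s (1 : R)).
  apply: has_diff_ext (has_diffB h1 (has_diff_cst (cfun (At 1%g) 1%g) _)) => t /=.
    by rewrite g0.
  by rewrite subr0.
have c2 : (fun k => 2 ^+ k *: (2^-1 ^+ k : R)) @ \oo --> (1 : R).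
  under eq_fun do rewrite /GRing.scale /= -exprMn mulfV // expr1n.
  exact: cvg_cst.
have c0 : (fun k => 2^-1 ^+ k : R) @ \oo --> (0 : R) := pow2_scaled_cvg0 c2.
rewrite -[X]scale1r -(scale1r (1 : R)) -[in RHS](expr0 (2^-1 : R)).
have r : root_seq At X (fun k => gam (2^-1 ^+ k)).
  split.
  - move=> k; rewrite -gD; congr gam; rewrite exprS; lra.
  - rewrite -[X in _ --> X]g0; exact: (cvg_comp _ _ c0 gc).
  - rewrite -[X in _ --> X]scale1r; apply: (has_diff_pow2 h) => //.
    by rewrite g0 lphi1.
have := root_seq_gexp G_lie r.
by rewrite !expr0 !scale1r.
Qed.

Lemma lexpE X : lexp At X = gexp X.
Proof.
rewrite /lexp; case: xgetP => [_ -> [gam [g1 <-]]|/(_ (gexp X))].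
  exact: one_param_unique.
case; exists (fun t : R => gexp (t *: X)); split; last by rewrite scale1r.
exact: one_param_gexp.
Qed.

End OneParameter.

(** * The Lie bracket *)

Lemma has_diff_line_unique (R : realType) (V : normedModType R) (f : R -> V) t (v w : V) :
  has_diff f t (fun s => s *: v) -> has_diff f t (fun s => s *: w) -> v = w.
Proof.
move=> h1 h2; have /(congr1 (@^~ (1 : R))) := has_diff_unique h1 h2.
by rewrite !scale1r.
Qed.

Section Bracket.
Context {R : realType} {n : nat} {G : topologicalGroupType}.
Variable At : atlas 'rV[R]_n G.
Hypothesis G_lie : is_lie_group At.
Local Notation V := 'rV[R]_n.
Local Notation dom := (cdom (At 1%g)).
Local Notation lphi := (lphi At).
Local Notation lpsi := (lpsi At).
Local Notation gexp := (gexp At).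
Local Notation Ad := (Ad At).
Local Notation bracket := (bracket At).
Implicit Types (X Y Z : V) (g : G).

(** In coordinates, conjugation [c (u, v)] is [C^2], and [Ad (lpsi u) Y] is its derivative at
    [(u, 0)] along [(0, Y)]; directional derivatives of a [C^2] map are differentiable. *)
Lemma Ad_lpsi_differentiable Y : differentiable (fun u => Ad (lpsi u) Y) 0.
Proof.
(* Conjugation is composed as [(u v) u^-1]; [U1] and then [U] keep both products and the inverse
   inside the chart. *)
pose U1 := [set p : V * V | mulc_dom At p /\ invc_dom At p.1].
pose S (p : V * V) := (mulc At p, invc At p.1).
pose U := [set p | U1 p /\ mulc_dom At (S p)].
have oU1 : open U1.
  apply: openI; first exact: mulc_dom_open.
  by apply: open_comp; [move=> p _; exact: fst_continuous|exact: invc_dom_open].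
have hcV := @has_coordinates_rV R n.
have hcVV := has_coordinates_prod hcV hcV.
have CS k : Ck k U1 S.
  apply: Ck_pair => //.
    by apply: Ck_sub (mulc_smooth G_lie k) => p [].
  apply: (Ck_comp (U' := invc_dom At) hcV oU1 _ _ (invc_smooth G_lie k)); first by move=> p [].
  by apply: (@Ck_lin _ k _ _ _ fst) => p; exact: fst_continuous.
have oU : open U.
  rewrite openE => p [U1p Sp].
  have h1 : nbhs p U1 by exact: open_nbhs_nbhs.
  have h2 : nbhs p (S @^-1` mulc_dom At).
    apply: (Ck_cont (CS 0) U1p); apply: open_nbhs_nbhs; split=> //; exact: mulc_dom_open.
  exact: filterI h1 h2.
pose c (p : V * V) := mulc At (S p).
have Cc k : Ck k U c.
  apply: (Ck_comp (U' := mulc_dom At) hcVV oU _ _ (mulc_smooth G_lie k)); first by move=> p [].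
  by apply: Ck_sub (CS k) => p [].
have U0 : U (0, 0).
  split; first by split; [exact: mulc_dom0|exact: invc_dom0].
  rewrite /S /mulc /invc /= lpsi0 // mulg1 invg1 lphi1; exact: mulc_dom0.
have [_ dC] := Cc 2.
have [dF _] := dC (0, Y).
have cE p : U p -> c p = lphi (lpsi p.1 * lpsi p.2 * (lpsi p.1)^-1)%g.
  case: p => u v [[muv iu] Suv].
  have [du dv duv eu ev] := mulc_domP G_lie muv.
  have [_ diu _] := invc_domP G_lie iu.
  by rewrite /c /S /mulc /invc /= lphiK // lphiK.
have near_U : \forall u \near (0 : V), U (u, 0).
  apply: (differentiable_continuous (has_diff_inl (0 : V) 0).1).
  by apply: open_nbhs_nbhs; split.
have H : has_diff (fun u : V => 'd c (u, 0 : V) (0 : V, Y)) 0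
    (fun u => 'd (fun p : V * V => 'd c p (0 : V, Y)) (0 : V, 0 : V) (u, 0)).
  have hF : has_diff (fun p : V * V => 'd c p (0 : V, Y)) (0, 0)
      ('d (fun p : V * V => 'd c p (0 : V, Y)) (0 : V, 0 : V)) by split=> //; exact: dF.
  exact: (has_diff_comp (f := fun u : V => (u, 0 : V)) (has_diff_inl (0 : V) 0) hF).
apply: (proj1 (has_diff_near _ H)).
apply: filterS near_U => u Uu.
have [dc _] := Cc 1.
have hc : has_diff c (u, 0) ('d c (u, 0 : V)) by split; [exact: dc|reflexivity].
have h1 := has_diff_comp (f := fun v : V => (u, v)) (has_diff_inr u 0) hc.
have h2 := Ad_lphi G_lie (lpsi u).
suff h3 : has_diff (fun v => lphi (lpsi u * lpsi v * (lpsi u)^-1)%g) 0 (fun v => 'd c (u, 0 : V) (0 : V, v)).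
  by rewrite (has_diff_unique h2 h3).
apply: has_diff_near h1.
have near_U2 : \forall v \near (0 : V), U (u, v).
  apply: (differentiable_continuous (has_diff_inr u (0 : V)).1).
  by apply: open_nbhs_nbhs; split.
by apply: filterS near_U2 => v Uv; rewrite cE.
Qed.

Lemma Ad_lpsi_diff Y : has_diff (fun u => Ad (lpsi u) Y) 0 (bracket^~ Y).
Proof.
have d := Ad_lpsi_differentiable Y.
have h : has_diff (fun u => Ad (lpsi u) Y) (cfun (At 1%g) 1%g - cfun (At 1%g) 1%g)
   ('d (fun u => Ad (lpsi u) Y) 0) by rewrite subrr.
have h2 := has_diff_comp (has_diff_shift (- cfun (At 1%g) 1%g) (cfun (At 1%g) 1%g)) h.
split; first exact: d.
have [_ e] : has_diff (cfun (@model_atlas R V (Ad 1%g Y)) \o (fun x => Ad x Y) \o cinv (At 1%g))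
  (cfun (At 1%g) 1%g) ('d (fun u => Ad (lpsi u) Y) 0).
  apply: (has_diff_ext _ (fun=> erefl) h2) => u.
  have e : lpsi (u + - cfun (At 1%g) 1%g) = cinv (At 1%g) u by rewrite !lpsiE subrK.
  by rewrite e.
apply/funext => X; rewrite -e; reflexivity.
Qed.

Lemma bracketDl X Y Z : bracket (X + Y) Z = bracket X Z + bracket Y Z.
Proof. by rewrite /Defs.bracket /tangent_map linearD. Qed.
Lemma bracketZl (c : R) X Z : bracket (c *: X) Z = c *: bracket X Z.
Proof. by rewrite /Defs.bracket /tangent_map linearZ. Qed.
Lemma bracketNl X Z : bracket (- X) Z = - bracket X Z.
Proof. by rewrite -scaleN1r bracketZl scaleN1r. Qed.
Lemma bracketDr X Y Z : bracket X (Y + Z) = bracket X Y + bracket X Z.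
Proof.
have h := has_diffD (Ad_lpsi_diff Y) (Ad_lpsi_diff Z).
have h2 : has_diff (fun u => Ad (lpsi u) (Y + Z)) 0 (fun v => bracket v Y + bracket v Z).
  by apply: has_diff_ext _ (fun=> erefl) h => u; rewrite AdD.
by have /(congr1 (@^~ X)) := has_diff_unique (Ad_lpsi_diff (Y + Z)) h2.
Qed.
Lemma bracketZr (c : R) X Y : bracket X (c *: Y) = c *: bracket X Y.
Proof.
have h := has_diff_comp (Ad_lpsi_diff Y) (@has_diff_lin _ _ _ (c \*: idfun) (Ad (lpsi 0) Y) (@rV_linear_continuous _ _ _ _)).
have h2 : has_diff (fun u => Ad (lpsi u) (c *: Y)) 0 (fun v => c *: bracket v Y).
  by apply: has_diff_ext _ (fun=> erefl) h => u; rewrite AdZ.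
by have /(congr1 (@^~ X)) := has_diff_unique (Ad_lpsi_diff (c *: Y)) h2.
Qed.

Lemma bracketNr X Y : bracket X (- Y) = - bracket X Y.
Proof. by rewrite -scaleN1r bracketZr scaleN1r. Qed.

Definition ad_lin X (Y : V) := bracket X Y.
Lemma ad_lin_is_linear X : linear (ad_lin X).
Proof. by move=> a Y Z; rewrite /ad_lin bracketDr bracketZr. Qed.

Lemma Ad_is_linear g : linear (Ad g).
Proof. by move=> a Y Z; rewrite AdD AdZ. Qed.

Lemma Ad_gexp_diff0 X Y : has_diff (fun t : R => Ad (gexp (t *: X)) Y) 0 (fun s => s *: bracket X Y).
Proof.
have h1 := has_diff_gexp_line G_lie X 0.
have e1 : lphi (gexp ((0 - 0) *: X)) = 0 by rewrite subrr scale0r gexp0 // lphi1.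
have h2 : has_diff (fun u => Ad (lpsi u) Y) (lphi (gexp ((0 - 0) *: X))) (bracket^~ Y).
  by rewrite e1; exact: Ad_lpsi_diff.
have h3 : has_diff (fun t : R => Ad (lpsi (lphi (gexp ((t - 0) *: X)))) Y) 0
    (fun s => s *: bracket X Y).
  by apply: has_diff_ext (fun=> erefl) _ (has_diff_comp h1 h2) => s; rewrite bracketZl.
apply: has_diff_near h3.
have c : (fun s : R => s *: X) @ (0 : R) --> (0 : R) *: X.
  by apply: cvgZl; exact: cvg_id.
rewrite scale0r in c.
have near_dom : \forall t \near (0 : R), dom (gexp (t *: X)) := c _ (gexp_near G_lie).
by move: near_dom; apply: filterS => t dt; rewrite subr0 lphiK.
Qed.

Lemma Ad_gexp_diff X Y (t : R) :
  has_diff (fun t : R => Ad (gexp (t *: X)) Y) t (fun s => s *: Ad (gexp (t *: X)) (bracket X Y)).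
Proof.
pose L : {linear V -> V} := HB.pack (Ad (gexp (t *: X)))
  (GRing.isLinear.Build _ _ _ _ _ (Ad_is_linear (gexp (t *: X)))).
have h0 : has_diff (fun s : R => s - t) t (fun s => s).
  apply: has_diff_ext (fun=> erefl) _ (has_diffB (has_diff_id t) (has_diff_cst t t)) => s.
  by rewrite subr0.
have h1 : has_diff (fun s : R => Ad (gexp (s *: X)) Y) (t - t) (fun s => s *: bracket X Y).
  by rewrite subrr; exact: Ad_gexp_diff0.
have h2 := has_diff_comp h0 h1.
have h3 := has_diff_comp h2 (@has_diff_lin _ _ _ L _ (@rV_linear_continuous _ _ _ L)).
apply: has_diff_ext h3 => s; last by rewrite -[LHS]/(Ad (gexp (t *: X)) _) AdZ.
have e : t + (s - t) = s by rewrite addrC subrK.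
have := gexpD G_lie X t (s - t); rewrite e => e2.
by rewrite e2 (AdM G_lie).
Qed.

(** The curve [e^(- a t) Ad (exp (t X)) Y] has zero derivative, hence is constant. *)
Lemma Ad_gexp_eigen X Y (a : R) : bracket X Y = a *: Y ->
  Ad (gexp X) Y = expR a *: Y.
Proof.
move=> e.
pose f (t : R) := expR (- (a * t)) *: Ad (gexp (t *: X)) Y.
have df t : has_diff f t (fun=> 0).
  have he : has_diff (fun t : R => expR (- (a * t))) t (fun s => s * (- a * expR (- (a * t)))).
    have d : is_derive t (1 : R) (fun t : R => expR (- (a * t))) (- a * expR (- (a * t))).
      have h := is_derive1_comp (f := expR) (g := fun t : R => - (a * t)) (x := t).
      by apply: is_derive_eq; rewrite /GRing.scale /=; ring.
    have dd : differentiable (fun t : R => expR (- (a * t))) t by apply/derivable1_diffP; case: d.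
    split=> //; apply/funext => s; rewrite -[s in LHS]mulr1.
    rewrite [LHS](linearZ_LR ('d _ _) s (1 : R)) -deriveE //; by case: d => _ ->.
  have [d1 _] := he; have h2 := Ad_gexp_diff X Y t.
  have [d3 e3] := diff_scale he.1 h2.1.
  split=> //; rewrite e3 he.2 h2.2; apply/funext => s.
  have -> : Ad (gexp (t *: X)) (bracket X Y) = a *: Ad (gexp (t *: X)) Y by rewrite e AdZ.
  rewrite !scalerA -scalerDl (_ : _ + _ = 0) ?scale0r //; ring.
have := zero_diff_cst df 1.
rewrite /f mulr1 mulr0 oppr0 expR0 !scale1r scale0r (gexp0 G_lie) (Ad1 G_lie) => E.
by rewrite -[in RHS]E scalerA -expRD subrr expR0 scale1r.
Qed.

Lemma Ad_gexp_fixed X Y : bracket X Y = 0 -> Ad (gexp X) Y = Y.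
Proof.
move=> e; rewrite (@Ad_gexp_eigen X Y 0); first by rewrite expR0 scale1r.
by rewrite scale0r.
Qed.

(** Both sides are derivatives at [t = 0] of [Ad (exp (t X)) Y] transported by [s], since [s]
    carries [exp (t X)] to the exponential of [t] times the differential of [s] at [X]. *)
Lemma differential_bracket (s : G -> G) X Y : mdiff At At s 1%g ->
  (forall x y, s (x * y) = s x * s y)%g ->
  differential At s (bracket X Y) = bracket (differential At s X) (differential At s Y).
Proof.
move=> ds sM.
pose D : {linear V -> V} := 'd (cfun (At (s 1%g)) \o s \o cinv (At 1%g)) (cfun (At 1%g) 1%g).
have h1 := has_diff_comp (Ad_gexp_diff0 X Y) (@has_diff_lin _ _ _ D _ (@rV_linear_continuous _ _ _ D)).
have h2 := Ad_gexp_diff0 (differential At s X) (differential At s Y).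
have h3 : has_diff (fun t : R => D (Ad (gexp (t *: X)) Y)) 0
    (fun u => u *: bracket (differential At s X) (differential At s Y)).
  apply: has_diff_ext _ (fun=> erefl) h2 => t.
  rewrite -differentialZ -(gexp_map G_lie _ ds sM).
  by rewrite -(differential_Ad G_lie _ _ ds sM).
have /(congr1 (@^~ (1 : R))) /= := has_diff_unique h1 h3.
by rewrite !scale1r.
Qed.

Lemma Ad_bracket g X Y : Ad g (bracket X Y) = bracket (Ad g X) (Ad g Y).
Proof.
apply: (differential_bracket X Y (mdiff_conj G_lie g 1%g)) => x y.
by rewrite /conj_by !mulgA mulgVK.
Qed.

Lemma bracketXX X : bracket X X = 0.
Proof.
have h : has_diff (fun t : R => Ad (gexp (t *: X)) X) 0 (fun s => s *: 0).
  apply: has_diff_ext _ _ (has_diff_cst X 0) => t; last by rewrite scaler0.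
  have [->|t0] := eqVneq t 0; first by rewrite scale0r (gexp0 G_lie) (Ad1 G_lie).
  by have := Ad_gexp_self G_lie (t *: X); rewrite AdZ => /scalerI ->.
exact: has_diff_line_unique (Ad_gexp_diff0 X X) h.
Qed.

Lemma bracketC X Y : bracket X Y = - bracket Y X.
Proof.
have := bracketXX (X + Y); rewrite bracketDl !bracketDr !bracketXX add0r addr0.
by move/eqP; rewrite addr_eq0 => /eqP.
Qed.

(** The Jacobi identity for commuting [X] and [Y]: [Ad (exp (t X))] fixes [Y], so it commutes with
    [ad Y]; differentiate at [t = 0]. It makes the operators [ad Y], for [Y] in [a], commute. *)
Lemma bracket_swap X Y Z : bracket X Y = 0 ->
  bracket X (bracket Y Z) = bracket Y (bracket X Z).
Proof.
move=> e.
pose L : {linear V -> V} := HB.pack (ad_lin Y)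
  (GRing.isLinear.Build _ _ _ _ _ (ad_lin_is_linear Y)).
have h1 := Ad_gexp_diff0 X (bracket Y Z).
have h2 := has_diff_comp (Ad_gexp_diff0 X Z) (@has_diff_lin _ _ _ L _ (@rV_linear_continuous _ _ _ L)).
have h3 : has_diff (fun t : R => Ad (gexp (t *: X)) (bracket Y Z)) 0
    (fun s => s *: bracket Y (bracket X Z)).
  apply: has_diff_ext _ _ h2 => t; last exact: bracketZr.
  rewrite -[LHS]/(bracket Y (Ad (gexp (t *: X)) Z)) Ad_bracket; congr bracket.
  by rewrite Ad_gexp_fixed // bracketZl e scaler0.
exact: has_diff_line_unique h1 h3.
Qed.

End Bracket.

(** * Riemannian distance and exponential coordinates *)

Section QuadraticForms.
Context {R : realType} {n : nat}.
Local Notation V := 'rV[R]_n.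

Definition bilinear_form (B : V -> V -> R) :=
  [/\ forall u u' v, B (u + u') v = B u v + B u' v,
      forall a u v, B (a *: u) v = a * B u v,
      forall u v v', B u (v + v') = B u v + B u v' &
      forall a u v, B u (a *: v) = a * B u v].

Lemma bilinear_expand (B : V -> V -> R) u v : bilinear_form B ->
  B u v = \sum_i \sum_j u ord0 i * v ord0 j * B (delta_mx 0 i) (delta_mx 0 j).
Proof.
move=> [Dl Zl Dr Zr].
have B0l w : B 0 w = 0 by rewrite -(scale0r 0) Zl mul0r.
have B0r w : B w 0 = 0 by rewrite -(scale0r 0) Zr mul0r.
rewrite [in LHS](row_sum_delta u) (big_morph (B^~ v) (fun x y => Dl x y v) (B0l v)).
apply: eq_bigr => i _; rewrite Zl.
rewrite [in LHS](row_sum_delta v) (big_morph (B _) (Dr _) (B0r _)) mulr_sumr.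
by apply: eq_bigr => j _; rewrite Zr mulrA.
Qed.

Lemma bilinear_bound (B : V -> V -> R) (M : R) u v : bilinear_form B ->
  (forall i j, `|B (delta_mx 0 i) (delta_mx 0 j)| <= M) ->
  `|B u v| <= n%:R * n%:R * M * `|u| * `|v|.
Proof.
move=> bB BM; rewrite (bilinear_expand u v bB).
apply: le_trans (ler_norm_sum _ _ _) _.
apply: (@le_trans _ _ (\sum_(i < n) n%:R * (M * `|u| * `|v|))).
  apply: ler_sum => i _; apply: le_trans (ler_norm_sum _ _ _) _.
  apply: (@le_trans _ _ (\sum_(j < n) (M * `|u| * `|v|))).
    apply: ler_sum => j _; rewrite !normrM.
    have -> : M * `|u| * `|v| = `|u| * `|v| * M by ring.
    by apply: ler_pM => //; apply: ler_pM => //; exact: rV_coord_le.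
  by rewrite sumr_const card_ord mulr_natl.
by rewrite sumr_const card_ord -(mulr_natl (_ * _)) !mulrA.
Qed.

Lemma bilinear_continuous (B : V -> V -> R) : bilinear_form B ->
  continuous (fun u => B u u).
Proof.
move=> bB.
have -> : (fun u => B u u) = (fun u => \sum_i \sum_j (coord_lin i u) *: (coord_lin j u *: B (delta_mx 0 i) (delta_mx 0 j))).
  apply/funext => u; rewrite (bilinear_expand u u bB); apply: eq_bigr => i _.
  by apply: eq_bigr => j _; rewrite -mulrA.
have oT : open [set: V] by exact: openT.
have cc j : Ck 0 [set: V] (@coord_lin R n j) by apply: Ck_lin => w; exact: coord_continuous.
move=> u; apply: (@Ck_cont _ 0 _ _ setT) => //.
apply: Ck_sum => // i; apply: Ck_sum => // j.
by apply: Ck_scale => //; apply: Ck_scale => //; exact: Ck_cst.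
Qed.

Lemma posdef_lower_bound (B : V -> V -> R) : bilinear_form B ->
  (forall u, u != 0 -> 0 < B u u) ->
  exists2 c, 0 < c & forall u, c * `|u| ^+ 2 <= B u u.
Proof.
move=> bB pB; have [Dl Zl Dr Zr] := bB.
have B00 : B 0 0 = 0 by rewrite -(scale0r 0) Zl mul0r.
pose S := [set u : V | `|u| = 1].
(* The unit sphere is empty in dimension 0, where there is no minimum to take. *)
have [S0|S0] := pselect (S !=set0); last first.
  exists 1 => // u; have [->|u0] := eqVneq u 0; first by rewrite normr0 expr0n mulr0 B00.
  case: S0; exists (`|u|^-1 *: u); rewrite /S /= normrZ normfV normr_id mulVf //.
  by rewrite normr_eq0.
have cS : compact S.
  apply: bounded_closed_compact.
    exists 1; split; first exact: num_real.
    by move=> x x1 u /= ->; exact: ltW.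
  have -> : S = (fun u : V => `|u|) @^-1` [set 1] by [].
  by apply: closed_comp; [move=> u _; exact: norm_continuous|exact: closed_eq].
have [u0 u0S Hmin] := EVT_min_rV S0 cS (continuous_subspaceT (bilinear_continuous bB)).
have u00 : u0 != 0.
  by apply/eqP => e; move: u0S; rewrite inE /S /= e normr0 => /eqP; rewrite eq_sym oner_eq0.
exists (B u0 u0); first exact: pB.
move=> u; have [->|un0] := eqVneq u 0; first by rewrite normr0 expr0n mulr0 B00.
have nu : `|u| != 0 by rewrite normr_eq0.
have := Hmin (`|u|^-1 *: u); rewrite inE /S /= normrZ normfV normr_id mulVf // => /(_ erefl).
rewrite Zl Zr mulrA -expr2 exprVn => h.
by rewrite mulrC -ler_pdivlMl // exprn_gt0 // normr_gt0.
Qed.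

Lemma bilinear_formB (B B' : V -> V -> R) : bilinear_form B -> bilinear_form B' ->
  bilinear_form (fun u v => B u v - B' u v).
Proof.
move=> [a1 a2 a3 a4] [b1 b2 b3 b4]; split=> *.
- by rewrite a1 b1; ring.
- by rewrite a2 b2; ring.
- by rewrite a3 b3; ring.
- by rewrite a4 b4; ring.
Qed.

(** One pair of constants serves all forms whose coefficients are close to those of [B0]. It is
    applied to the metric at nearby points. *)
Lemma posdef_stable (B0 : V -> V -> R) : bilinear_form B0 ->
  (forall u, u != 0 -> 0 < B0 u u) ->
  exists c1 c2 eta : R, [/\ 0 < c1, 0 < c2, 0 < eta & forall B, bilinear_form B ->
    (forall i j, `|B (delta_mx 0 i) (delta_mx 0 j) - B0 (delta_mx 0 i) (delta_mx 0 j)| <= eta) ->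
    forall u, c1 * `|u| ^+ 2 <= B u u <= c2 * `|u| ^+ 2].
Proof.
move=> bB0 pos; have [c c0 Hc] := posdef_lower_bound bB0 pos.
pose N : R := n%:R * n%:R.
have N0 : 0 <= N by rewrite mulr_ge0.
(* A change of the coefficients by [eta] changes the form by at most [N * eta <= c / 2] times the
   squared norm, half of the lower bound. *)
pose eta := c / 2 / (N + 1).
have eta0 : 0 < eta by rewrite !divr_gt0 // ltr_wpDl.
have Neta : N * eta <= c / 2.
  rewrite /eta mulrCA ger_pMr ?divr_gt0 // ler_pdivrMr ?ltr_wpDl // mul1r.
  by rewrite lerDl ler01.
pose M := \big[Num.max/0]_(p : 'I_n * 'I_n) `|B0 (delta_mx 0 p.1) (delta_mx 0 p.2)|.
have HM i j : `|B0 (delta_mx 0 i) (delta_mx 0 j)| <= M.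
  exact: (le_bigmax _ (fun p : 'I_n * 'I_n => `|B0 (delta_mx 0 p.1) (delta_mx 0 p.2)|) (i, j)).
have M0 : 0 <= M by exact: bigmax_ge_id.
exists (c / 2), (N * M + c / 2), eta; split=> //; first by rewrite divr_gt0.
  by rewrite ltr_wpDl ?divr_gt0 // mulr_ge0.
move=> B bB HB u.
have hB := bilinear_bound u u (bilinear_formB bB bB0) HB.
have hM := bilinear_bound u u bB0 HM.
have hc := Hc u.
have hN : N * eta * `|u| ^+ 2 <= c / 2 * `|u| ^+ 2 by rewrite ler_wpM2r // sqr_ge0.
have e (x : R) : n%:R * n%:R * x * `|u| * `|u| = N * x * `|u| ^+ 2 by rewrite /N; ring.
rewrite !e !ler_norml in hB hM.
by apply/andP; split; move: hB hM hc hN; rewrite ?mulrDl; lra.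
Qed.

End QuadraticForms.

Section LocalCk.
Context {R : realType}.
Implicit Types V W : normedModType R.

Lemma Ck_local k V W (U : set V) (f : V -> W) :
  (forall x, U x -> exists2 U', U' x & Ck k U' f) -> Ck k U f.
Proof.
elim: k f => [|k IH] f H.
  by move=> x /H [U' U'x]; exact.
split=> [x /H [U' U'x [df _]]|v]; first exact: df.
by apply: (IH (fun x => 'd f x v)) => x /H [U' U'x [_ dC]]; exists U'; [|exact: dC].
Qed.

Lemma diff_lipschitz_le W (f : R -> W) (t K : R) : differentiable f t ->
  (\forall s \near t, `|f s - f t| <= K * `|s - t|) -> `|'d f t 1| <= K.
Proof.
move=> df H; apply/ler_addgt0Pr => e e0.
have [r /= r0 HH] := (nbhs_normP _ _).1 (filterI H (diff_eps df e0)).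
have : ball_ Num.Def.normr t r (t + r / 2).
  rewrite /ball_ /= opprD addrA subrr sub0r normrN ger0_norm ?divr_ge0 ?(ltW r0) //; lra.
move=> /HH [h1 h2].
have r2 : `|t + r / 2 - t| = r / 2.
  by rewrite addrAC subrr add0r ger0_norm // divr_ge0 // ltW.
have h3 : `|'d f t (t + r / 2 - t)| <= (K + e) * (r / 2).
  rewrite r2 in h1 h2.
  rewrite -[X in `|X|](subKr (f (t + r / 2) - f t)) mulrDl.
  by apply: le_trans (ler_normB _ _) _; exact: lerD.
move: h3; rewrite addrAC subrr add0r -{1}(mulr1 (r / 2)).
rewrite (linearZ_LR ('d f t) (r / 2) (1 : R)) normrZ ger0_norm ?divr_ge0 ?(ltW r0) //.
by rewrite mulrC ler_pM2r // divr_gt0.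
Qed.

End LocalCk.

(** * Curve lengths in a fixed chart *)

Section Riemannian.
Context {R : realType} {n : nat} {G : topologicalGroupType}.
Variable At : atlas 'rV[R]_n G.
Hypothesis G_lie : is_lie_group At.
Local Notation V := 'rV[R]_n.
Local Notation gexp := (gexp At).
Local Notation model := (@model_atlas R R).
Variable m : G -> 'M[R]_n.
Hypothesis m_metric : is_riemannian_metric At m.

Lemma inner_bilinear x : bilinear_form (inner m x).
Proof.
rewrite /inner; split=> *.
- by rewrite !mulmxDl mxE.
- by rewrite -!scalemxAl mxE.
- by rewrite linearD /= mulmxDr mxE.
- by rewrite linearZ /= -scalemxAr mxE.
Qed.

(** The metric at a point is stored in the chart preferred at that point; the transition map
    rewrites it in the single chart at [x0]. *)
Definition gram x0 y (u v : V) : R :=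
  let x := cinv (At x0) y in
  inner m x ('d (cfun (At x) \o cinv (At x0)) y u)
            ('d (cfun (At x) \o cinv (At x0)) y v).

Lemma gram_bilinear x0 y : bilinear_form (gram x0 y).
Proof.
rewrite /gram; have [Dl Zl Dr Zr] := inner_bilinear (cinv (At x0) y).
set D := 'd _ y.
split=> [u u' v|a u v|u v v'|a u v] /=.
- by rewrite linearD Dl.
- by rewrite (linearZ_LR D) Zl.
- by rewrite linearD Dr.
- by rewrite (linearZ_LR D) Zr.
Qed.

Lemma gram_Ck x0 u v : Ck 0 (cfun (At x0) @` cdom (At x0)) (fun y => gram x0 y u v : R).
Proof. by case: m_metric => _ _ /(_ x0 u v 0). Qed.

Lemma transition_smooth x y :
  smooth_on (cfun (At x) @` (cdom (At x) `&` cdom (At y))) (cfun (At y) \o cinv (At x)).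
Proof. by case: G_lie => -[_ _ _ H] _ _; exact: H. Qed.

(** [Ck_map] reads the curve in a chart that moves with the point; transition maps bring it into one
    chart, where speeds at different times can be compared. *)
Lemma curve_chart k (gam : R -> G) x0 : Ck_map model At k gam ->
  Ck k (gam @^-1` cdom (At x0)) (cfun (At x0) \o gam).
Proof.
move=> [gc gC]; apply: Ck_local => t /= dt.
set x := gam t.
have [cx dx] := lie_chart G_lie x; have [ox oix xK _ _] := cx.
have [[od0 _ _ _ _] _] := lie_chart G_lie x0.
pose T := gam @^-1` (cdom (At x) `&` cdom (At x0)).
have oT : open T by apply: open_comp => [s _|]; [exact: gc|exact: openI].
exists T => //.
have C1 : Ck k T (cfun (At x) \o gam).
  have := gC t; apply: Ck_sub => s [sx _] /=.
  by exists s.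
have C2 := transition_smooth x x0 k.
have sT s : T s -> (cfun (At x) @` (cdom (At x) `&` cdom (At x0))) ((cfun (At x) \o gam) s).
    by move=> Ts; exists (gam s).
have C3 := Ck_comp (@has_coordinates_rV R n) oT sT C1 C2.
by apply: Ck_ext oT _ C3 => s [sx _] /=; rewrite xK.
Qed.

Definition speed (gam : R -> G) (t : R) : R :=
  let v := tangent_map model At gam t 1 in Num.sqrt (inner m (gam t) v v).

Lemma speed_chart (gam : R -> G) x0 t : Ck_map model At 1 gam ->
  cdom (At x0) (gam t) ->
  speed gam t = Num.sqrt (gram x0 (cfun (At x0) (gam t))
    ('d (cfun (At x0) \o gam) t 1) ('d (cfun (At x0) \o gam) t 1)).
Proof.
move=> gC dt; have [d0 _] := curve_chart x0 gC.
have [[_ oi0 K0 _ _] _] := lie_chart G_lie x0.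
rewrite /speed /gram /= K0 //; congr (Num.sqrt _).
suff -> : tangent_map model At gam t 1 =
  'd (cfun (At (gam t)) \o cinv (At x0)) (cfun (At x0) (gam t))
     ('d (cfun (At x0) \o gam) t 1) by [].
have [dtr _] := transition_smooth x0 (gam t) 1.
have h2 : has_diff (cfun (At (gam t)) \o cinv (At x0)) (cfun (At x0) (gam t))
   ('d (cfun (At (gam t)) \o cinv (At x0)) (cfun (At x0) (gam t))).
  split; last by [].
  by apply: dtr; exists (gam t) => //; split=> //; exact: (lie_chart G_lie _).2.
have h1 : has_diff (cfun (At x0) \o gam) t ('d (cfun (At x0) \o gam) t).
  by split; [exact: d0|].
have h3 : has_diff (cfun (At (gam t)) \o gam) t (fun s =>
   'd (cfun (At (gam t)) \o cinv (At x0)) (cfun (At x0) (gam t))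
     ('d (cfun (At x0) \o gam) t s)).
  apply: has_diff_near (has_diff_comp h1 h2).
  have nd : \forall s \near t, cdom (At x0) (gam s).
    by apply: gC.1; apply: open_nbhs_nbhs; split=> //; have [[]] := lie_chart G_lie x0.
  by apply: filterS nd => s ds /=; rewrite K0.
exact: (congr1 (@^~ (1 : R)) h3.2).
Qed.

Lemma speed_continuous (gam : R -> G) : Ck_map model At 1 gam -> continuous (speed gam).
Proof.
move=> gC t0; set x0 := gam t0.
have [[od0 oi0 K0 _ _] dt0] := lie_chart G_lie x0.
pose T := gam @^-1` cdom (At x0).
have oT : open T by apply: open_comp => // s _; exact: gC.1.
have C1 := curve_chart x0 gC.
pose u t := 'd (cfun (At x0) \o gam) t 1.
pose q t := \sum_i \sum_j coord_lin i (u t) *: (coord_lin j (u t) *: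
   gram x0 (cfun (At x0) (gam t)) (delta_mx 0 i) (delta_mx 0 j)).
have Cu j : Ck 0 T (fun t => coord_lin j (u t)).
  by apply: Ck_linl => //; [exact: coord_continuous|exact: C1.2].
have Cq : Ck 0 T q.
  apply: Ck_sum => // i; apply: Ck_sum => // j.
  apply: (Ck_scale oT (Cu i)); apply: (Ck_scale oT (Cu j)).
  have sT s : T s -> (cfun (At x0) @` cdom (At x0)) ((cfun (At x0) \o gam) s).
    by move=> Ts; exists (gam s).
  exact: (Ck_comp (@has_coordinates_rV R n) oT sT (CkS C1) (@gram_Ck x0 _ _)).
have e : forall t, T t -> Num.sqrt (q t) = speed gam t.
  move=> t Tt; rewrite (speed_chart gC Tt) (bilinear_expand _ _ (gram_bilinear _ _)).
  congr Num.sqrt; apply: eq_bigr => i _; apply: eq_bigr => j _.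
  by rewrite /u /coord_lin /GRing.scale /= mulrA.
have c : (fun t => Num.sqrt (q t)) @ t0 --> Num.sqrt (q t0).
  by apply: continuous_comp; [exact: Cq|exact: sqrt_continuous].
rewrite /continuous_at -e //.
apply: cvg_trans c; apply: near_eq_cvg.
exact: near_open oT dt0 e.
Qed.

Lemma speed_ge0 gam t : 0 <= speed gam t.
Proof. exact: sqrtr_ge0. Qed.

Lemma speed_integrable gam a b : Ck_map model At 1 gam ->
  lebesgue_measure.-integrable `[a, b]%classic (EFin \o speed gam).
Proof.
move=> gC; apply: continuous_compact_integrable; first exact: segment_compact.
exact: continuous_subspaceT (speed_continuous gC).
Qed.

Lemma curve_length_ge0 gam : 0 <= curve_length At m gam.
Proof. by apply: Rintegral_ge0 => t _; exact: sqrtr_ge0. Qed.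

Lemma piecewise_length_ge0 x y L : piecewise_path At m x y L -> 0 <= L.
Proof.
by elim=> // gam z L' _ _ h; rewrite addr_ge0 // curve_length_ge0.
Qed.

Lemma riemannian_dist_le x y L : piecewise_path At m x y L ->
  riemannian_dist At m x y <= L.
Proof.
move=> H; apply: ge_inf => //; exists 0 => L' /=; exact: piecewise_length_ge0.
Qed.

Lemma piecewise_path_cat x y z L L' : piecewise_path At m x y L ->
  piecewise_path At m y z L' -> piecewise_path At m x z (L + L').
Proof.
elim=> [w h|gam w L1 gC _ IH h]; first by rewrite add0r.
by rewrite -addrA; apply: path_cons => //; exact: IH.
Qed.

Lemma gexp_path g X : piecewise_path At m g (g * gexp X)%g
  (curve_length At m (fun t : R => g * gexp (t *: X))%g).
Proof.
pose gam := (fun t : R => g * gexp (t *: X))%g.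
have g0 : gam 0 = g by rewrite /gam scale0r (gexp0 G_lie) mulg1.
have g1 : gam 1 = (g * gexp X)%g by rewrite /gam scale1r.
rewrite -{1}g0 -g1 -[curve_length _ _ _]addr0.
apply: path_cons; last exact: path_nil.
exact: mulg_gexp_line_smooth.
Qed.

End Riemannian.

(** * Integral bounds and induction on the unit interval *)

Section RealLemmas.
Context {R : realType}.

Lemma integral_derivative_bound (F f s : R -> R) (t K : R) : 0 <= K -> 0 <= t <= 1 ->
  (forall x, 0 <= x <= t -> is_derive x (1 : R) F (f x)) ->
  (forall x, 0 <= x <= t -> {for x, continuous f}) ->
  continuous s -> (forall x, 0 <= s x) ->
  (forall x, 0 <= x <= t -> `|f x| <= K * s x) ->
  `|F t - F 0| <= K * \int[lebesgue_measure]_(x in `[0, 1]%classic) s x.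
Proof.
move=> K0 /andP[t0 t1] dF cf cs s0 fs.
have I0 : 0 <= \int[lebesgue_measure]_(x in `[0, 1]%classic) s x by apply: Rintegral_ge0.
have [->|tn0] := eqVneq t 0; first by rewrite subrr normr0 mulr_ge0.
have {}t0 : 0 < t by rewrite lt_neqAle eq_sym tn0.
have cF x : 0 <= x <= t -> {for x, continuous F}.
  move=> xt; apply: differentiable_continuous; apply/derivable1_diffP.
  by have [] := dF x xt.
have cfw : {within `[0, t], continuous f}.
  by apply: continuous_in_subspaceT => x; rewrite inE /= in_itv /=; exact: cf.
have t0t : 0 <= t <= t by rewrite (ltW t0) lexx.
have z0t : 0 <= (0 : R) <= t by rewrite lexx (ltW t0).
have E : (\int[lebesgue_measure]_(x in [set` `[0%R, t]%R]) (f x)%:E = (F t)%:E - (F 0%R)%:E)%E.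
  apply: continuous_FTC2 => //.
    split.
    - move=> x; rewrite in_itv /= => /andP[/ltW x0 /ltW xt].
      by have [] := dF x (introT andP (conj x0 xt)).
    - apply: cvg_at_right_filter; exact: cF.
    - apply: cvg_at_left_filter; exact: cF.
  move=> x; rewrite in_itv /= => /andP[/ltW x0 /ltW xt].
  by have [_] := dF x (introT andP (conj x0 xt)); rewrite derive1E.
have -> : F t - F 0 = \int[lebesgue_measure]_(x in `[0, t]) f x by rewrite /Rintegral E.
have cpt a : compact `[0 : R, a] by exact: segment_compact.
have If : lebesgue_measure.-integrable `[0, t]%classic (EFin \o f).
  exact: continuous_compact_integrable.
have Is a : lebesgue_measure.-integrable `[0, a]%classic (EFin \o s).
  by apply: continuous_compact_integrable => //; exact: continuous_subspaceT.
have IKs : lebesgue_measure.-integrable `[0, t]%classic (EFin \o (fun x => K * s x)).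
  apply: continuous_compact_integrable => //; apply: continuous_subspaceT => x.
  by apply: cvgM; [exact: cvg_cst|exact: cs].
apply: le_trans (le_normr_Rintegral _ If) _; first exact: measurable_itv.
apply: (@le_trans _ _ (\int[lebesgue_measure]_(x in `[0, t]%classic) (K * s x))).
  apply: le_Rintegral => //.
    apply: continuous_compact_integrable => //.
    apply: continuous_in_subspaceT => x; rewrite inE /= in_itv /= => xt.
    by apply: continuous_comp; [exact: cf|exact: norm_continuous].
rewrite (RintegralZl K _ (Is t)); last exact: measurable_itv.
rewrite ler_wpM2l // /Rintegral.
apply: fine_le.
- by apply: integrable_fin_num; [exact: measurable_itv|exact: Is].
- by apply: integrable_fin_num; [exact: measurable_itv|exact: Is].
apply: ge0_subset_integral => //.
- by have /integrableP[] := Is 1.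
- by move=> x _; rewrite lee_fin.
- move=> x /=; rewrite !in_itv /= => /andP[-> xt] /=; exact: le_trans xt t1.
Qed.

(** The supremum of the times up to which [P] holds satisfies [P] by the second hypothesis, and
    cannot lie below 1 by the first. At [t = 0] the second hypothesis is vacuous and starts the
    induction. *)
Lemma interval_induction (P : R -> Prop) :
  (forall t, 0 <= t <= 1 -> P t -> \forall s \near t, P s) ->
  (forall t, 0 <= t <= 1 -> (forall s, 0 <= s < t -> P s) -> P t) ->
  forall t, 0 <= t <= 1 -> P t.
Proof.
move=> Pop Pcl.
pose S := [set t : R | 0 <= t <= 1 /\ forall s, 0 <= s <= t -> P s].
have P0 : P 0.
  apply: Pcl; first by rewrite lexx ler01.
  by move=> s /andP[s0 s1]; have := le_lt_trans s0 s1; rewrite ltxx.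
have S0 : S 0.
  split; first by rewrite lexx ler01.
  by move=> s /andP[s0 s1]; rewrite (_ : s = 0) //; apply/eqP; rewrite eq_le s0 s1.
have Sub : has_ubound S by exists 1 => t [/andP[]].
pose T := sup S.
have T0 : 0 <= T by apply: ub_le_sup.
have T1 : T <= 1 by apply: ge_sup; [exists 0|move=> t [/andP[]]].
have PltT s : 0 <= s < T -> P s.
  move=> /andP[s0 sT].
  have [t [_ Pt] st] := @sup_gt _ S s (ex_intro _ _ S0) sT.
  by apply: Pt; rewrite s0 ltW.
have PT : P T by apply: Pcl => //; rewrite T0 T1.
have /nbhs_normP [r /= r0 Hr] := Pop T (introT andP (conj T0 T1)) PT.
have [T1'|T1'] := ltP T 1; last first.
  move=> t /andP[t0 t1]; have [tT|Tt] := ltP t T; first by apply: PltT; rewrite t0.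
  have -> : t = T by apply/eqP; rewrite eq_le Tt (le_trans t1).
  exact: PT.
pose T' := Num.min 1 (T + r / 2).
have TT' : T < T' by rewrite lt_min T1' ltrDl divr_gt0.
have : S T'.
  split; first by rewrite (le_trans T0 (ltW TT')) ge_min lexx.
  move=> s /andP[s0 sT'].
  have [sT|Ts] := ltP s T; first by apply: PltT; rewrite s0.
  apply: Hr; rewrite /ball_ /= distrC ger0_norm ?subr_ge0 //.
  have : s <= T + r / 2 by apply: le_trans sT' _; rewrite ge_min lexx orbT.
  lra.
by move=> /(ub_le_sup Sub); rewrite leNgt TT'.
Qed.

End RealLemmas.

(** * Riemannian balls about the identity *)

Section RiemannianBalls.
Context {R : realType} {n : nat} {G : topologicalGroupType}.
Variable At : atlas 'rV[R]_n G.
Hypothesis G_lie : is_lie_group At.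
Local Notation V := 'rV[R]_n.
Local Notation dom := (cdom (At 1%g)).
Local Notation lphi := (lphi At).
Local Notation lpsi := (lpsi At).
Variable m : G -> 'M[R]_n.
Hypothesis m_metric : is_riemannian_metric At m.
Local Notation y0 := (cfun (At 1%g) 1%g).

Lemma gram_bounds : exists c1 c2 r : R, [/\ 0 < c1, 0 < c2, 0 < r &
  forall v, `|v| <= r -> [/\ dom (lpsi v), lphi (lpsi v) = v &
    forall u, c1 * `|u| ^+ 2 <= gram At m 1%g (v + y0) u u <= c2 * `|u| ^+ 2]].
Proof.
have [_ mpos _] := m_metric.
have pos u : u != 0 -> 0 < gram At m 1%g y0 u u.
  move=> u0; rewrite /gram /= (good_cinvK (lie_chart G_lie 1%g)).
  have [_ e] := mdiff_id (lie_chart G_lie 1%g).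
  have -> : 'd (cfun (At 1%g) \o cinv (At 1%g)) y0 u = u := congr1 (@^~ u) e.
  exact: mpos.
have [c1 [c2 [eta [c10 c20 eta0 H]]]] := posdef_stable (gram_bilinear At m 1%g y0) pos.
have [[od oi K _ _] d1] := lie_chart G_lie 1%g.
have near_gram (p : 'I_n * 'I_n) : \forall v \near (0 : V),
    `|gram At m 1%g (v + y0) (delta_mx 0 p.1) (delta_mx 0 p.2) -
      gram At m 1%g y0 (delta_mx 0 p.1) (delta_mx 0 p.2)| <= eta.
  have y0im : (cfun (At 1%g) @` dom) y0 by exists 1%g.
  have cg := @gram_Ck _ _ _ _ _ m_metric 1%g (delta_mx 0 p.1) (delta_mx 0 p.2) y0 y0im.
  have cs : (fun v : V => v + y0) @ (0 : V) --> y0.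
    by have := @shift_continuous R n y0 0; rewrite /prop_for /continuous_at add0r.
  move: cg; set g := fun y => gram At m 1%g y _ _; move=> cg.
  have := cvg_comp _ _ cs cg; move=> /cvgrPdist_le /(_ _ eta0).
  rewrite -[X in X -> _]/(\forall v \near 0, `|g y0 - g (v + y0)| <= eta).
  rewrite -[X in _ -> X]/(\forall v \near 0, `|g (v + y0) - g y0| <= eta).
  by clearbody g; apply: filterS => v; rewrite distrC.
have {}near_gram := filter_forall (nbhs_filter (0 : V)) near_gram.
have [r /= r0 Hr] := (nbhs_normP _ _).1 (filterI near_gram (lpsi_near G_lie)).
exists c1, c2, (r / 2); split; rewrite ?divr_gt0 // => v vr.
have /Hr [h1 [h2 h3]] : ball_ Num.Def.normr 0 r v.
  by rewrite /ball_ /= sub0r normrN; lra.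
split=> // u; apply: H; first exact: gram_bilinear.
by move=> i j; exact: (h1 (i, j)).
Qed.

End RiemannianBalls.

Section BallComparison.
Context {R : realType} {n : nat} {G : topologicalGroupType}.
Variable At : atlas 'rV[R]_n G.
Hypothesis G_lie : is_lie_group At.
Local Notation V := 'rV[R]_n.
Local Notation dom := (cdom (At 1%g)).
Local Notation lphi := (lphi At).
Local Notation lpsi := (lpsi At).
Local Notation gexp := (gexp At).
Local Notation model := (@model_atlas R R).
Variable m : G -> 'M[R]_n.
Hypothesis m_metric : is_riemannian_metric At m.
Local Notation y0 := (cfun (At 1%g) 1%g).

Lemma dist_gexp_le : exists C d : R, [/\ 0 < C, 0 < d &
  forall X, `|X| <= d -> riemannian_dist At m 1%g (gexp X) <= C * `|X|].
Proof.
have [c1 [c2 [r [c10 c20 r0 Hr]]]] := gram_bounds G_lie m_metric.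
have [E [A [rE [[A0 rE0 qE] ArE E0 HE]]]] := gexp_local G_lie.
(* Half of [rE] leaves room for times slightly beyond 1 when differentiating at [t = 1]; half of [r]
   is there because [E] at most doubles norms. *)
pose d := Num.min (rE / 2) (r / 2).
have d0 : 0 < d by rewrite lt_min !divr_gt0.
have drE : d <= rE / 2 by rewrite ge_min lexx.
have dr : d <= r / 2 by rewrite ge_min lexx orbT.
exists (Num.sqrt c2 * 2), d; split=> //; first by rewrite mulr_gt0 // sqrtr_gt0.
move=> X Xd.
have EL Y Z : `|Y| <= rE -> `|Z| <= rE -> `|E Y - E Z| <= 2 * `|Y - Z|.
  move=> hY hZ; rewrite -[X in `|X|](subrK (Y - Z)).
  apply: le_trans (ler_normD _ _) _.
  have h := qE rE Y Z (lexx _); rewrite !subr0 in h.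
  have {}h := h hY hZ.
  have : A * rE * `|Y - Z| <= 1 * `|Y - Z| by rewrite ler_wpM2r.
  by move: h => /=; lra.
pose gam := (fun t : R => 1 * gexp (t *: X))%g.
have gC : Ck_map model At 1 gam by exact: mulg_gexp_line_smooth.
have P := gexp_path G_lie m 1%g X; rewrite mul1g in P.
apply: le_trans (riemannian_dist_le P) _.
have sp t : 0 <= t <= 1 -> speed At m gam t <= Num.sqrt c2 * 2 * `|X|.
  move=> /andP[t0 t1].
  have tX s : 0 <= s <= 2 -> `|s *: X| <= rE.
    move=> /andP[s0 s2]; rewrite normrZ ger0_norm //.
    apply: (@le_trans _ _ (2 * d)); last by lra.
    by apply: ler_pM.
  have near_t : \forall s \near t, `|s *: X| <= rE.
    apply/nbhs_normP; exists 1 => //= s; rewrite /ball_ /= => ts.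
    rewrite normrZ; apply: (@le_trans _ _ (2 * d)); last by lra.
    apply: ler_pM => //; rewrite -(subrK t s) addrC.
    by apply: le_trans (ler_normD _ _) _; rewrite distrC (ger0_norm t0); lra.
  have t02 : 0 <= t <= 2 by rewrite t0; lra.
  have tr : `|t *: X| <= r / 2.
    by rewrite normrZ ger0_norm //; apply: le_trans dr; apply: le_trans Xd; rewrite ler_piMl.
  have [ge gd gl] := HE _ (tX t t02).
  have gdom : dom (gam t) by rewrite /gam mul1g ge.
  rewrite (speed_chart G_lie m gC gdom).
  set u := 'd _ t 1.
  have uX : `|u| <= 2 * `|X|.
    apply: diff_lipschitz_le; first exact: (curve_chart G_lie 1%g gC).1.
    apply: filterS near_t => s sX.
    have [ge' gd' gl'] := HE _ sX.
    have e1 : (cfun (At 1%g) \o gam) s = E (s *: X) + y0.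
      by rewrite -gl' -ge' /= /gam mul1g !lphiE subrK.
    have e2 : (cfun (At 1%g) \o gam) t = E (t *: X) + y0.
      by rewrite -gl -ge /= /gam mul1g !lphiE subrK.
    have -> : (cfun (At 1%g) \o gam) s - (cfun (At 1%g) \o gam) t = E (s *: X) - E (t *: X).
      by rewrite e1 e2 opprD addrACA subrr addr0.
    apply: le_trans (EL _ _ sX (tX t t02)) _.
    by rewrite -scalerBl normrZ -mulrA [`|X| * _]mulrC.
  have v_r : `|lphi (gam t)| <= r.
    have h := EL (t *: X) 0 (tX t t02); rewrite normr0 E0 !subr0 in h.
    by rewrite /gam mul1g ge gl; apply: le_trans (h (ltW rE0)) _; lra.
  have [_ _ /(_ u) /andP[_ hu]] := Hr _ v_r.
  have ey : lphi (gam t) + y0 = cfun (At 1%g) (gam t) by rewrite !lphiE subrK.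
  rewrite ey in hu.
  apply: (@le_trans _ _ (Num.sqrt (c2 * `|u| ^+ 2))); first by rewrite ler_wsqrtr.
  rewrite sqrtrM ?(ltW c20) // sqrtr_sqr normr_id -mulrA.
  by rewrite ler_wpM2l // sqrtr_ge0.
have -> : curve_length At m (fun t : R => 1 * gexp (t *: X))%g =
   \int[lebesgue_measure]_(t in `[0, 1]%classic) speed At m gam t by [].
have cst1 : \int[lebesgue_measure]_(t in `[0, 1]%classic) (Num.sqrt c2 * 2 * `|X|) = Num.sqrt c2 * 2 * `|X|.
  rewrite Rintegral_cst; last exact: measurable_itv.
  have E1 : lebesgue_measure (`[0, 1]%classic : set R) = 1%E.
    by rewrite lebesgue_measure_itv /= lte01 oppr0 adde0.
  by rewrite [X in fine X]E1 mulr1.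
rewrite -[leRHS]cst1.
apply: le_Rintegral; first exact: measurable_itv.
- exact: speed_integrable.
- apply: continuous_compact_integrable; first exact: segment_compact.
  by apply: continuous_subspaceT => x; exact: cvg_cst.
- by move=> t /=; rewrite in_itv /=; exact: sp.
Qed.

(** It is the continuous image of a compact ball in a Hausdorff space. A curve that stays in it
    cannot leave the chart domain, which is merely open, at a limit time. *)
Lemma closed_chart_ball r : (forall v, `|v| <= r -> dom (lpsi v) /\ lphi (lpsi v) = v) ->
  closed [set x | dom x /\ `|lphi x| <= r].
Proof.
move=> Hr.
have -> : [set x | dom x /\ `|lphi x| <= r] = lpsi @` [set v | `|v| <= r].
  apply/seteqP; split=> [x [dx xr]|_ [v vr <-]] /=.
    by exists (lphi x) => //; rewrite lphiK.
  by have [d e] := Hr v vr; rewrite e.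
apply: compact_closed; first by case: G_lie => -[].
apply: continuous_compact; last first.
  apply: bounded_closed_compact.
    exists r; split; first exact: num_real.
    by move=> x rx v /= /le_trans; apply; exact: ltW.
  have -> : [set v : V | `|v| <= r] = (fun v => `|v|) @^-1` [set x | x <= r] by [].
  by apply: closed_comp; [move=> v _; exact: norm_continuous|exact: closed_le].
apply: continuous_in_subspaceT => v; rewrite inE /= => /Hr [d e].
by rewrite -e; exact: (lpsi_continuous G_lie d).
Qed.

(** While the curve stays in the ball of radius [r], its coordinates are bounded by the initial ones
    plus [K] times the length. This number is strictly below [r], so the curve never reaches the
    boundary. *)
Lemma curve_stays (K r : R) (gam : R -> G) : 0 < K ->
  (forall v, `|v| <= r -> [/\ dom (lpsi v), lphi (lpsi v) = v &
    forall u, `|u| <= K * Num.sqrt (gram At m 1%g (v + y0) u u)]) ->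
  Ck_map model At 1 gam -> dom (gam 0) ->
  `|lphi (gam 0)| + K * curve_length At m gam < r ->
  dom (gam 1) /\ `|lphi (gam 1)| <= `|lphi (gam 0)| + K * curve_length At m gam.
Proof.
move=> K0 Hr gC d0 lt_r.
set b := _ + _ in lt_r *.
have Cc := curve_chart G_lie 1%g gC.
have lphi_gam s : dom (gam s) -> has_diff (fun t => lphi (gam t)) s ('d (cfun (At 1%g) \o gam) s).
  move=> ds; have h : has_diff (cfun (At 1%g) \o gam) s ('d (cfun (At 1%g) \o gam) s).
    by split; [exact: Cc.1|].
  have := has_diffB h (has_diff_cst y0 s).
  by apply: has_diff_ext (fun=> erefl) _ => v; rewrite subr0.
pose O s := dom (gam s) /\ `|lphi (gam s)| < r.
have est t : 0 <= t <= 1 -> (forall s, 0 <= s <= t -> O s) -> `|lphi (gam t)| <= b.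
  move=> t01 Os.
  have b0 : 0 <= b.
    by rewrite addr_ge0 // mulr_ge0 ?(ltW K0) // curve_length_ge0.
  apply: rV_norm_le => // j.
  pose F s := coord_lin j (lphi (gam s)).
  pose f s := coord_lin j ('d (cfun (At 1%g) \o gam) s 1).
  have h1 x : 0 <= x <= t -> is_derive x (1 : R) F (f x).
    move=> /Os [dx _].
    have dc : has_diff (@coord_lin R n j) (lphi (gam x)) (@coord_lin R n j).
      by apply: has_diff_lin; exact: coord_continuous.
    have [dF eF] := has_diff_comp (lphi_gam x dx) dc.
    by apply: DeriveDef; [exact: diff_derivable|rewrite deriveE // eF].
  have h2 x : 0 <= x <= t -> {for x, continuous f}.
    move=> /Os [dx _].
    have oD : open (gam @^-1` dom).
      apply: open_comp => [s _|]; first exact: gC.1.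
      by have [[]] := lie_chart G_lie 1%g.
    have cf : Ck 0 (gam @^-1` dom) f.
      by apply: Ck_linl => //; [exact: coord_continuous|exact: Cc.2].
    exact: cf.
  have h3 : continuous (speed At m gam) by exact: speed_continuous.
  have h4 x : 0 <= x <= t -> `|f x| <= K * speed At m gam x.
    move=> /Os [dx xr]; apply: le_trans (rV_coord_le _ _) _.
    have [_ _ /(_ ('d (cfun (At 1%g) \o gam) x 1))] := Hr _ (ltW xr).
    by rewrite !lphiE subrK (speed_chart G_lie m gC dx).
  have hF := integral_derivative_bound (ltW K0) t01 h1 h2 h3 (speed_ge0 At m gam) h4.
  have -> : lphi (gam t) ord0 j = F 0 + (F t - F 0) by rewrite addrC subrK.
  apply: le_trans (ler_normD _ _) _; apply: lerD; last exact: hF.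
  exact: rV_coord_le.
have Oall : forall t, 0 <= t <= 1 -> O t.
  apply: interval_induction => t t01.
    move=> [dt tr].
    have h1 : \forall s \near t, dom (gam s).
      by apply: gC.1; apply: open_nbhs_nbhs; split=> //; have [[]] := lie_chart G_lie 1%g.
    have h2 : \forall s \near t, `|lphi (gam s)| < r.
      have c : (fun s => `|lphi (gam s)|) @ t --> `|lphi (gam t)|.
        have cc := differentiable_continuous (lphi_gam t dt).1.
        exact: (cvg_norm cc).
      have nr : nbhs `|lphi (gam t)| [set x : R | x < r].
        by apply: open_nbhs_nbhs; split=> //; exact: open_lt.
      exact: (c _ nr).
    by apply: filterI h1 h2.
  (* At a limit time, closedness of the chart ball of the smaller radius [b] keeps the point in the
     chart, and [b < r] restores the strict inequality. *)
  move=> Ot.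
  have [t0|tn0] := eqVneq t 0.
    rewrite t0; split=> //; apply: le_lt_trans lt_r.
    by rewrite lerDl mulr_ge0 ?(ltW K0) // curve_length_ge0.
  have {}tn0 : 0 < t by rewrite lt_neqAle eq_sym tn0; case/andP: t01.
  suff [dt bt] : [set x | dom x /\ `|lphi x| <= b] (gam t).
    by split=> //; exact: le_lt_trans bt lt_r.
  have cb : closed [set x | dom x /\ `|lphi x| <= b].
    by apply: closed_chart_ball => v vb; have [] := Hr v (le_trans vb (ltW lt_r)).
  have cl : (gam @ t^'-) --> gam t by apply: cvg_at_left_filter; exact: gC.1.
  apply: (closed_cvg _ cb _ _ cl).
  near=> s.
  have s0 : 0 < s by near: s; exact: nbhs_left_gt.
  have st : s < t by near: s; exact: nbhs_left_lt.
  have Os u : 0 <= u <= s -> O u.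
    by move=> /andP[u0 us]; apply: Ot; rewrite u0 (le_lt_trans us).
  split; first by have [] := Os s; rewrite ?lexx ?ltW.
  apply: est => //; rewrite (ltW s0) (le_trans (ltW st)) //.
  by case/andP: t01.
have one01 : 0 <= (1 : R) <= 1 by rewrite ler01 lexx.
have [d1 _] := Oall 1 one01; split=> //; exact: est.
Unshelve. all: by end_near. Qed.

Lemma path_stays (K r : R) x y L : 0 < K ->
  (forall v, `|v| <= r -> [/\ dom (lpsi v), lphi (lpsi v) = v &
    forall u, `|u| <= K * Num.sqrt (gram At m 1%g (v + y0) u u)]) ->
  piecewise_path At m x y L -> dom x -> `|lphi x| + K * L < r ->
  dom y /\ `|lphi y| <= `|lphi x| + K * L.
Proof.
move=> K0 Hr; elim=> [z dz|gam z L' gC P IH d0]; first by rewrite mulr0 addr0.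
have L0 := piecewise_length_ge0 P.
have KL0 : 0 <= K * L' by rewrite mulr_ge0 // ltW.
rewrite mulrDr addrA => lt_r.
have [|d1 h1] := curve_stays K0 Hr gC d0; first by apply: le_lt_trans lt_r; rewrite lerDl.
have [|dz hz] := IH d1; first by apply: le_lt_trans lt_r; rewrite lerD2r.
by split=> //; apply: le_trans hz _; rewrite lerD2r.
Qed.

(* Needed because [riemannian_dist] is [0] between points that no path joins. *)
Lemma reachable : connected [set: G] -> forall x, exists L, piecewise_path At m 1%g x L.
Proof.
move=> Gc; pose S := [set x | exists L, piecewise_path At m 1%g x L].
have [r r0 Hr] := gexp_onto G_lie.
have nN : nbhs 1%g [set y | dom y /\ `|lphi y| <= r].
  have c : (fun x => `|lphi x|) @ 1%g --> `|lphi 1%g|.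
    by apply: cvg_norm; exact: (lphi_continuous G_lie (lie_chart G_lie 1%g).2).
  rewrite lphi1 normr0 in c.
  have nr : nbhs (0 : R) [set x : R | x <= r].
    by apply: filterS (open_nbhs_nbhs (conj (@open_lt _ r) r0)) => x; exact: ltW.
  have c' : nbhs 1%g ((fun x => `|lphi x|) @^-1` [set x : R | x <= r]) := c _ nr.
  by apply: filterI; [exact: (dom_nbhs G_lie)|exact: c'].
have near_step x : \forall z \near x, exists X, z = (x * gexp X)%g.
  have c : (fun z => x^-1 * z)%g @ x --> 1%g.
    rewrite -[X in _ --> X](mulVg x).
    exact: (cvg_comp2 (cvg_cst _) cvg_id (@mulg_continuous G (x^-1%g, x))).
  have h : \forall z \near x, dom (x^-1 * z)%g /\ `|lphi (x^-1 * z)%g| <= r := c _ nN.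
  apply: filterS h => z [dz /(Hr _ dz) [X [_ eX]]].
  by exists X; rewrite eX mulVKg.
have step x X : S x -> S (x * gexp X)%g.
  by move=> [L P]; eexists; apply: piecewise_path_cat P _; exact: gexp_path.
have oS : open S.
  rewrite openE => x Sx; apply: filterS (near_step x) => z [X ->].
  exact: step.
have cS : closed S.
  rewrite -[S]setCK; apply: open_closedC; rewrite openE => x nSx.
  apply: filterS (near_step x) => z [X ez] Sz; apply: nSx.
  have -> : x = (z * gexp (- X))%g by rewrite ez (gexpN G_lie) mulgK.
  exact: step.
have ST : S = setT.
  apply: Gc; first by exists 1%g; exists 0; exact: path_nil.
  - by exists S => //; rewrite setTI.
  - by exists S => //; rewrite setTI.
by move=> x; have : setT x by []; rewrite -ST.
Qed.

(** A path of length below [eps] confines the coordinates of its endpoint to [K * eps]; then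
    [gexp_onto] supplies a logarithm of at most twice that size. *)
Lemma ball_sub_gexp : connected [set: G] -> exists C d : R, [/\ 0 < C, 0 < d &
  forall eps x, 0 < eps <= d -> identity_ball At m eps x ->
    exists2 X, gexp X = x & `|X| <= C * eps].
Proof.
move=> Gc; have [c1 [c2 [r [c10 c20 r0 Hr]]]] := gram_bounds G_lie m_metric.
have [r' r'0 Hr'] := gexp_onto G_lie.
pose K := (Num.sqrt c1)^-1.
have K0 : 0 < K by rewrite invr_gt0 sqrtr_gt0.
have HK v : `|v| <= r -> [/\ dom (lpsi v), lphi (lpsi v) = v &
    forall u, `|u| <= K * Num.sqrt (gram At m 1%g (v + y0) u u)].
  move=> /Hr [h1 h2 h3]; split=> // u; have /andP[h4 _] := h3 u.
  rewrite mulrC ler_pdivlMr ?sqrtr_gt0 // mulrC -[`|u|]normr_id -sqrtr_sqr.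
  by rewrite -sqrtrM ?(ltW c10) // ler_wsqrtr.
pose d := Num.min (r / 2 / K) (r' / K).
have d0 : 0 < d by rewrite lt_min !divr_gt0.
exists (2 * K), d; split=> //; first by rewrite mulr_gt0.
move=> eps x /andP[e0 ed] Bx.
have [L PL Le] : exists2 L, piecewise_path At m 1%g x L & L < eps.
  by apply: inf_lt Bx; have [L PL] := reachable Gc x; exists L.
have KL : K * L < K * eps by rewrite ltr_pM2l.
have dr : K * d <= r / 2 by rewrite mulrC -ler_pdivlMr // ge_min lexx.
have dr' : K * d <= r' by rewrite mulrC -ler_pdivlMr // ge_min lexx orbT.
have Ked : K * eps <= K * d by rewrite ler_pM2l.
have [||dx xr] := path_stays K0 HK PL; first exact: (lie_chart G_lie 1%g).2.
  by rewrite lphi1 normr0 add0r; lra.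
rewrite lphi1 normr0 add0r in xr.
have [|X [X2 eX]] := Hr' x dx; first by lra.
by exists X => //; apply: le_trans X2 _; rewrite -mulrA ler_pM2l //; lra.
Qed.

End BallComparison.

(** * The Cartan form and restricted roots *)

Section Killing.
Context {R : realType} {n : nat} {G : topologicalGroupType}.
Variable At : atlas 'rV[R]_n G.
Hypothesis G_lie : is_lie_group At.
Local Notation V := 'rV[R]_n.
Local Notation gexp := (gexp At).
Local Notation Ad := (Ad At).
Local Notation bracket := (bracket At).
Local Notation killing := (killing At).
Implicit Types (X Y Z : V) (g : G).

Lemma killing_bilinear : bilinear_form killing.
Proof.
have eD X Y : lin1_mx (bracket (X + Y)) = lin1_mx (bracket X) + lin1_mx (bracket Y).
  by apply/matrixP => i j; rewrite !mxE bracketDl !mxE.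
have eZ (a : R) X : lin1_mx (bracket (a *: X)) = a *: lin1_mx (bracket X).
  by apply/matrixP => i j; rewrite !mxE bracketZl !mxE.
rewrite /Defs.killing; split=> [X X' Y|a X Y|X Y Y'|a X Y].
- by rewrite eD mulmxDl mxtraceD.
- by rewrite eZ -scalemxAl mxtraceZ.
- by rewrite eD mulmxDr mxtraceD.
- by rewrite eZ -scalemxAr mxtraceZ.
Qed.

Lemma killingC X Y : killing X Y = killing Y X.
Proof. by rewrite /Defs.killing mxtrace_mulC. Qed.

(** [phi] conjugates [ad X] into [ad (phi X)], and the trace is invariant under conjugation. *)
Lemma killing_automorphism (phi psi : V -> V) X Y : linear phi -> linear psi ->
  cancel phi psi -> cancel psi phi ->
  (forall X Y, phi (bracket X Y) = bracket (phi X) (phi Y)) ->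
  killing (phi X) (phi Y) = killing X Y.
Proof.
move=> lphi lpsi phiK psiK phiB.
pose L (f : V -> V) (lf : linear f) : {linear V -> V} :=
  HB.pack f (GRing.isLinear.Build _ _ _ _ _ lf).
pose P := lin1_mx (L phi lphi); pose Q := lin1_mx (L psi lpsi).
have PQ : Q *m P = 1%:M.
  by apply/row_matrixP => i; rewrite !rowE mulmx1 mulmxA !mul_rV_lin1 /= psiK.
have adE Z u : u *m lin1_mx (bracket Z) = bracket Z u.
  exact: (mul_rV_lin1 (L (bracket Z) (ad_lin_is_linear G_lie Z))).
have conj Z : lin1_mx (bracket (phi Z)) = Q *m lin1_mx (bracket Z) *m P.
  apply/row_matrixP => i; rewrite !rowE !mulmxA adE !mul_rV_lin1 /= adE phiB.
  by rewrite psiK.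
rewrite /Defs.killing !conj mulmxA -[_ *m P *m (_ *m _)]mulmxA.
have PQ' : P *m Q = 1%:M by apply: mulmx1C.
rewrite [P *m (_ *m _)]mulmxA PQ' mul1mx -!mulmxA mxtrace_mulC.
by rewrite -!mulmxA PQ' mulmx1.
Qed.

Lemma killing_Ad g X Y : killing (Ad g X) (Ad g Y) = killing X Y.
Proof.
apply: (@killing_automorphism _ (Ad g^-1%g)); [exact: Ad_is_linear|exact: Ad_is_linear|..].
- exact: AdK.
- exact: AdVK.
- exact: Ad_bracket.
Qed.

Lemma bilinear_form_linl (B : V -> V -> R) Z : bilinear_form B ->
  linear (fun X => B X Z : R^o).
Proof. by move=> [Dl Zl _ _] a X Y; rewrite Dl Zl. Qed.

(** Differentiate [killing (Ad (exp (t X)) Y) Z = killing Y (Ad (exp (- t X)) Z)] at [t = 0]. *)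
Lemma killing_bracket X Y Z : killing (bracket X Y) Z = - killing Y (bracket X Z).
Proof.
have bK := killing_bilinear; have [_ Zl _ Zr] := bK.
pose L Z : {linear V -> R^o} :=
  HB.pack (fun X => killing X Z : R^o) (GRing.isLinear.Build _ _ _ _ _ (bilinear_form_linl Z bK)).
have hL Y' Z' X' := has_diff_comp (Ad_gexp_diff0 G_lie X' Y')
  (@has_diff_lin _ _ _ (L Z') _ (@rV_linear_continuous _ _ _ (L Z'))).
have h1 : has_diff (fun t : R => killing (Ad (gexp (t *: X)) Y) Z : R^o) 0
    (fun s => s *: (killing (bracket X Y) Z : R^o)).
  by apply: has_diff_ext (fun=> erefl) _ (hL Y Z X) => s; rewrite /= Zl.
have h2 : has_diff (fun t : R => killing (Ad (gexp (t *: X)) Y) Z : R^o) 0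
    (fun s => s *: (killing (bracket (- X) Z) Y : R^o)).
  apply: has_diff_ext _ _ (hL Z Y (- X)) => t; last by rewrite /= Zl.
  rewrite /= -(killing_Ad (gexp (t *: X))) killingC; congr Defs.killing.
  by rewrite scalerN (gexpN G_lie) (AdVK G_lie).
have := has_diff_line_unique h1 h2 => ->.
by rewrite -scaleN1r bracketZl Zl mulN1r killingC.
Qed.

End Killing.

Section CartanForm.
Context {R : realType} {n : nat} {G : topologicalGroupType}.
Variable At : atlas 'rV[R]_n G.
Hypothesis G_lie : is_lie_group At.
Variable theta : G -> G.
Hypothesis theta_cartan : is_cartan_involution At theta.
Local Notation V := 'rV[R]_n.
Local Notation Ad := (Ad At).
Local Notation bracket := (bracket At).
Local Notation killing := (killing At).
Local Notation dth := (differential At theta).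
Implicit Types (X Y Z : V) (g : G).

Lemma involution_bracket (s : G -> G) X Y : is_involution At s ->
  differential At s (bracket X Y) = bracket (differential At s X) (differential At s Y).
Proof.
by move=> [ss sM _]; apply: differential_bracket => //; exact: mdiff_smooth.
Qed.

Lemma involution_Ad (s : G -> G) g X : is_involution At s ->
  differential At s (Ad g X) = Ad (s g) (differential At s X).
Proof.
by move=> [ss sM _]; apply: differential_Ad => //; exact: mdiff_smooth.
Qed.

Lemma differential_is_linear (s : G -> G) : linear (differential At s).
Proof. by move=> a X Y; rewrite differentialD differentialZ. Qed.

(** The inner product usually written [B_theta]; its positivity is the defining property of a Cartan
    involution. *)
Definition cform X Y := - killing X (dth Y).

Lemma cform_bilinear : bilinear_form cform.
Proof.
have [Dl Zl Dr Zr] := killing_bilinear At.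
rewrite /cform; split=> [X X' Y|a X Y|X Y Y'|a X Y].
- by rewrite Dl opprD.
- by rewrite Zl mulrN.
- by rewrite differentialD Dr opprD.
- by rewrite differentialZ Zr mulrN.
Qed.

Lemma cform_gt0 X : X != 0 -> 0 < cform X X.
Proof. by case: theta_cartan => _; exact. Qed.

Lemma dthK X : dth (dth X) = X.
Proof. by apply: differential_involution => //; case: theta_cartan. Qed.

Lemma killing_dth X Y : killing (dth X) (dth Y) = killing X Y.
Proof.
have [th_inv _] := theta_cartan.
apply: (@killing_automorphism _ _ _ _ G_lie _ dth);
  [exact: differential_is_linear|exact: differential_is_linear|exact: dthK|exact: dthK|].
by move=> X' Y'; exact: involution_bracket.
Qed.

Lemma cformC X Y : cform X Y = cform Y X.
Proof. by rewrite /cform killingC -[in RHS]killing_dth dthK. Qed.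

Lemma cform_Ad k X Y : theta k = k -> cform (Ad k X) (Ad k Y) = cform X Y.
Proof.
have [th_inv _] := theta_cartan.
by move=> tk; rewrite /cform involution_Ad // tk killing_Ad.
Qed.

(** For [X] in the [-1] eigenspace of [theta], the sign from [theta] cancels that from invariance of
    the Killing form: [ad X] is symmetric. *)
Lemma cform_ad X Y Z : dth X = - X -> cform (bracket X Y) Z = cform Y (bracket X Z).
Proof.
have [th_inv _] := theta_cartan.
move=> tX; rewrite /cform killing_bracket // opprK involution_bracket // tX.
have [_ _ _ Zr] := killing_bilinear At.
by rewrite bracketNl -(scaleN1r (bracket X _)) Zr mulN1r opprK.
Qed.

(* [Ad k] is an isometry of [cform], so compactness of K is not needed. *)
Lemma Ad_fixed_bounded : exists2 C, 0 < C &
  forall k X, theta k = k -> `|Ad k X| <= C * `|X|.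
Proof.
have [c1 [c2 [eta [c10 c20 eta0 H]]]] := posdef_stable cform_bilinear cform_gt0.
have bnd X : c1 * `|X| ^+ 2 <= cform X X <= c2 * `|X| ^+ 2.
  apply: H; first exact: cform_bilinear.
  by move=> i j; rewrite subrr normr0 ltW.
exists (Num.sqrt (c2 / c1)); first by rewrite sqrtr_gt0 divr_gt0.
move=> k X tk.
have /andP[h1 _] := bnd (Ad k X); have /andP[_ h2] := bnd X.
rewrite cform_Ad // in h1.
have cc : 0 <= c2 / c1 by rewrite divr_ge0 // ltW.
rewrite -(ler_pXn2r (n := 2)) ?nnegrE ?mulr_ge0 ?sqrtr_ge0 //.
rewrite exprMn sqr_sqrtr // mulrAC ler_pdivlMr // mulrC.
exact: le_trans h1 h2.
Qed.

End CartanForm.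

(** * Simultaneous diagonalization of commuting symmetric operators *)

Section JointSpectral.
Context {R : realType} {n : nat}.
Local Notation V := 'rV[R]_n.
Variable B : V -> V -> R.
Hypothesis B_bil : bilinear_form B.
Hypothesis B_sym : forall u v, B u v = B v u.
Hypothesis B_pos : forall u, u != 0 -> 0 < B u u.

Lemma vspace_closed (U : {vspace V}) : closed [set u | u \in U].
Proof.
pose f (u : V) := projv U u - u.
have -> : [set u | u \in U] = f @^-1` [set 0].
  apply/seteqP; split=> u /= uU; first by rewrite /f projv_id // subrr.
  by have := memv_proj U u; move/eqP : uU; rewrite subr_eq0 => /eqP ->.
apply: closed_comp => [u _|]; last by apply: accessible_closed_set1; apply: hausdorff_accessible; exact: norm_hausdorff.
apply: continuousD; last by apply: continuousN; exact: cvg_id.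
exact: rV_linear_continuous.
Qed.

Lemma psd_form_kernel (b c : R) : 0 <= c -> (forall t, 0 <= 2 * t * b + t ^+ 2 * c) -> b = 0.
Proof.
move=> c0 H; apply/eqP; apply: contraT => b0.
(* The minimum of the quadratic is at [- b / c]; the denominator [c + 1] also covers [c = 0] and
   still makes the value negative. *)
have h := H (- b / (c + 1)).
have c1 : 0 < c + 1 by rewrite ltr_wpDl.
have : 2 * (- b / (c + 1)) * b + (- b / (c + 1)) ^+ 2 * c =
  - (b ^+ 2 * (c + 2)) / (c + 1) ^+ 2 by field; rewrite lt0r_neq0.
move=> e; rewrite e in h; move: h.
rewrite mulNr oppr_ge0 leNgt divr_gt0 // ?exprn_gt0 // mulr_gt0 ?ltr_wpDl //.
by rewrite lt_neqAle sqr_ge0 eq_sym sqrf_eq0 b0.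
Qed.

(** A maximizer [v] of [B (S u) u] on the unit sphere of [U], with maximum [l], is a null vector of
    the positive semidefinite form of [l - S] on [U]; a null vector of such a form lies in its
    kernel. *)
Lemma symmetric_eigenvector (S : {linear V -> V}) (U : {vspace V}) :
  (forall u v, B (S u) v = B u (S v)) -> (forall u, u \in U -> S u \in U) ->
  U != 0%VS -> exists v l, [/\ v \in U, v != 0 & S v = l *: v].
Proof.
move=> Ssym SU U0; have [Dl Zl Dr Zr] := B_bil.
have [c c0 Hc] := posdef_lower_bound B_bil B_pos.
pose D := [set u | u \in U] `&` [set u | B u u = 1].
have Sc : continuous S by exact: rV_linear_continuous.
have D0 : D !=set0.
  have w0 : vpick U != 0 by rewrite vpick0.
  have Bw := B_pos w0.
  exists ((Num.sqrt (B (vpick U) (vpick U)))^-1 *: vpick U); split=> /=.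
    by rewrite memvZ // memv_pick.
  rewrite Zl Zr mulrA -expr2 exprVn sqr_sqrtr ?(ltW Bw) // mulVf //.
  exact: lt0r_neq0.
have cD : compact D.
  apply: bounded_closed_compact.
    exists (1 + c^-1); split; first exact: num_real.
    move=> x hx u /= [uU u1]; apply: ltW; apply: le_lt_trans hx.
    have := Hc u; rewrite u1 => h.
    have : `|u| ^+ 2 <= c^-1 by rewrite -[leRHS]mulr1 mulrC ler_pdivlMr // mulrC.
    have [u1'|u1'] := leP `|u| 1.
      by move=> _; rewrite (le_trans u1') // lerDl invr_ge0 ltW.
    move=> h2; apply: (@le_trans _ _ (`|u| ^+ 2)).
      by rewrite expr2 ler_peMr // ltW.
    by apply: le_trans h2 _; rewrite lerDr.
  apply: closedI; first exact: vspace_closed.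
  have -> : [set u | B u u = 1] = (fun u => B u u) @^-1` [set 1] by [].
  by apply: closed_comp; [move=> u _; exact: (bilinear_continuous B_bil)|exact: closed_eq].
have bS : bilinear_form (fun u v => B (S u) v).
  split=> *; rewrite ?linearD ?(linearZ_LR S) /= ?(Dl, Zl, Dr, Zr) //.
have [v vD Hmax] := EVT_max_rV D0 cD (continuous_subspaceT (bilinear_continuous bS)).
move: vD; rewrite inE => -[/= vU v1].
pose l := B (S v) v.
have Hl w : w \in U -> B (S w) w <= l * B w w.
  move=> wU; have [->|w0] := eqVneq w 0.
    by rewrite linear0 -(scale0r 0) !Zl !Zr !mul0r mulr0.
  have Bw := B_pos w0.
  pose a := (Num.sqrt (B w w))^-1.
  have a2 : a * a = (B w w)^-1 by rewrite -expr2 exprVn sqr_sqrtr // ltW.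
  have := Hmax (a *: w); rewrite inE => /(_ _)/wrap[].
    by split=> /=; [rewrite memvZ|rewrite Zl Zr mulrA a2 mulVf // lt0r_neq0].
  rewrite (linearZ_LR S) /= Zl Zr mulrA a2 -/l => h.
  by rewrite mulrC -ler_pdivrMl.
pose T w := l *: w - S w.
have TU w : w \in U -> T w \in U by move=> wU; rewrite memvB // ?memvZ // SU.
have Bsub u w z : B (u - w) z = B u z - B w z by rewrite Dl -scaleN1r Zl mulN1r.
have BTsym u w : B (T u) w = B u (T w).
  by rewrite /T Bsub [RHS]B_sym Bsub !Zl Ssym (B_sym w u) (B_sym (S w) u).
have BT0 w : w \in U -> 0 <= B (T w) w by move=> wU; rewrite /T Bsub Zl subr_ge0 Hl.
have BTv : B (T v) v = 0 by rewrite /T Bsub Zl v1 mulr1 subrr.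
exists v, l; split=> //.
  by apply/eqP => e; move: v1; rewrite e -(scale0r 0) Zl mul0r => /eqP; rewrite eq_sym oner_eq0.
have TvU := TU v vU.
have TD u w : T (u + w) = T u + T w by rewrite /T !linearD; row_ring.
have TZ a u : T (a *: u) = a *: T u.
  by rewrite /T (linearZ_LR S) /= scalerBr !scalerA mulrC.
have : B (T v) (T v) = 0.
  apply: (@psd_form_kernel _ (B (T (T v)) (T v))); first exact: BT0.
  move=> t; have := BT0 (v + t *: T v); rewrite memvD ?memvZ // => /(_ isT).
  rewrite TD TZ; have e1 := BTsym (T v) v.
  move: BTv e1; move: (T v) => w bw; move: (T w) => w2 e1.
  have -> : B (w + t *: w2) (v + t *: w) = 2 * t * B w w + t ^+ 2 * B w2 w.
    by rewrite Dl Zl !Dr !Zr bw e1; ring.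
  by [].
move=> e; have : T v = 0.
  by apply/eqP; apply: contraT => /B_pos; rewrite e ltxx.
by move/eqP; rewrite subr_eq0 => /eqP ->.
Qed.

Variables (I : Type) (F : I -> {linear V -> V}).
Hypothesis F_sym : forall i u v, B (F i u) v = B u (F i v).
Hypothesis F_comm : forall i j u, F i (F j u) = F j (F i u).

(** If every operator is scalar on [U], any vector works. Otherwise an eigenspace of a nonscalar one
    is a proper nonzero subspace, stable under the others by commutation, and the dimension
    drops. *)
Lemma joint_eigenvector (U : {vspace V}) :
  (forall i u, u \in U -> F i u \in U) -> U != 0%VS ->
  exists v, [/\ v \in U, v != 0 & forall i, exists l, F i v = l *: v].
Proof.
have [k] := ubnP (\dim U); elim: k U => // k IH U dU FU U0.
have [H|H] := pselect (forall i, exists l, forall u, u \in U -> F i u = l *: u).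
  exists (vpick U); rewrite memv_pick vpick0; split=> // i.
  by have [l Hl] := H i; exists l; apply: Hl; exact: memv_pick.
have [i Hi] : exists i, forall l, exists2 u, u \in U & F i u != l *: u.
  apply: contrapT => N; apply: H => i; apply: contrapT => Ni; apply: N.
  exists i => l; apply: contrapT => Nl; apply: Ni; exists l => u uU.
  by apply/eqP; apply: contraT => ne; case: Nl; exists u.
have [v [l [vU v0 ev]]] := symmetric_eigenvector (F_sym i) (FU i) U0.
pose h := linfun (F i) - l *: \1%VF.
have hE u : h u = F i u - l *: u by rewrite add_lfunE opp_lfunE scale_lfunE id_lfunE lfunE.
pose U' := (U :&: lker h)%VS.
have memU' u : (u \in U') = (u \in U) && (F i u == l *: u).
  by rewrite memv_cap memv_ker hE subr_eq0.
have U'U : (U' <= U)%VS by exact: capvSl.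
have [|||w [wU' w0 Hw]] := IH U'.
- have [u uU ne] := Hi l.
  rewrite -ltnS; apply: leq_trans dU; rewrite ltnS.
  rewrite ltn_neqAle dimvS // andbT; apply/eqP => e.
  have /eqP E : U' == U by rewrite eqEdim U'U e leqnn.
  by move: uU; rewrite -E memU' (negbTE ne) andbF.
- move=> j u; rewrite !memU' => /andP[uU /eqP eu]; rewrite FU //=.
  by rewrite F_comm eu (linearZ_LR (F j)).
- by apply/eqP => e; move: v0; rewrite -memv0 -e memU' vU ev eqxx.
by exists w; split=> //; exact: (subvP U'U).
Qed.

Lemma joint_eigenlist : exists s : seq V,
  (forall f, f \in s -> f != 0 /\ forall i, exists l, F i f = l *: f) /\
  forall x, x = \sum_(f <- s) (B f x / B f f) *: f.
Proof.
have [Dl Zl Dr Zr] := B_bil.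
suff H (U : {vspace V}) : (forall i u, u \in U -> F i u \in U) -> exists s : seq V,
  (forall f, f \in s -> [/\ f \in U, f != 0 & forall i, exists l, F i f = l *: f]) /\
  forall x, x \in U -> x = \sum_(f <- s) (B f x / B f f) *: f.
  have [s [Hs Es]] := H fullv (fun i u _ => memvf _).
  by exists s; split=> [f /Hs[]|x]; [|apply: Es; exact: memvf].
have [k] := ubnP (\dim U); elim: k U => // k IH U dU FU.
have [U0|U0] := eqVneq U 0%VS.
  exists [::]; split=> // x; rewrite U0 memv0 => /eqP ->.
  by rewrite big_nil.
have [v [vU v0 ev]] := joint_eigenvector FU U0.
have Bv := B_pos v0.
pose L : {linear V -> R^o} := HB.pack (fun x => B x v : R^o)
  (GRing.isLinear.Build _ _ _ _ _ (fun a x y => etrans (Dl (a *: x) y v) (congr1 (+%R^~ _) (Zl a x v)) : B (a *: x + y) v = a * B x v + B y v)).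
pose U' := (U :&: lker (linfun L))%VS.
have memU' u : (u \in U') = (u \in U) && (B u v == 0).
  by rewrite memv_cap memv_ker lfunE.
have U'U : (U' <= U)%VS by exact: capvSl.
have [||s [Hs Es]] := IH U'.
- rewrite -ltnS; apply: leq_trans dU; rewrite ltnS.
  rewrite ltn_neqAle dimvS // andbT; apply/eqP => e.
  have /eqP E : U' == U by rewrite eqEdim U'U e leqnn.
  by move: vU; rewrite -E memU' (gt_eqF Bv) andbF.
- move=> j u; rewrite !memU' => /andP[uU /eqP eu]; rewrite FU //=.
  by have [l el] := ev j; rewrite F_sym el Zr eu mulr0.
exists (v :: s); split=> [f|x xU].
  rewrite inE => /predU1P[->//|/Hs[fU' f0 ef]]; split=> //.
  exact: (subvP U'U).
rewrite big_cons.
(* Removing the component along [v] leaves a vector of the orthogonal complement [U']. The rest of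
   the list lies in [U'], so its coefficients are those of [x] itself. *)
pose x' := x - (B v x / B v v) *: v.
have x'U' : x' \in U'.
  rewrite memU' memvB // ?memvZ //=.
  have Bsub u w z : B (u - w) z = B u z - B w z by rewrite Dl -scaleN1r Zl mulN1r.
  by rewrite Bsub Zl (divfK (lt0r_neq0 Bv)) (B_sym v x) subrr.
have e1 : x = (B v x / B v v) *: v + x' by rewrite /x' addrC subrK.
apply: (etrans e1); congr (_ + _); rewrite [LHS](Es _ x'U').
apply: eq_big_seq => f /Hs [fU' _ _]; congr (_ / _ *: _).
have : B f v == 0 by move: fU'; rewrite memU' => /andP[].
by rewrite /x' Dr -scaleN1r !Zr => /eqP ->; rewrite !mulr0 addr0.
Qed.

End JointSpectral.

(** * Restricted roots and the chamber *)

Section Roots.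
Context {R : realType} {n : nat} {G : topologicalGroupType}.
Variable At : atlas 'rV[R]_n G.
Hypothesis G_lie : is_lie_group At.
Variable theta : G -> G.
Hypothesis theta_cartan : is_cartan_involution At theta.
Local Notation V := 'rV[R]_n.
Local Notation bracket := (bracket At).
Local Notation dth := (differential At theta).
Local Notation cform := (cform At theta).
Variable a : {vspace V}.
Hypothesis a_p : forall X, X \in a -> dth X = - X.
Hypothesis a_abelian : forall X Y, X \in a -> Y \in a -> bracket X Y = 0.
Implicit Types (X Y Z : V).

Lemma devalD (al be : dual_space a) X : deval (al + be) X = deval al X + deval be X.
Proof. by rewrite /deval add_lfunE. Qed.

Lemma devalN (al : dual_space a) X : deval (- al) X = - deval al X.
Proof. by rewrite /deval opp_lfunE. Qed.

Lemma deval_is_linear (al : dual_space a) : linear (deval al : V -> R^o).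
Proof. by move=> k X Y; rewrite /deval !linearP. Qed.

Lemma deval_continuous (al : dual_space a) : continuous (deval al).
Proof.
pose L : {linear V -> R^o} := HB.pack (deval al : V -> R^o)
  (GRing.isLinear.Build _ _ _ _ _ (deval_is_linear al)).
exact: (@rV_linear_continuous _ _ _ L).
Qed.

Lemma ad_eigenlist : exists s : seq V,
  (forall f, f \in s -> f != 0 /\ exists al : dual_space a, root_space At al f) /\
  forall x, x = \sum_(f <- s) (cform f x / cform f f) *: f.
Proof.
have bc := cform_bilinear At theta; have [Dl Zl Dr Zr] := bc.
pose F (u : subvs_of a) : {linear V -> V} := HB.pack (ad_lin At (vsval u))
  (GRing.isLinear.Build _ _ _ _ _ (ad_lin_is_linear G_lie (vsval u))).
have [||s [Hs Es]] := @joint_eigenlist _ _ cform bc (cformC G_lie theta_cartan) (cform_gt0 theta_cartan) _ F.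
- by move=> u X Y; apply: cform_ad => //; apply: a_p; exact: subvsP.
- by move=> u v X; apply: bracket_swap => //; apply: a_abelian; exact: subvsP.
exists s; split=> // f /Hs [f0 ef]; split=> //.
have cf := cform_gt0 theta_cartan f0.
(* Eigenvalues were obtained separately for each element of [a]; this quotient recovers them by a
   formula that is visibly linear in [u]. *)
pose g (u : subvs_of a) : R^o := cform f (bracket (vsval u) f) / cform f f.
have gl : linear g.
  by move=> k u v; rewrite /g linearP bracketDl bracketZl Dr Zr mulrDl -mulrA.
pose L : {linear subvs_of a -> R^o} := HB.pack g (GRing.isLinear.Build _ _ _ _ _ gl).
exists (linfun L) => Y Ya; rewrite /deval lfunE /= /g vsprojK //.
have [l] := ef (vsproj a Y); rewrite /= /ad_lin vsprojK // => ->.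
by rewrite Zr mulfK // lt0r_neq0.
Qed.

Lemma root_opp al : is_root At al -> is_root At (- al : dual_space a).
Proof.
have [th_inv _] := theta_cartan.
move=> [al0 [X [rX X0]]]; split; first by rewrite oppr_eq0.
exists (dth X); split=> [Y Ya|]; last first.
  apply: contra X0 => /eqP e; rewrite -(dthK G_lie theta_cartan X) e.
  by rewrite differential0.
have e := rX Y Ya.
have eY : dth (- Y) = Y by rewrite differentialN a_p // opprK.
rewrite -{1}eY -involution_bracket // bracketNl e devalN.
by rewrite differentialN differentialZ scaleNr.
Qed.

(** Some [f] in the list is not orthogonal to the given root vector, and eigenvectors of a symmetric
    operator with different eigenvalues are orthogonal; so [f] has the same root. Thus the list
    exhausts the roots. *)
Lemma root_finite (s : seq V) (al : dual_space a) :
  (forall f, f \in s -> f != 0 /\ exists al : dual_space a, root_space At al f) ->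
  (forall x, x = \sum_(f <- s) (cform f x / cform f f) *: f) ->
  is_root At al -> exists2 f, f \in s & forall Y, Y \in a -> bracket Y f = deval al Y *: f.
Proof.
move=> Hs Es [_ [X [rX X0]]].
have [Dl Zl Dr Zr] := cform_bilinear At theta.
have [f fs fX] : exists2 f, f \in s & cform f X != 0.
  apply: contrapT => N; move: X0; rewrite (Es X) big_seq big1 ?eqxx // => f fs.
  have [->|e] := eqVneq (cform f X) 0; first by rewrite mul0r scale0r.
  by case: N; exists f.
exists f => // Y Ya; have [f0 [be rf]] := Hs f fs.
rewrite (rf Y Ya); congr (_ *: _).
have := cform_ad G_lie theta_cartan f X (a_p Ya).
by rewrite (rf Y Ya) (rX Y Ya) Zl Zr => /(mulIf fX).
Qed.

Lemma ltn_count (T : eqType) (p q : pred T) (s : seq T) x :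
  subpred p q -> x \in s -> q x -> ~~ p x -> (count p s < count q s)%N.
Proof.
move=> pq; elim: s => //= y s IH; rewrite inE => /predU1P[<-|xs] qx npx.
  by rewrite qx (negbTE npx) add0n add1n ltnS; exact: sub_count.
apply: leq_ltn_trans (_ : _ <= q y + count p s)%N _.
  by rewrite leq_add2r; case: (p y) (pq y) => // ->.
by rewrite ltn_add2l; exact: IH.
Qed.

(** A positive root that is not simple is a sum of two positive roots, both smaller at [Z0], and
    descent ends at simple roots. Negative roots are handled through their opposites. *)
Lemma root_value_bound (C : set V) (c : R) X : is_open_chamber At a C ->
  (forall al : dual_space a, simple_root At C al -> c <= deval al X) -> 0 <= c ->
  forall al : dual_space a, is_root At al -> c <= `|deval al X|.
Proof.
move=> [Z0 rZ0 CE] Hc c0.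
have CZ0 : C Z0 by rewrite CE; exact: connected_component_refl.
have Creg Y : C Y -> regular_set At a Y.
  by rewrite CE; exact: connected_component_sub.
have Cconn : connected C by rewrite CE; exact: component_connected.
have [s [Hs Es]] := ad_eigenlist.
have pos (al : dual_space a) : positive_root At C al -> c <= deval al X.
  have Za : Z0 \in a by case: rZ0.
  pose ev (f : V) := cform f (bracket Z0 f) / cform f f.
  have evE f (be : dual_space a) : f \in s -> bracket Z0 f = deval be Z0 *: f -> ev f = deval be Z0.
    move=> fs e; rewrite /ev e; have [_ _ _ Zr] := cform_bilinear At theta.
    by rewrite Zr mulfK // lt0r_neq0 // (cform_gt0 theta_cartan) //; case: (Hs f fs).
  (* The descent is measured by the number of listed eigenvectors whose value at [Z0] is below that
     of [al]. A summand of [al] occurs in the list by [root_finite], so the count drops strictly. *)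
  pose N (al : dual_space a) := count (fun f => ev f < deval al Z0) s.
  have [k] := ubnP (N al); elim: k al => // k IH al Nk pal.
  have [simp|nsimp] := pselect (simple_root At C al); first exact: Hc.
  have [be [ga [pb pg e]]] : exists be ga, [/\ positive_root At C be, positive_root At C ga & al = be + ga].
    by apply: contrapT => h; apply: nsimp.
  have lt_N (b g : dual_space a) : positive_root At C b -> positive_root At C g -> al = b + g -> (N b < N al)%N.
    move=> pb' pg' e'; have [f fs ef] := root_finite Hs Es pb'.1.
    have evf := evE f b fs (ef Z0 Za).
    have g0 := pg'.2 Z0 CZ0.
    apply: (@ltn_count _ _ _ _ f) => //.
    - by move=> h /= hb; apply: lt_trans hb _; rewrite e' devalD ltrDl.
    - by rewrite /= evf e' devalD ltrDl.
    - by rewrite /= evf ltxx.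
  have hb : c <= deval be X.
    by apply: IH => //; rewrite -ltnS; apply: leq_trans Nk; rewrite ltnS; exact: lt_N pb pg e.
  have hg : c <= deval ga X.
    apply: IH => //; rewrite -ltnS; apply: leq_trans Nk; rewrite ltnS.
    by apply: lt_N pg pb _; rewrite addrC.
  by rewrite e devalD; apply: le_trans hb _; rewrite lerDl (le_trans c0 hg).
move=> al ral.
(* A root does not vanish on the connected set [C], so it keeps the sign that it has at [Z0]. *)
have cst_sign (be : dual_space a) : is_root At be -> 0 < deval be Z0 -> positive_root At C be.
  move=> rb b0; split=> // Y CY.
  have conn : connected (deval be @` C).
    apply: connected_continuous_connected => //.
    by apply: continuous_subspaceT; exact: deval_continuous.
  rewrite ltNge; apply/negP => bY.
  have /(_ (deval be Y) (deval be Z0)) := (connected_intervalP _).1 conn.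
  move=> /(_ (ex_intro2 _ _ Y CY erefl) (ex_intro2 _ _ Z0 CZ0 erefl) 0).
  rewrite bY (ltW b0) => /(_ isT) [Y' CY' e0].
  by have := (Creg Y' CY').2 be rb; rewrite e0 eqxx.
have : deval al Z0 != 0 by have := (Creg Z0 CZ0).2 al ral.
rewrite neq_lt => /orP[neg|pos0].
  have := pos (- al) (cst_sign (- al) (root_opp ral) _).
  by rewrite !devalN oppr_gt0 => /(_ neg) h; apply: le_trans h _; rewrite -normrN ler_norm.
by apply: le_trans (ler_norm _); apply: pos; exact: cst_sign.
Qed.

End Roots.

(** * The tangent decomposition *)

(* Here [z = 1 / (e^t - e e^-t)] and [u = - z e e^-t], with [e = 1] or [-1]. *)
Lemma hyperbolic_coefficients (R : realType) (c t e : R) : 0 < c -> c <= `|t| ->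
  `|e| = 1 ->
  let K := (1 - expR (- (2 * c)))^-1 in
  exists u z, [/\ u + z * expR t = 1, u + z * (e * expR (- t)) = 0, `|u| <= K, `|z| <= K &
     `|z * expR t| <= K /\ `|z * (e * expR (- t))| <= K].
Proof.
move=> c0 ct e1 K.
have k0 : 0 < 1 - expR (- (2 * c)) by rewrite subr_gt0 -expR0 ltr_expR oppr_lt0 mulr_gt0.
pose E := expR `|t|; pose d := expR t - e * expR (- t).
have E0 : 0 < E by exact: expR_gt0.
(* The reverse triangle inequality leaves [e^|t| - e^-|t|], and [|t| >= c] extracts the factor.
   Dividing by [d] thus absorbs any exponential up to [e^|t|]. *)
have dE : E * (1 - expR (- (2 * c))) <= `|d|.
  have h1 : E - expR (- `|t|) <= `|d|.
    rewrite /d /E; have [t0|t0] := leP 0 t.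
      rewrite (ger0_norm t0); apply: le_trans (lerB_dist _ _).
      by rewrite normrM e1 mul1r !ger0_norm ?expR_ge0.
    rewrite (ltr0_norm t0) opprK -normrN opprB; apply: le_trans (lerB_dist _ _).
    by rewrite normrM e1 mul1r !ger0_norm ?expR_ge0.
  apply: le_trans h1; rewrite mulrBr mulr1 lerD2l lerN2 /E -expRD ler_expR; lra.
have d0 : d != 0 by rewrite -normr_gt0; apply: lt_le_trans dE; rewrite mulr_gt0.
have zE : `|d^-1| * E <= K.
  by rewrite normfV ler_pdivrMl ?normr_gt0 // /K ler_pdivlMr // mulrC.
have zb x : 0 < x -> x <= E -> `|d^-1| * x <= K.
  by move=> x0 xE; apply: le_trans zE; rewrite ler_wpM2l.
have tE : expR t <= E by rewrite ler_expR ler_norm.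
have tE' : expR (- t) <= E by rewrite ler_expR -normrN ler_norm.
have oE : 1 <= E by rewrite -expR0 ler_expR.
have b2 : `|d^-1 * (e * expR (- t))| <= K.
  rewrite !normrM e1 mul1r (ger0_norm (expR_ge0 _)).
  by apply: zb => //; exact: expR_gt0.
exists (- (d^-1 * (e * expR (- t)))), d^-1; split.
- have -> : - (d^-1 * (e * expR (- t))) + d^-1 * expR t = d^-1 * d by rewrite /d; ring.
  by rewrite mulVf.
- by rewrite addNr.
- by rewrite normrN.
- by rewrite -[`|_|]mulr1; exact: zb.
- split=> //; rewrite normrM (ger0_norm (expR_ge0 _)).
  by apply: zb => //; exact: expR_gt0.
Qed.

Section Decomposition.
Context {R : realType} {n : nat} {G : topologicalGroupType}.
Variable At : atlas 'rV[R]_n G.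
Hypothesis G_lie : is_lie_group At.
Variables (sigma theta : G -> G).
Hypothesis sigma_inv : is_involution At sigma.
Hypothesis theta_cartan : is_cartan_involution At theta.
Hypothesis theta_sigma : forall x, theta (sigma x) = sigma (theta x).
Local Notation V := 'rV[R]_n.
Local Notation bracket := (bracket At).
Local Notation Ad := (Ad At).
Local Notation gexp := (gexp At).
Local Notation dth := (differential At theta).
Local Notation dsg := (differential At sigma).
Variable a : {vspace V}.
Hypothesis a_max : maximal_abelian_subspace At
  (minus_eigenspace At theta `&` minus_eigenspace At sigma) a.
Implicit Types (X Y Z : V).

Let theta_inv : is_involution At theta. Proof. by case: theta_cartan. Qed.

Lemma involution1 (s : G -> G) : is_involution At s -> s 1%g = 1%g.
Proof. by move=> [_ sM _]; apply: (@mulgI _ (s 1%g)); rewrite -sM !mulg1. Qed.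

Lemma differential_commute X : dth (dsg X) = dsg (dth X).
Proof.
have [ts _ _] := theta_inv; have [ss _ _] := sigma_inv.
have mt := mdiff_smooth G_lie 1%g ts; have ms := mdiff_smooth G_lie 1%g ss.
have t1 := involution1 theta_inv; have s1 := involution1 sigma_inv.
have [_ e1] := mdiff_comp (lie_chart G_lie _) (lie_chart G_lie _) ms (mdiff_smooth G_lie _ ts).
have [_ e2] := mdiff_comp (lie_chart G_lie _) (lie_chart G_lie _) mt (mdiff_smooth G_lie _ ss).
have e : theta \o sigma = sigma \o theta by apply/funext.
move: e1 e2; rewrite e s1 t1 => -> /(congr1 (@^~ X)) /= h; exact: h.
Qed.

Lemma amax_p X : X \in a -> dth X = - X.
Proof. by move=> Xa; have [[H _] _] := a_max; have [h _] := H X Xa; exact: h. Qed.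

Lemma amax_q X : X \in a -> dsg X = - X.
Proof. by move=> Xa; have [[H _] _] := a_max; have [_ h] := H X Xa; exact: h. Qed.

Lemma amax_abelian X Y : X \in a -> Y \in a -> bracket X Y = 0.
Proof. by move=> Xa Ya; have [[_ H] _] := a_max; exact: H. Qed.

(** The span of [a] and [X] is abelian and lies in the same eigenspaces, so it equals [a]. *)
Lemma amax_maximal X : dth X = - X -> dsg X = - X ->
  (forall Y, Y \in a -> bracket Y X = 0) -> X \in a.
Proof.
move=> tX sX aX.
have [_ /(_ (a + <[X]>)%VS)] := a_max.
have : abelian_subspace At (minus_eigenspace At theta `&` minus_eigenspace At sigma) (a + <[X]>)%VS.
  split=> [Z /memv_addP [Y Ya [_ /vlineP [k ->] ->]]|].
    split; rewrite /minus_eigenspace /= differentialD differentialZ.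
      by rewrite amax_p // tX scalerN opprD.
    by rewrite amax_q // sX scalerN opprD.
  move=> _ _ /memv_addP [Y Ya [_ /vlineP [k ->] ->]] /memv_addP [Y' Ya' [_ /vlineP [k' ->] ->]].
  rewrite bracketDl !(bracketDr G_lie) !bracketZl !(bracketZr G_lie).
  rewrite (bracketXX G_lie) amax_abelian // aX // (bracketC G_lie X Y') aX //.
  by rewrite oppr0 !scaler0 !addr0.
move=> h /(_ h (addvSl _ _)) <-.
by rewrite memvE addvSr.
Qed.

(* The involution attached to [w H w^-1]. *)
Definition sgw (w : G) X := Ad w (dsg (Ad w^-1%g X)).

Variable w : G.
Hypothesis theta_w : theta w = w.
Hypothesis w_a : Ad w @` [set` a] = [set` a].

Lemma theta_wV : theta w^-1%g = w^-1%g.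
Proof.
have [_ tM _] := theta_inv.
by apply: (@mulgI _ w); rewrite -{1}theta_w -tM !mulgV (involution1 theta_inv).
Qed.

Lemma Ad_w_a X : X \in a -> Ad w X \in a.
Proof.
move=> Xa; have : [set` a] (Ad w X) by rewrite -w_a; exists X.
by [].
Qed.

Lemma Ad_wV_a X : X \in a -> Ad w^-1%g X \in a.
Proof.
move=> Xa; have : [set` a] X by [].
by rewrite -w_a => -[Y Ya <-]; rewrite (AdK G_lie).
Qed.

Lemma sgwK X : sgw w (sgw w X) = X.
Proof.
by rewrite /sgw (AdK G_lie) (differential_involution G_lie _ sigma_inv) (AdVK G_lie).
Qed.

Lemma sgwD X Y : sgw w (X + Y) = sgw w X + sgw w Y.
Proof. by rewrite /sgw AdD differentialD AdD. Qed.
Lemma sgwZ (k : R) X : sgw w (k *: X) = k *: sgw w X.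
Proof. by rewrite /sgw AdZ differentialZ AdZ. Qed.
Lemma sgw0 : sgw w 0 = 0.
Proof. by rewrite /sgw Ad0 differential0 Ad0. Qed.

Lemma sgwN X : sgw w (- X) = - sgw w X.
Proof. by rewrite -scaleN1r sgwZ scaleN1r. Qed.

Lemma sgw_a X : X \in a -> sgw w X = - X.
Proof.
by move=> Xa; rewrite /sgw amax_q ?Ad_wV_a // AdN (AdVK G_lie).
Qed.

Lemma sgw_dth X : dth (sgw w X) = sgw w (dth X).
Proof.
rewrite /sgw (involution_Ad G_lie _ _ theta_inv) theta_w differential_commute.
by rewrite (involution_Ad G_lie _ _ theta_inv) theta_wV.
Qed.

Lemma sgw_bracket X Y : sgw w (bracket X Y) = bracket (sgw w X) (sgw w Y).
Proof.
by rewrite /sgw (Ad_bracket G_lie) (involution_bracket G_lie _ _ sigma_inv) (Ad_bracket G_lie).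
Qed.

Lemma sgw_fixed X : sgw w X = X -> dsg (Ad w^-1%g X) = Ad w^-1%g X.
Proof. by move=> {2}<-; rewrite /sgw (AdK G_lie). Qed.

Lemma sgw_minus X : sgw w X = - X -> dsg (Ad w^-1%g X) = - Ad w^-1%g X.
Proof. by move=> e; rewrite -AdN -e /sgw (AdK G_lie). Qed.

Lemma bracket_dth X Y : X \in a -> bracket X (dth Y) = - dth (bracket X Y).
Proof.
move=> Xa; rewrite (involution_bracket G_lie _ _ theta_inv) (amax_p Xa).
by rewrite bracketNl opprK.
Qed.

Lemma bracket_sgw X Y : X \in a -> bracket X (sgw w Y) = - sgw w (bracket X Y).
Proof. by move=> Xa; rewrite sgw_bracket (sgw_a Xa) bracketNl opprK. Qed.

(** One constant for [dth], [dsg] and every [Ad k]. The exponents of [M] below bound the number of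
    such operators that an estimate passes through, [sgw w] counting for three. *)
Variable M : R.
Hypothesis M1 : 1 <= M.
Hypothesis M_dth : forall X, `|dth X| <= M * `|X|.
Hypothesis M_dsg : forall X, `|dsg X| <= M * `|X|.
Hypothesis M_Ad : forall k X, theta k = k -> `|Ad k X| <= M * `|X|.

Variable X1 : V.
Hypothesis X1_a : X1 \in a.

(* With [x = exp X1], this is the tangent form of [K A x w H]: the last summand
   is moved back across [x w]. *)
Definition decomposes (D : R) X U A Y :=
  [/\ dth U = U, A \in a, dsg Y = Y & X = U + A + Ad (gexp X1) (Ad w Y)] /\
  [/\ `|U| <= D, `|A| <= D, `|Y| <= D & `|Ad (gexp X1) (Ad w Y)| <= D].

Lemma decomposesD D D' X X' U U' A A' Y Y' :
  decomposes D X U A Y -> decomposes D' X' U' A' Y' ->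
  decomposes (D + D') (X + X') (U + U') (A + A') (Y + Y').
Proof.
move=> [[u a1 y e] [b1 b2 b3 b4]] [[u' a1' y' e'] [b1' b2' b3' b4']].
split; split.
- by rewrite differentialD u u'.
- exact: memvD.
- by rewrite differentialD y y'.
- by rewrite e e' !AdD; row_ring.
- by apply: le_trans (ler_normD _ _) _; exact: lerD.
- by apply: le_trans (ler_normD _ _) _; exact: lerD.
- by apply: le_trans (ler_normD _ _) _; exact: lerD.
- by rewrite !AdD; apply: le_trans (ler_normD _ _) _; exact: lerD.
Qed.

Lemma decomposesZ D X U A Y (k : R) : decomposes D X U A Y ->
  decomposes (`|k| * D) (k *: X) (k *: U) (k *: A) (k *: Y).
Proof.
move=> [[u a1 y e] [b1 b2 b3 b4]]; split; split.
- by rewrite differentialZ u.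
- exact: memvZ.
- by rewrite differentialZ y.
- by rewrite e !AdZ !scalerDr.
- by rewrite normrZ ler_wpM2l.
- by rewrite normrZ ler_wpM2l.
- by rewrite normrZ ler_wpM2l.
- by rewrite !AdZ normrZ ler_wpM2l.
Qed.

Lemma decomposes_le D D' X U A Y : D <= D' ->
  decomposes D X U A Y -> decomposes D' X U A Y.
Proof. by move=> le [h [b1 b2 b3 b4]]; split=> //; split; apply: le_trans le. Qed.

Let M0 : 0 <= M. Proof. by apply: le_trans M1. Qed.

Lemma sgw_le X : `|sgw w X| <= M ^+ 3 * `|X|.
Proof.
apply: le_trans (M_Ad _ theta_w) _; rewrite exprS -mulrA ler_wpM2l //.
apply: le_trans (M_dsg _) _; rewrite exprS -mulrA ler_wpM2l //.
by rewrite expr1; apply: M_Ad; exact: theta_wV.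
Qed.

Lemma half_sum_le X Y (D B : R) : `|X| <= D -> `|Y| <= B -> D <= B ->
  `|2^-1 *: (X + Y)| <= B.
Proof.
move=> h1 h2 h3; rewrite normrZ ger0_norm ?invr_ge0 //.
have := ler_normD X Y; lra.
Qed.

Lemma M_exp_le (i j : nat) (x : R) : 0 <= x -> (i <= j)%N -> M ^+ i * x <= M ^+ j * x.
Proof. by move=> x0 ij; rewrite ler_wpM2r // ler_weXn2l. Qed.

(* The symmetric part of [X] splits under [sgw w]; by maximality of [a], the part
   on which [sgw w] is [-1] lies in [Ad w a = a]. *)
Lemma decompose_centralizer X : (forall Y, Y \in a -> bracket Y X = 0) ->
  exists U A Y, decomposes (M ^+ 5 * `|X|) X U A Y.
Proof.
move=> aX.
have nX : 0 <= `|X| by [].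
have e0 : `|X| = M ^+ 0 * `|X| by rewrite expr0 mul1r.
pose Xp := 2^-1 *: (X + - dth X).
have aXp Y : Y \in a -> bracket Y Xp = 0.
  move=> Ya; rewrite (bracketZr G_lie) (bracketDr G_lie) (bracketNr G_lie).
  by rewrite bracket_dth // aX // differential0 !oppr0 addr0 scaler0.
have tXp : dth Xp = - Xp.
  rewrite differentialZ differentialD differentialN (dthK G_lie theta_cartan).
  by rewrite /Xp; row_ring.
have bXp : `|Xp| <= M ^+ 1 * `|X|.
  apply: (half_sum_le (D := `|X|)) => //; first by rewrite normrN expr1.
  by rewrite {1}e0 M_exp_le.
pose A := 2^-1 *: (Xp + - sgw w Xp); pose Z := 2^-1 *: (Xp + sgw w Xp).
have bs : `|sgw w Xp| <= M ^+ 4 * `|X|.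
  apply: le_trans (sgw_le _) _; rewrite (exprD M 3 1) -mulrA ler_wpM2l ?exprn_ge0 //.
have bA : `|A| <= M ^+ 4 * `|X|.
  by apply: (half_sum_le bXp); rewrite ?normrN // M_exp_le.
have bZ : `|Z| <= M ^+ 4 * `|X| by apply: (half_sum_le bXp) => //; rewrite M_exp_le.
have aS Y : Y \in a -> bracket Y (sgw w Xp) = 0.
  by move=> Ya; rewrite bracket_sgw // aXp // sgw0 oppr0.
have aA Y : Y \in a -> bracket Y A = 0.
  move=> Ya; rewrite (bracketZr G_lie) (bracketDr G_lie) (bracketNr G_lie).
  by rewrite aXp // aS // oppr0 addr0 scaler0.
have tA : dth A = - A.
  rewrite differentialZ differentialD differentialN sgw_dth tXp sgwN.
  by rewrite /A; row_ring.
have sA : sgw w A = - A.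
  by rewrite sgwZ sgwD sgwN sgwK /A; row_ring.
have Aa : A \in a.
  rewrite -(AdVK G_lie w A); apply: Ad_w_a; apply: amax_maximal.
  - by rewrite (involution_Ad G_lie _ _ theta_inv) theta_wV tA AdN.
  - exact: sgw_minus.
  - move=> Y Ya; rewrite -(AdK G_lie w Y) -(Ad_bracket G_lie) aA ?Ad0 //.
    exact: Ad_w_a.
have sZ : sgw w Z = Z by rewrite sgwZ sgwD sgwK addrC.
(* [X] is its [theta]-fixed half plus [A + Z]. As [Z] commutes with [X1], [Ad (gexp X1)] leaves it
   unchanged, and only [Ad w] has to be undone. *)
exists (2^-1 *: (X + dth X)), A, (Ad w^-1%g Z).
have eZ : Ad (gexp X1) (Ad w (Ad w^-1%g Z)) = Z.
  rewrite (AdVK G_lie) (Ad_gexp_fixed G_lie) //.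
  by rewrite (bracketZr G_lie) (bracketDr G_lie) aXp // aS // addr0 scaler0.
split; split.
- by rewrite differentialZ differentialD (dthK G_lie theta_cartan) addrC.
- exact: Aa.
- exact: sgw_fixed.
- rewrite eZ /A /Z /Xp; apply/rowP => j; rewrite !mxE; by field.
- apply: (half_sum_le (D := `|X|)) => //.
    by apply: le_trans (M_dth _) _; rewrite -[X in X * _]expr1 M_exp_le.
  by rewrite {1}e0 M_exp_le.
- by apply: le_trans bA _; rewrite M_exp_le.
- apply: le_trans (M_Ad _ theta_wV) _; rewrite exprS -mulrA ler_wpM2l //.
- by rewrite eZ; apply: le_trans bZ _; rewrite M_exp_le.
Qed.

(* On each half of [X = X_+ + X_-], where [sgw w x = e theta x], combine
   [x + theta x] and [Ad x1 (x + sgw w x) = e^t x + e e^-t theta x]. *)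
Lemma decompose_eigen (c t : R) X : 0 < c -> c <= `|t| -> bracket X1 X = t *: X ->
  let K := (1 - expR (- (2 * c)))^-1 in
  exists U A Y, decomposes (4 * K * (M ^+ 8 * `|X|)) X U A Y.
Proof.
move=> c0 ct eX K.
have nX : 0 <= `|X| by [].
have K0 : 0 <= K.
  have [u [z [_ _ h _ _]]] := hyperbolic_coefficients (e := 1) c0 ct (normr1 _).
  exact: le_trans h.
(* Both [dth] and [sgw w] carry the eigenvalue [t] to [- t]. Their product is an involution
   preserving the eigenspace of [t], and [e] ranges over its two eigenvalues. *)
have H (e : R) : e = 1 \/ e = -1 ->
  exists U A Y, decomposes (2 * K * (M ^+ 8 * `|X|)) (2^-1 *: (X + e *: dth (sgw w X))) U A Y.
  move=> e1.
  have ne : `|e| = 1 by case: e1 => ->; rewrite ?normrN normr1.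
  have ee : e * e = 1 by case: e1 => ->; rewrite ?mulrNN mulr1.
  have [u [z [E1 E2 bu bz [bz1 bz2]]]] := hyperbolic_coefficients (e := e) c0 ct ne.
  set x := 2^-1 *: _.
  have bx : `|x| <= M ^+ 4 * `|X|.
    apply: (half_sum_le (D := `|X|)) => //.
      rewrite normrZ ne mul1r; apply: le_trans (M_dth _) _.
      by rewrite exprS -mulrA ler_wpM2l // sgw_le.
    by rewrite -{1}(mul1r `|X|) -(expr0 M) M_exp_le.
  have btx : `|dth x| <= M ^+ 5 * `|X|.
    by apply: le_trans (M_dth _) _; rewrite exprS -mulrA ler_wpM2l.
  have bsx : `|sgw w x| <= M ^+ 7 * `|X|.
    apply: le_trans (sgw_le _) _; rewrite (exprD M 3 4) -mulrA ler_wpM2l ?exprn_ge0 //.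
  have X1x : bracket X1 x = t *: x.
    rewrite (bracketZr G_lie) (bracketDr G_lie) (bracketZr G_lie) bracket_dth //.
    rewrite bracket_sgw // eX sgwZ differentialN differentialZ opprK.
    by rewrite /x; apply/rowP => j; rewrite !mxE; ring.
  have X1tx : bracket X1 (dth x) = (- t) *: dth x.
    by rewrite bracket_dth // X1x differentialZ scaleNr.
  have sx : sgw w x = e *: dth x.
    rewrite /x sgwZ sgwD sgwZ -sgw_dth sgwK differentialZ differentialD differentialZ.
    rewrite (dthK G_lie theta_cartan).
    transitivity (2^-1 *: ((e * e) *: sgw w X + e *: dth X)); first by rewrite ee scale1r.
    by row_ring.
  exists (u *: (x + dth x)), 0, (z *: Ad w^-1%g (x + sgw w x)).
  have eZ : Ad (gexp X1) (Ad w (z *: Ad w^-1%g (x + sgw w x))) =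
      (z * expR t) *: x + (z * (e * expR (- t))) *: dth x.
    rewrite AdZ (AdVK G_lie) AdZ AdD sx AdZ (Ad_gexp_eigen G_lie X1x).
    by rewrite (Ad_gexp_eigen G_lie X1tx) scalerDr !scalerA -!mulrA.
  have M47 : M ^+ 4 * `|X| <= M ^+ 7 * `|X| by rewrite M_exp_le.
  have M57 : M ^+ 5 * `|X| <= M ^+ 7 * `|X| by rewrite M_exp_le.
  have M78 : M ^+ 7 * `|X| <= M ^+ 8 * `|X| by rewrite M_exp_le.
  have two (p q : V) (k l : R) : `|k| <= K -> `|l| <= K -> `|p| <= M ^+ 7 * `|X| ->
      `|q| <= M ^+ 7 * `|X| -> `|k *: p + l *: q| <= 2 * K * (M ^+ 7 * `|X|).
    move=> hk hl hp hq; apply: le_trans (ler_normD _ _) _; rewrite !normrZ.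
    have -> : 2 * K * (M ^+ 7 * `|X|) = K * (M ^+ 7 * `|X|) + K * (M ^+ 7 * `|X|) by ring.
    by apply: lerD; apply: ler_pM.
  have M8 : 2 * K * (M ^+ 7 * `|X|) <= 2 * K * (M ^+ 8 * `|X|).
    by rewrite ler_wpM2l // mulr_ge0.
  split; split.
  - by rewrite differentialZ differentialD (dthK G_lie theta_cartan) addrC.
  - exact: mem0v.
  - rewrite differentialZ sgw_fixed // sgwD sgwK addrC //.
  - rewrite eZ; transitivity ((u + z * expR t) *: x + (u + z * (e * expR (- t))) *: dth x).
      by rewrite E1 E2 scale1r scale0r addr0.
    by row_ring.
  - rewrite scalerDr; apply: le_trans M8.
    exact: (two _ _ _ _ bu bu (le_trans bx M47) (le_trans btx M57)).
  - by rewrite normr0 !mulr_ge0 // exprn_ge0.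
  - rewrite normrZ; have hw : `|Ad w^-1%g (x + sgw w x)| <= M * (2 * (M ^+ 7 * `|X|)).
      apply: le_trans (M_Ad _ theta_wV) _; rewrite ler_wpM2l //.
      by apply: le_trans (ler_normD _ _) _; move: bx bsx M47; lra.
    have -> : 2 * K * (M ^+ 8 * `|X|) = K * (M * (2 * (M ^+ 7 * `|X|))) by rewrite exprS; ring.
    by apply: ler_pM.
  - rewrite eZ; apply: le_trans M8.
    exact: (two _ _ _ _ bz1 bz2 (le_trans bx M47) (le_trans btx M57)).
have [U [A [Y d1]]] := H 1 (or_introl erefl).
have [U' [A' [Y' d2]]] := H (-1) (or_intror erefl).
exists (U + U'), (A + A'), (Y + Y').
have := decomposesD d1 d2.
have -> : 2^-1 *: (X + 1 *: dth (sgw w X)) + 2^-1 *: (X + -1 *: dth (sgw w X)) = X.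
  by apply/rowP => j; rewrite !mxE; by field.
by apply: decomposes_le; lra.
Qed.

End Decomposition.

(** * The local decomposition *)

Lemma quad_diff_strict (R : realType) (V W : normedModType R) (f : V -> W) x0 L C r e :
  quad_diff f x0 L C r -> 0 < e -> exists2 d, 0 < d & forall x y,
    `|x - x0| <= d -> `|y - x0| <= d -> `|f x - f y - L (x - y)| <= e * `|x - y|.
Proof.
move=> [C0 r0 q] e0; exists (Num.min r (e / C)); first by rewrite lt_min r0 divr_gt0.
move=> x y hx hy; apply: le_trans (q _ x y _ hx hy) _; first by rewrite ge_min lexx.
by rewrite ler_wpM2r // mulrC -ler_pdivlMr // ge_min lexx orbT.
Qed.

Section LocalProduct.
Context {R : realType} {n : nat} {G : topologicalGroupType}.
Variable At : atlas 'rV[R]_n G.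
Hypothesis G_lie : is_lie_group At.
Local Notation V := 'rV[R]_n.
Local Notation dom := (cdom (At 1%g)).
Local Notation gexp := (gexp At).
Local Notation mulc := (mulc At).
Local Notation lpsi := (lpsi At).
Local Notation lphi := (lphi At).

(** The norm of a pair is the maximum, so one [b] bounds both increments. The domain clauses allow
    coordinates to be turned back into group elements. *)
Lemma mulc_strict (e : R) : 0 < e -> exists2 d, 0 < d & forall u u' v v' : V,
  `|u| <= d -> `|u'| <= d -> `|v| <= d -> `|v'| <= d -> forall b,
  `|u - u'| <= b -> `|v - v'| <= b ->
  [/\ mulc_dom At (u, v), mulc_dom At (u', v') &
     `|mulc (u, v) - mulc (u', v') - ((u - u') + (v - v'))| <= e * b].
Proof.
move=> e0; have hcV := @has_coordinates_rV R n.
have [C [r [q qU]]] := C2_quad_diff (has_coordinates_prod hcV hcV)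
  (mulc_dom_open G_lie) (mulc_dom0 G_lie) (mulc_smooth G_lie 2).
have [d d0 H] := quad_diff_strict q e0; have [_ r0 _] := q.
have nE (x y : V) (s : R) : `|x| <= s -> `|y| <= s -> `|(x, y) - (0 : V, 0 : V)| <= s.
  by move=> hx hy; rewrite subr0 prod_normE /= ge_max hx.
exists (Num.min d r); first by rewrite lt_min d0.
move=> u u' v v'; rewrite !le_min => /andP[hu1 hu2] /andP[hu1' hu2'] /andP[hv1 hv2] /andP[hv1' hv2'] b bu bv.
split; [exact: (qU _ (nE _ _ _ hu2 hv2))|exact: (qU _ (nE _ _ _ hu2' hv2'))|].
have := H (u, v) (u', v') (nE _ _ _ hu1 hv1) (nE _ _ _ hu1' hv1').
have [_ ->] := mulc_diff0 G_lie.
move=> h; apply: le_trans h _; rewrite ler_wpM2l //; first exact: ltW.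
by rewrite prod_normE /= ge_max bu.
Qed.

(** The radius depends on [D] only, so it serves every splitting with these Lipschitz bounds. The
    differential of the product at 0 would be [U + A + Z], the identity, and only increments of the
    three maps enter. *)
Lemma gexp_product_onto (D : R) : 1 <= D -> exists2 r, 0 < r & forall U A Z : V -> V,
  U 0 = 0 -> A 0 = 0 -> Z 0 = 0 -> (forall x, x = U x + A x + Z x) ->
  (forall x y, [/\ `|U x - U y| <= D * `|x - y|, `|A x - A y| <= D * `|x - y| &
    `|Z x - Z y| <= D * `|x - y|]) ->
  forall X, `|X| <= r -> exists2 x, `|x| <= 4 * `|X| &
    gexp X = (gexp (U x) * gexp (A x) * gexp (Z x))%g.
Proof.
move=> D1; have D0 : 0 < D by apply: lt_le_trans D1.
have w6 (t s d : R) : 0 < d -> t <= 2 * s -> 6 * s <= d -> t <= d / 3 by lra.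
have wF : 6 / 22 + (2 / 22 + (22^-1 + (22^-1 + 22^-1))) <= 2^-1 :> R by lra.
have w3 (d : R) : 0 < d -> d / 3 <= d by lra.
have w2 (t s d : R) : t <= 2 * s -> s <= d -> t <= 2 * d by lra.
have w2' (t s d : R) : 0 <= d -> t <= 2 * s -> s <= d -> t <= 6 * d by lra.
have wP (p s u v d b : R) : 0 <= b -> b <= d -> p <= 2 / 22 * b -> s <= u + v ->
  u <= 2 * d -> v <= 2 * d -> p + s <= 6 * d by lra.
have e0 : 0 < (22 * D)^-1 by rewrite invr_gt0 mulr_gt0.
(* Relative to [e * D], the outer product contributes an error 6, the inner product 2 and the three
   exponentials 1 each. The sum 11 must amount to [1 / 2], hence 22. *)
set e := (22 * D)^-1 in e0.
have e1 : e <= 1 by rewrite invf_le1 ?mulr_gt0 //; lra.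
have eD : e * D = 22^-1 by rewrite /e invfM -mulrA mulVf ?mulr1 // gt_eqF.
have [E [B [r1 [q _ E0 HE]]]] := gexp_local G_lie.
have [d1 d10 sE] := quad_diff_strict q e0; have [_ r10 _] := q.
have [d2 d20 sM] := mulc_strict e0.
pose rE := Num.min r1 d1; have rE0 : 0 < rE by rewrite lt_min r10.
have {}sE x y : `|x| <= rE -> `|y| <= rE -> `|E x - E y - (x - y)| <= e * `|x - y|.
  by rewrite !le_min => /andP[_ hx] /andP[_ hy]; apply: sE; rewrite subr0.
have {}HE x : `|x| <= rE -> [/\ gexp x = lpsi (E x), dom (lpsi (E x)) & lphi (lpsi (E x)) = E x].
  by rewrite le_min => /andP[hx _]; exact: HE.
have lE x y : `|x| <= rE -> `|y| <= rE -> `|E x - E y| <= 2 * `|x - y|.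
  move=> hx hy; rewrite -(subrK (x - y) (E x - E y)); apply: le_trans (ler_normD _ _) _.
  have := sE _ _ hx hy; have : e * `|x - y| <= `|x - y| by rewrite ler_piMl.
  lra.
pose r := Num.min (rE / D) (d2 / (6 * D)).
have r0 : 0 < r by rewrite lt_min !divr_gt0 // mulr_gt0.
(* With [|X| <= r / 4] the target [E X] has norm at most [r / 2], and the solution has norm at most
   [4 * |X| <= r]. *)
exists (Num.min rE (r / 4)); first by rewrite lt_min rE0 divr_gt0.
move=> U A Z U0 A0 Z0 EUAZ LUAZ X; rewrite le_min => /andP[XE Xr].
pose P x := mulc (E (U x), E (A x)); pose F x := mulc (P x, E (Z x)).
have small (T : V -> V) : T 0 = 0 -> (forall x y, `|T x - T y| <= D * `|x - y|) ->
    forall x, `|x| <= r -> `|T x| <= rE /\ 6 * `|T x| <= d2.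
  move=> T0 LT x; rewrite le_min !ler_pdivlMr ?mulr_gt0 // => /andP[h1 h2].
  by have := LT x 0; rewrite T0 !subr0 => h; split; move: h h1 h2; lra.
have sU := small U U0 (fun x y => let: And3 h _ _ := LUAZ x y in h).
have sA := small A A0 (fun x y => let: And3 _ h _ := LUAZ x y in h).
have sZ := small Z Z0 (fun x y => let: And3 _ _ h := LUAZ x y in h).
have rE00 : `|0 : V| <= rE by rewrite normr0 ltW.
have bE x : `|x| <= rE -> `|E x| <= 2 * `|x|.
  by move=> hx; have := lE x 0 hx rE00; rewrite E0 !subr0.
have m00 : mulc (0, 0) = 0 by rewrite /mulc /= (lpsi0 G_lie) mulg1 lphi1.
have z0 : `|0 : V| <= d2 by rewrite normr0 ltW.
have P0 : P 0 = 0 by rewrite /P U0 A0 E0 m00.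
have bP x : `|x| <= r -> `|P x| <= d2 /\ mulc_dom At (E (U x), E (A x)).
  move=> xr; have [hu1 hu2] := sU x xr; have [ha1 ha2] := sA x xr.
  have h1 := bE _ hu1; have h2 := bE _ ha1.
  have b1 : `|E (U x)| <= d2 / 3 by exact: w6 d20 h1 hu2.
  have b2 : `|E (A x)| <= d2 / 3 by exact: w6 d20 h2 ha2.
  have d3 : d2 / 3 <= d2 := w3 _ d20.
  have := sM _ _ _ _ (le_trans b1 d3) z0 (le_trans b2 d3) z0 (d2 / 3).
  rewrite m00 !subr0 => /(_ b1 b2) [dP _ h]; split=> //.
  rewrite -(subrK (E (U x) + E (A x)) (P x)); apply: le_trans (ler_normD _ _) _.
  have h3 := ler_normD (E (U x)) (E (A x)).
  have h4 : e * (d2 / 3) <= d2 / 3 by rewrite ler_piMl // divr_ge0 // ltW.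
  move: h h3 h4 b1 b2; lra.
have key x y : `|x| <= r -> `|y| <= r ->
    mulc_dom At (P x, E (Z x)) /\ `|F x - F y - (x - y)| <= 2^-1 * `|x - y|.
  move=> xr yr; have [LU LA LZ] := LUAZ x y.
  have [xu1 xu2] := sU x xr; have [xa1 xa2] := sA x xr; have [xz1 xz2] := sZ x xr.
  have [yu1 yu2] := sU y yr; have [ya1 ya2] := sA y yr; have [yz1 yz2] := sZ y yr.
  have [Px _] := bP x xr; have [Py _] := bP y yr.
  set b0 := `|x - y| in LU LA LZ *; have b00 : 0 <= b0 := normr_ge0 _.
  have lU := lE _ _ xu1 yu1; have lA := lE _ _ xa1 ya1; have lZ := lE _ _ xz1 yz1.
  have e2 : e * (2 * (D * b0)) = 2 / 22 * b0 by rewrite -eD; ring.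
  have e6 : e * (6 * (D * b0)) = 6 / 22 * b0 by rewrite -eD; ring.
  have tE (s : R) : s <= D * b0 -> e * s <= 22^-1 * b0.
    by move=> h; rewrite -eD -mulrA ler_wpM2l // ltW.
  have Db : b0 <= D * b0 by rewrite ler_peMl.
  have bxu := bE _ xu1; have bxa := bE _ xa1; have bxz := bE _ xz1.
  have byu := bE _ yu1; have bya := bE _ ya1; have byz := bE _ yz1.
  have w6' t s : t <= 2 * s -> 6 * s <= d2 -> t <= d2.
    by move=> h1 h2; exact: le_trans (w6 _ _ _ d20 h1 h2) (w3 _ d20).
  have [_ _ hP] := sM _ _ _ _ (w6' _ _ bxu xu2) (w6' _ _ byu yu2)
    (w6' _ _ bxa xa2) (w6' _ _ bya ya2) _ (w2 _ _ _ lU LU) (w2 _ _ _ lA LA).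
  have lP : `|P x - P y| <= 6 * (D * b0).
    rewrite -(subrK (E (U x) - E (U y) + (E (A x) - E (A y))) (P x - P y)).
    apply: le_trans (ler_normD _ _) _.
    move: hP; rewrite -/(P x) -/(P y) e2 => hP.
    exact: wP b00 Db hP (ler_normD _ _) (w2 _ _ _ lU LU) (w2 _ _ _ lA LA).
  have [dF _ hF] := sM _ _ _ _ Px Py (w6' _ _ bxz xz2) (w6' _ _ byz yz2) _ lP
    (w2' _ _ _ (le_trans b00 Db) lZ LZ).
  split=> //; move: hP hF; rewrite -/(P x) -/(P y) -/(F x) -/(F y) e2 e6 => hP hF.
  have sU' := le_trans (sE _ _ xu1 yu1) (tE _ LU).
  have sA' := le_trans (sE _ _ xa1 ya1) (tE _ LA).
  have sZ' := le_trans (sE _ _ xz1 yz1) (tE _ LZ).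
  have exy : x - y = (U x - U y) + ((A x - A y) + (Z x - Z y)).
    by rewrite {1}(EUAZ x) {1}(EUAZ y); row_ring.
  (* Telescoping isolates the errors of the outer product, of the inner product and of the three
     exponentials. *)
  have -> : F x - F y - (x - y) =
      (F x - F y - (P x - P y + (E (Z x) - E (Z y)))) +
      ((P x - P y - (E (U x) - E (U y) + (E (A x) - E (A y)))) +
      ((E (U x) - E (U y) - (U x - U y)) + ((E (A x) - E (A y) - (A x - A y)) +
       (E (Z x) - E (Z y) - (Z x - Z y))))).
    by rewrite exy; row_ring.
  have n5 (p1 p2 p3 p4 p5 : V) :
      `|p1 + (p2 + (p3 + (p4 + p5)))| <= `|p1| + (`|p2| + (`|p3| + (`|p4| + `|p5|))).
    by do 4![apply: le_trans (ler_normD _ _) _; rewrite lerD2l].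
  apply: le_trans (n5 _ _ _ _ _) _.
  apply: le_trans (lerD hF (lerD hP (lerD sU' (lerD sA' sZ')))) _.
  by rewrite -!mulrDl ler_wpM2r.
have F0 : F 0 = 0.
  by rewrite /F P0 Z0 E0 m00.
have [hX dX eX] := HE X XE.
have bX := bE X XE.
have [|x [bx Fx]] := small_perturbation_onto (y := E X) F0 (fun x y hx hy => (key x y hx hy).2).
  by rewrite ler_pdivlMr //; move: Xr bX; rewrite ler_pdivlMr //; lra.
have b4 : `|x| <= 4 * `|X| by move: bx bX; lra.
have xr : `|x| <= r by move: Xr b4; rewrite ler_pdivlMr //; lra.
exists x => //.
have [hu _] := sU x xr; have [ha _] := sA x xr; have [hz _] := sZ x xr.
have [-> _ _] := HE _ hu; have [-> _ _] := HE _ ha; have [-> _ _] := HE _ hz.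
have [_ _ d1' _ _] := mulc_domP G_lie (bP x xr).2.
have [_ _ d2' _ _] := mulc_domP G_lie (key x x xr xr).1.
rewrite hX -Fx /F /mulc (lphiK G_lie d2') /P /mulc (lphiK G_lie d1') //.
Qed.
End LocalProduct.

(** * A splitting uniform over the group elements involved *)

Section UniformDecomposition.
Context {R : realType} {n : nat} {G : topologicalGroupType}.
Variable At : atlas 'rV[R]_n G.
Hypothesis G_lie : is_lie_group At.
Variables (sigma theta : G -> G).
Hypothesis sigma_inv : is_involution At sigma.
Hypothesis theta_cartan : is_cartan_involution At theta.
Hypothesis theta_sigma : forall x, theta (sigma x) = sigma (theta x).
Local Notation V := 'rV[R]_n.
Local Notation Ad := (Ad At).
Variable a : {vspace V}.
Hypothesis a_max : maximal_abelian_subspace At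
  (minus_eigenspace At theta `&` minus_eigenspace At sigma) a.
Local Notation decomposes := (decomposes At sigma theta a).

Lemma decomposes_lincomb w X1 (s : seq V) (p : V -> V * V * V) (D k : V -> R) :
  (forall f, f \in s -> decomposes w X1 (D f) f (p f).1.1 (p f).1.2 (p f).2) ->
  decomposes w X1 (\sum_(f <- s) `|k f| * D f) (\sum_(f <- s) k f *: f)
    (\sum_(f <- s) k f *: (p f).1.1) (\sum_(f <- s) k f *: (p f).1.2)
    (\sum_(f <- s) k f *: (p f).2).
Proof.
elim: s => [_|f s IH Hs].
  rewrite !big_nil; split; split; rewrite ?Ad0 ?differential0 ?normr0 ?addr0 //.
  exact: mem0v.
rewrite !big_cons; apply: decomposesD; first by apply: decomposesZ; apply: Hs; exact: mem_head.
by apply: IH => g gs; apply: Hs; rewrite inE gs orbT.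
Qed.

Lemma differential_bounded s : exists2 M, 0 < M & forall X, `|differential At s X| <= M * `|X|.
Proof.
pose L : {linear V -> V} := HB.pack (differential At s)
  (GRing.isLinear.Build _ _ _ _ _ (differential_is_linear At s)).
exact: (linear_bound (@rV_linear_continuous _ _ _ L)).
Qed.

Lemma cform_bounded f : exists M, forall X, `|cform At theta f X / cform At theta f f| <= M * `|X|.
Proof.
have [Dl Zl Dr Zr] := cform_bilinear At theta.
have lin : linear (cform At theta f : V -> R^o) by move=> k X Y; rewrite Dr Zr.
pose L : {linear V -> R^o} := HB.pack (cform At theta f : V -> R^o)
  (GRing.isLinear.Build _ _ _ _ _ lin).
have [M M0 H] := linear_bound (@rV_linear_continuous _ _ _ L).
exists (M * `|(cform At theta f f)^-1|) => X.
by rewrite normrM mulrAC ler_wpM2r //; exact: H.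
Qed.

(** The eigenlist depends on [a] alone and is fixed before [w] and [X1]. Its vectors are split one
    by one and the splittings combined with the coordinates of [X], which are linear in [X]:
    differences therefore decompose as well. *)
Lemma uniform_decomposition (C : set V) (c : R) : is_open_chamber At a C -> 0 < c ->
  exists2 D, 1 <= D & forall w X1, theta w = w -> Ad w @` [set` a] = [set` a] -> X1 \in a ->
    (forall al : dual_space a, simple_root At C al -> c <= deval al X1) ->
    exists U A Y : V -> V, [/\ U 0 = 0, A 0 = 0, Y 0 = 0 &
      forall X X', decomposes w X1 (D * `|X - X'|) (X - X') (U X - U X') (A X - A X') (Y X - Y X')].
Proof.
move=> HC c0.
have ap := amax_p a_max; have aa := amax_abelian a_max.
have [s [Hs Es]] := ad_eigenlist G_lie theta_cartan ap aa.
have [M1 M10 H1] := differential_bounded theta.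
have [M2 M20 H2] := differential_bounded sigma.
have [M3 M30 H3] := Ad_fixed_bounded G_lie theta_cartan.
pose M : R := 1 + M1 + M2 + M3.
have M_1 : 1 <= M by rewrite /M; lra.
have MM (t : R) (X : V) : t <= M -> t * `|X| <= M * `|X| by move=> h; rewrite ler_wpM2r.
have {}H1 X : `|differential At theta X| <= M * `|X|.
  by apply: le_trans (H1 X) (MM _ _ _); rewrite /M; lra.
have {}H2 X : `|differential At sigma X| <= M * `|X|.
  by apply: le_trans (H2 X) (MM _ _ _); rewrite /M; lra.
have {}H3 k X : theta k = k -> `|Ad k X| <= M * `|X|.
  by move=> tk; apply: le_trans (H3 k X tk) (MM _ _ _); rewrite /M; lra.
pose K := (1 - expR (- (2 * c)))^-1.
(* The first entry serves vectors centralizing [a], the second those with a nonzero root. *)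
pose B (f : V) := Num.max (M ^+ 5 * `|f|) (4 * K * (M ^+ 8 * `|f|)).
have B0 f : 0 <= B f by rewrite le_max mulr_ge0 // exprn_ge0 //; lra.
have [N HN] := choice cform_bounded.
exists (1 + \sum_(f <- s) `|N f| * B f).
  by rewrite lerDl big_seq sumr_ge0 // => f _; rewrite mulr_ge0.
move=> w X1 tw wa X1a X1c.
(* For [f] outside the list the triple is a dummy, so that [choice] can range over all of [V]. *)
have Hf f : exists p : V * V * V,
    f \in s -> decomposes w X1 (B f) f p.1.1 p.1.2 p.2.
  have [fs|nfs] := boolP (f \in s); last by exists (0, 0, 0).
  have [f0 [al ral]] := Hs f fs.
  have [al0|al0] := eqVneq al 0.
    have aX Y : Y \in a -> bracket At Y f = 0.
      by move=> Ya; rewrite ral // al0 /deval lfunE scale0r.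
    have [U [A [Y d]]] := decompose_centralizer G_lie sigma_inv theta_cartan theta_sigma a_max
      tw wa M_1 H1 H2 H3 X1a aX.
    by exists (U, A, Y) => _; apply: decomposes_le d; rewrite le_max lexx.
  have ral' : is_root At al by split=> //; exists f.
  have ct := root_value_bound G_lie theta_cartan ap aa HC X1c (ltW c0) ral'.
  have [U [A [Y d]]] := decompose_eigen G_lie sigma_inv theta_cartan theta_sigma a_max
      tw wa M_1 H1 H2 H3 X1a c0 ct (ral _ X1a).
  by exists (U, A, Y) => _; apply: decomposes_le d; rewrite le_max lexx orbT.
have [p Hp] := choice Hf.
pose k X f := cform At theta f X / cform At theta f f.
pose comb (q : V -> V) X := \sum_(f <- s) k X f *: q f.
have [Dl Zl Dr Zr] := cform_bilinear At theta.
have kB X X' f : k X f - k X' f = k (X - X') f.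
  by rewrite /k -mulrBl -(scaleN1r X') Dr Zr mulN1r.
have combB q X X' : comb q X - comb q X' = \sum_(f <- s) k (X - X') f *: q f.
  by rewrite /comb -sumrB; apply: eq_bigr => f _; rewrite -scalerBl kB.
have comb0 q : comb q 0 = 0.
  rewrite /comb big1 // => f _.
  by have := kB 0 0 f; rewrite !subrr => <-; rewrite scale0r.
exists (comb (fun f => (p f).1.1)), (comb (fun f => (p f).1.2)), (comb (fun f => (p f).2)).
split; [exact: comb0|exact: comb0|exact: comb0|move=> X X'].
have d := decomposes_lincomb (k (X - X')) Hp.
have eX : \sum_(f <- s) k (X - X') f *: f = X - X' by rewrite /k -Es.
rewrite !combB; rewrite eX in d; apply: decomposes_le d.
rewrite mulrDl mul1r mulr_suml; apply: ler_wpDl; first exact: normr_ge0.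
apply: ler_sum => f _; rewrite mulrAC; apply: ler_wpM2r; first exact: B0.
by apply: le_trans (HN f _) _; apply: ler_wpM2r; [exact: normr_ge0|exact: ler_norm].
Qed.

End UniformDecomposition.

Section FixedPoints.
Context {R : realType} {n : nat} {G : topologicalGroupType}.
Variable At : atlas 'rV[R]_n G.
Hypothesis G_lie : is_lie_group At.
Variable s : G -> G.
Hypothesis s_inv : is_involution At s.
Local Notation gexp := (gexp At).

Lemma gexp_fixed X : differential At s X = X -> s (gexp X) = gexp X.
Proof.
have [ss sM _] := s_inv => sX.
by rewrite (gexp_map G_lie X (mdiff_smooth G_lie 1%g ss) sM) sX.
Qed.

(** The line through [Y] gives a connected set of fixed points containing the identity. The
    component matters because only the identity component of [H] is tied to [sigma]. *)
Lemma gexp_fixed_component Y : differential At s Y = Y ->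
  connected_component (fixed_group s) 1%g (gexp Y).
Proof.
move=> sY; exists ((fun t : R => gexp (t *: Y)) @` [set: R]); last first.
  by exists 1; [exact: I|rewrite scale1r].
split.
- by exists 0; [exact: I|rewrite scale0r (gexp0 G_lie)].
- by move=> _ [t _ <-]; apply: gexp_fixed; rewrite differentialZ sY.
apply: connected_continuous_connected; first by apply/connected_intervalP => x y _ _ z _.
apply: continuous_subspaceT; exact: (gexp_line_continuous G_lie).
Qed.

End FixedPoints.

Theorem theorem1p2 (R : realType) (n : nat) (G : topologicalGroupType)
    (At : atlas 'rV[R]_n G)
    (G_lie : is_lie_group At)
    (G_connected : connected [set: G])
    (G_noncompact : ~ compact [set: G])
    (G_semisimple : semisimple_lie_algebra At)
    (G_center : finite_set (@group_center G))
    (sigma theta : G -> G)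
    (sigma_inv : is_involution At sigma)
    (H : set G)
    (H_closed : is_closed_subgroup H)
    (H_component :
       connected_component H 1%g = connected_component (fixed_group sigma) 1%g)
    (theta_cartan : is_cartan_involution At theta)
    (theta_sigma : forall x, theta (sigma x) = sigma (theta x))
    (K : set G) (K_def : K = fixed_group theta)
    (a b : {vspace 'rV[R]_n})
    (a_max : maximal_abelian_subspace At
       (minus_eigenspace At theta `&` minus_eigenspace At sigma) a)
    (b_max : maximal_abelian_subspace At (minus_eigenspace At theta) b)
    (a_sub_b : (a <= b)%VS)
    (C : set 'rV[R]_n) (C_chamber : is_open_chamber At a C)
    (W : set G)
    (W_sub : W `<=` normalizer_in At a K `&` normalizer_in At b K)
    (W_reps : is_coset_reps (normalizer_in At a K)
       (normalizer_in At a (K `&` H) ** centralizer_in At a K) W)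
    (m : G -> 'M[R]_n) (m_metric : is_riemannian_metric At m)
    (c : R) (c_gt0 : 0 < c) :
  let A := Agroup At a in
  let Ball := identity_ball At m in
  exists ell eps0 : R,
    [/\ 1 < ell, 0 < eps0 &
      forall k x w h, K k -> Aplus At C x -> W w -> H h ->
        (forall alpha : dual_space a, simple_root At C alpha ->
           c <= deval alpha (logA At a x)) ->
        forall eps, 0 < eps < eps0 ->
          Ball eps ** [set (k * x * w * h)%g] `<=`
            ((K `&` Ball (ell * eps)) ** [set k]) **
            ((A `&` Ball (ell * eps)) ** [set x]) **
            ([set w] ** ((H `&` Ball (ell * eps)) ** [set h]))].
Proof.
move=> A Ball; subst K.
have th_inv : is_involution At theta by case: theta_cartan.
have [C1 [d1 [C10 d10 Hball]]] := ball_sub_gexp G_lie m_metric G_connected.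
have [C2 [d2 [C20 d20 Hdist]]] := dist_gexp_le G_lie m_metric.
have [M M0 HM] := Ad_fixed_bounded G_lie theta_cartan.
have [D D1 HD] := uniform_decomposition G_lie sigma_inv theta_cartan theta_sigma
  a_max C_chamber c_gt0.
have [r r0 Hr] := gexp_product_onto G_lie D1.
have D0 : 0 < D by apply: lt_le_trans D1.
(* Passing from the ball to a logarithm costs [C1], removing [k] costs [M], solving the product
   equation 4 and the splitting [D]. The factor [1 + M] in [N] also covers the return of the first
   component through [Ad k]. *)
pose T : R := D * (4 * (M * C1)); pose N : R := (1 + M) * T.
have MC0 : 0 < M * C1 by exact: mulr_gt0.
have T0 : 0 < T by rewrite !mulr_gt0.
have N0 : 0 < N by rewrite mulr_gt0 // addr_gt0.
(* The summand 1 gives [ell > 1] and the strict inequality defining the ball. The three bounds on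
   [eps] make [Hball], [Hr] and [Hdist] applicable. *)
exists (1 + C2 * N), (Num.min d1 (Num.min (r / (M * C1)) (d2 / N))); split.
- by rewrite ltrDl mulr_gt0.
- by rewrite !lt_min d10 !divr_gt0.
move=> k x w h Kk Ax Ww Hh alc eps /andP[e0].
rewrite !lt_min => /and3P[/ltW e1 /ltW e2 /ltW e3].
move: e2 e3; rewrite !ler_pdivlMr // => e2 e3.
have InBall X : `|X| <= N * eps -> Ball ((1 + C2 * N) * eps) (gexp At X).
  move=> hX; apply: le_lt_trans (Hdist X _) _; first by apply: le_trans hX _; rewrite mulrC.
  apply: le_lt_trans (_ : C2 * (N * eps) < _); first by rewrite ler_wpM2l // ltW.
  by rewrite mulrA mulrDl mul1r ltrDr.
have bT X : `|X| <= T * eps -> `|X| <= N * eps.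
  move=> hX; apply: le_trans hX _; rewrite /N mulrDl mul1r mulrDl lerDl.
  by apply: mulr_ge0; [apply: mulr_ge0|]; exact: ltW.
have [[tw wa] _] : (normalizer_in At a (fixed_group theta) `&`
  normalizer_in At b (fixed_group theta)) w by exact: W_sub.
pose X1 := logA At a x.
(* [logA] is a choice with default value 0. It is a true logarithm here: [x] is the exponential of a
   point in the closure of the chamber, and [a], being closed, contains that closure. *)
have [X1a eX1] : X1 \in a /\ lexp At X1 = x.
  rewrite /X1 /logA; case: xgetP => [_ -> []//|none].
  have [X0 CX0 eX0] := Ax; case: (none X0); split=> //.
  have [Z0 _ CE] := C_chamber.
  suff : closure [set u | u \in a] X0 by move=> /(@vspace_closed R n a).
  apply: closureS CX0 => Z; rewrite CE => /connected_component_sub; by case.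
have x_gexp : gexp At X1 = x by rewrite -(lexpE G_lie).
have [U [A' [Y [U0 A0 Y0 HUAY]]]] := HD w X1 tw wa X1a alc.
move=> _ [g' Bg' [_ -> <-]].
have [X eX bX] := Hball eps g' (introT andP (conj e0 e1)) Bg'.
have tkV : theta k^-1%g = k^-1%g := theta_wV theta_cartan Kk.
pose X' := Ad At k^-1%g X.
have bX' : `|X'| <= M * C1 * eps.
  by apply: le_trans (HM _ _ tkV) _; rewrite -mulrA ler_wpM2l // ltW.
pose Z Q := Ad At (gexp At X1) (Ad At w (Y Q)).
have Z0 : Z 0 = 0 by rewrite /Z Y0 !Ad0.
have EUAZ Q : Q = U Q + A' Q + Z Q.
  by have [[_ _ _ e] _] := HUAY Q 0; move: e; rewrite U0 A0 Y0 !subr0.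
have LUAZ Q Q' : [/\ `|U Q - U Q'| <= D * `|Q - Q'|, `|A' Q - A' Q'| <= D * `|Q - Q'| &
    `|Z Q - Z Q'| <= D * `|Q - Q'|].
  by have [_ [b1 b2 _ b4]] := HUAY Q Q'; split=> //; move: b4; rewrite !AdB.
have bXr : `|X'| <= r by apply: le_trans bX' _; rewrite mulrC.
have [Q bQ eQ] := Hr U A' Z U0 A0 Z0 EUAZ LUAZ X' bXr.
have [[tU aA sY _] [bU bA bY _]] := HUAY Q 0.
rewrite U0 A0 Y0 !subr0 in tU aA sY bU bA bY.
have DT : D * `|Q| <= T * eps.
  rewrite /T -mulrA; apply: ler_wpM2l; first exact: ltW.
  apply: le_trans bQ _; rewrite -mulrA; apply: ler_wpM2l => //.
have {}bU := le_trans bU DT; have {}bA := le_trans bA DT; have {}bY := le_trans bY DT.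
have bkU : `|Ad At k (U Q)| <= N * eps.
  apply: le_trans (HM _ _ Kk) _; rewrite /N -mulrA; apply: ler_pM => //; first exact: ltW.
  by rewrite lerDr.
exists (gexp At (Ad At k (U Q)) * k * (gexp At (A' Q) * x))%g.
  exists (gexp At (Ad At k (U Q)) * k)%g.
    exists (gexp At (Ad At k (U Q))); last by exists k.
    split; last exact: InBall.
    apply: (gexp_fixed G_lie th_inv).
    by rewrite (involution_Ad G_lie _ _ th_inv) Kk tU.
  exists (gexp At (A' Q) * x)%g => //; exists (gexp At (A' Q)); last by exists x.
  split; last by apply: InBall; exact: bT.
  by exists (A' Q) => //; rewrite (lexpE G_lie).
exists (w * (gexp At (Y Q) * h))%g.
  exists w => //; exists (gexp At (Y Q) * h)%g => //.
  exists (gexp At (Y Q)); last by exists h.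
  split; last by apply: InBall; exact: bT.
  apply: (@connected_component_sub _ _ 1%g); rewrite H_component.
  exact: (gexp_fixed_component G_lie sigma_inv).
(* These conjugations put the factors in place: [exp X * k = k * exp X'] and
   [exp (Z Q) * x * w = x * w * exp (Y Q)]. *)
have eX' : gexp At X = (k * gexp At X' * k^-1)%g.
  by rewrite (gexp_conj G_lie) /X' (AdVK G_lie).
have eZ : gexp At (Z Q) = (x * (w * gexp At (Y Q) * w^-1) * x^-1)%g.
  by rewrite /Z !(gexp_conj G_lie) x_gexp.
rewrite -eX eX' eQ eZ -(gexp_conj G_lie) !mulgA.
by rewrite !(mulgK, mulgVK).
Qed.
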